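(* Let $T\in\mathbb N\cup\{\infty\}$ and let $(\phi_{t,T})_{t\in[0,T]\cap\mathbb N}$ be a concave monetary utility functional process such that for every $t\in[0,T]\cap\mathbb N$ and $X\in\mathcal R^\infty_{t,T}$, $$\phi_{t,T}(X)=\operatorname{ess\,inf}_{a\in\mathcal D_{t,T}}\{\langle X,a\rangle_{t,T}-\gamma_{t,T}(a)\}$$ for a special penalty function $\gamma_{t,T}$ on $\mathcal D_{t,T}$. Assume that at least one of the following two conditions is satisfied: (1) For each $t\in[0,T]\cap\mathbb N$ and every finite stopping time $\theta$ such that $t\le\theta\le T$, $$\gamma_{t,T}(a)=\operatorname{ess\,sup}_{b\in\mathcal D_{\theta,T}}\gamma_{t,T}(a\oplus^\theta_\Omega b)+E\big[\gamma^{\rm ext}_{\theta,T}(a)\mid\mathcal F_t\big]\qquad\text{for all }a\in\mathcal D_{t,T}.$$ (2) $T\in\mathbb N$, and for each $t=0,\dots,T-1$, $$\gamma_{t,T}(a)=\operatorname{ess\,sup}_{b\in\mathcal D_{t+1,T}}\gamma_{t,T}(a\oplus^{t+1}_\Omega b)+E\big[\gamma^{\rm ext}_{t+1,T}(a)\mid\mathcal F_t\big]\qquad\text{for all }a\in\mathcal D_{t,T}.$$ Then $(\phi_{t,T})_{t\in[0,T]\cap\mathbb N}$ is time-consistent.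
   Context: Setup. $\mathbb N=\{0,1,2,\dots\}$; $(\Omega,\mathcal F,(\mathcal F_t)_{t\in\mathbb N},P)$ is a filtered probability space with $\mathcal F_0=\{\emptyset,\Omega\}$; stopping times are $(\mathcal F_t)$-stopping times. All equalities and inequalities between random variables or processes (for processes: simultaneously for all $t$) and all equalities and inclusions between events are understood $P$-almost surely. $\mathcal R^0$ is the space of real-valued adapted processes $(X_t)_{t\in\mathbb N}$ (a.s. equal processes are identified); $\mathcal R^\infty$ is the subspace of those with $\sup_{t}|X_t|\le m$ for some $m\in\mathbb R$. For stopping times $0\le\tau<\infty$, $\tau\le\theta\le\infty$, put $\pi_{\tau,\theta}(X)_t:=1_{\{\tau\le t\}}X_{t\wedge\theta}$ and $\mathcal R^\infty_{\tau,\theta}:=\pi_{\tau,\theta}\mathcal R^\infty$. $1_{[\tau,\infty)}$ and $1_{[\tau,\theta)}$ are the processes $t\mapsto1_{\{\tau\le t\}}$ and $t\mapsto1_{\{\tau\le t<\theta\}}$. Dual space. For $a\in\mathcal R^0$ put $a_{-1}:=0$, $\Delta a_t:=a_t-a_{t-1}$, $\|a\|_{\mathcal A^1}:=E[\sum_{t\in\mathbb N}|\Delta a_t|]$. $\mathcal A^1:=\{a\in\mathcal R^0:\|a\|_{\mathcal A^1}<\infty\}$, $\mathcal A^1_+:=\{a\in\mathcal A^1:\Delta a_t\ge0\ \forall t\}$. $\langle X,a\rangle_{\tau,\theta}:=E[\sum_{t\in[\tau,\theta]\cap\mathbb N}X_t\Delta a_t\mid\mathcal F_\tau]$. $(\mathcal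 A^1_{\tau,\theta})_+:=\pi_{\tau,\theta}\mathcal A^1_+$, $\mathcal D_{\tau,\theta}:=\{a\in(\mathcal A^1_{\tau,\theta})_+:\langle1,a\rangle_{\tau,\theta}=1\}$. Functionals. A monetary utility functional on $\mathcal R^\infty_{\tau,\theta}$ is a map $\phi:\mathcal R^\infty_{\tau,\theta}\to L^\infty(\mathcal F_\tau)$ with: (0) $\phi(1_AX)=1_A\phi(X)$ for all $X$ and $A\in\mathcal F_\tau$; (1) $\phi(X)\le\phi(Y)$ whenever $X\le Y$; (2) $\phi(X+m1_{[\tau,\infty)})=\phi(X)+m$ for all $X\in\mathcal R^\infty_{\tau,\theta}$, $m\in L^\infty(\mathcal F_\tau)$. It is concave if (3) $\phi(\lambda X+(1-\lambda)Y)\ge\lambda\phi(X)+(1-\lambda)\phi(Y)$ for all $X,Y$ and $\lambda\in L^\infty(\mathcal F_\tau)$, $0\le\lambda\le1$. For $X\in\mathcal R^\infty$, $\phi(X):=\phi(\pi_{\tau,\theta}(X))$. Processes. A concave monetary utility functional process $(\phi_{t,T})_{t\in[0,T]\cap\mathbb N}$ consists of a concave monetary utility functional $\phi_{t,T}$ on $\mathcal R^\infty_{t,T}$ for each $t$. For a finite stopping time $\tau\le T$ and $X\in\mathcal R^\infty_{\tau,T}$, $\phi_{\tau,T}(X):=\sum_{t\in[0,T]\cap\mathbb N}\phi_{t,T}(1_{\{\tau=t\}}X)$. The process is time-consistent if $\phi_{t,T}(X)=\phi_{t,T}(X1_{[t,\theta)}+\phi_{\theta,T}(X)1_{[\theta,\infty)})$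 for each $t\in[0,T]\cap\mathbb N$, every finite stopping time $\theta$ with $t\le\theta\le T$ and all $X\in\mathcal R^\infty_{t,T}$. Penalty functions. A penalty function $\gamma$ on $\mathcal D_{\tau,\theta}$ is a map from $\mathcal D_{\tau,\theta}$ to the measurable functions $(\Omega,\mathcal F_\tau)\to[-\infty,0]$ with $\operatorname{ess\,sup}_{a\in\mathcal D_{\tau,\theta}}\gamma(a)=0$; it is special if $\gamma(1_Aa+1_{A^c}b)=1_A\gamma(a)+1_{A^c}\gamma(b)$ for all $a,b\in\mathcal D_{\tau,\theta}$, $A\in\mathcal F_\tau$ (with $0\cdot(-\infty)=0$). Given special penalty functions $\gamma_{t,T}$ on $\mathcal D_{t,T}$, $t\in[0,T]\cap\mathbb N$, for a finite stopping time $\theta\le T$ the special penalty function $\gamma_{\theta,T}$ on $\mathcal D_{\theta,T}$ is $\gamma_{\theta,T}(a):=\sum_{t\in[0,T]\cap\mathbb N}1_{\{\theta=t\}}\gamma_{t,T}(1_{\{\theta=t\}}a+1_{\{\theta\ne t\}}1_{[t,\infty)})$. For $a\in\mathcal D_{0,T}$ (note $\mathcal D_{t,T}\subset\mathcal D_{0,T}$), the process $\overset{\to\theta}{a}\in\mathcal D_{\theta,T}$ is $\frac{a-a_{\theta-1}}{\langle1,a\rangle_{\theta,T}}1_{[\theta,\infty)}$ on $\{\langle1,a\rangle_{\theta,T}>0\}$ and $1_{[\theta,\infty)}$ on $\{\langle1,a\rangle_{\theta,T}=0\}$; and $\gamma^{\rm ext}_{\theta,T}(a):=\langle1,a\rangle_{\theta,T}\,\gamma_{\theta,T}(\overset{\to\theta}{a})$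 on $\{\langle1,a\rangle_{\theta,T}>0\}$, $:=0$ on $\{\langle1,a\rangle_{\theta,T}=0\}$. For measurable $f\le0$ (values in $[-\infty,0]$), $E[f\mid\mathcal F_t]:=\lim_{n\to-\infty}E[f\vee n\mid\mathcal F_t]$. Concatenation. For $a,b\in\mathcal A^1_+$, a finite stopping time $\theta$ and $A\in\mathcal F_\theta$, $(a\oplus^\theta_Ab)_t:=a_t$ on $\{t<\theta\}\cup A^c\cup\{\langle1,b\rangle_{\theta,\infty}=0\}$ and $(a\oplus^\theta_Ab)_t:=a_{\theta-1}+\frac{\langle1,a\rangle_{\theta,\infty}}{\langle1,b\rangle_{\theta,\infty}}(b_t-b_{\theta-1})$ on $\{t\ge\theta\}\cap A\cap\{\langle1,b\rangle_{\theta,\infty}>0\}$, with $a_{-1}=b_{-1}=0$. *)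

(* Defs.v *)
From HB Require Import structures.
From mathcomp Require Import all_boot all_order all_algebra.
From mathcomp Require Import all_classical all_reals all_analysis.
From mathcomp Require Import measurable_realfun.

Set Implicit Arguments.
Unset Strict Implicit.
Unset Printing Implicit Defensive.

Import Order.TTheory GRing.Theory Num.Theory.
Import numFieldNormedType.Exports.

Local Open Scope classical_set_scope.
Local Open Scope ring_scope.

(* Elements of N \cup {oo} are represented in [option nat], [None] being oo. *)
Definition le_time (x y : option nat) : bool :=
  match x, y with
  | _, None => true
  | None, Some _ => false
  | Some m, Some n => (m <= n)%N
  end.

Definition min_time (m : nat) (y : option nat) : nat :=
  if y is Some n then minn m n else m.

Section Defs.
Context (d : measure_display) (Omega : measurableType d) (R : realType).
Variable P : probability Omega R.

Local Notation process := (nat -> Omega -> R).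
Local Notation time := (Omega -> option nat).

(* Random variables and processes are represented by functions; equality is
   replaced by almost sure equality, and for processes this means equality
   for all times outside of one single null set. *)

Definition aeq (U : Type) (f g : Omega -> U) : Prop :=
  {ae P, forall w, f w = g w}.

Definition aeqp (X Y : process) : Prop :=
  {ae P, forall w, forall t, X t w = Y t w}.

Definition measurable_wrt (G : set (set Omega)) (d' : measure_display)
    (U : measurableType d') (f : Omega -> U) : Prop :=
  measurable_fun [set: g_sigma_algebraType G]
    (f : g_sigma_algebraType G -> U).

(* [L0 G f] : the almost sure class of [f] belongs to L^0(G), that is, it
   contains a G-measurable function.  The filtration is not assumed to be
   complete, so [f] itself need not be G-measurable.  This makes all the
   domains below stable under almost sure equality. *)
Definition L0 (G : set (set Omega)) (d' : measure_display)
    (U : measurableType d') (f : Omega -> U) : Prop :=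
  measurable_fun setT f /\ exists2 g : Omega -> U, measurable_wrt G g & aeq f g.

Definition Linf (G : set (set Omega)) (f : Omega -> R) : Prop :=
  L0 G f /\ exists m : R, {ae P, forall w, `|f w| <= m}.

(* [condexp G f] is a G-measurable version of E[f | G], for integrable [f]. *)
Definition is_condexp (G : set (set Omega)) (f g : Omega -> R) : Prop :=
  [/\ measurable_wrt G g, P.-integrable setT (EFin \o g) &
      forall A, G A ->
        (\int[P]_(w in A) (g w)%:E = \int[P]_(w in A) (f w)%:E)%E].

Definition condexp (G : set (set Omega)) (f : Omega -> R) : Omega -> R :=
  xget (cst 0) (is_condexp G f).

(* E[f | G] for [f] with values in [-oo, 0]. *)
Definition condexp_npos (G : set (set Omega)) (f : Omega -> \bar R)
    : Omega -> \bar R :=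
  fun w => limn (fun n : nat =>
    (condexp G (fun w' => fine (maxe (f w') (- n%:R)%:E)) w)%:E).

(* Essential supremum and infimum of a family of random variables; the
   library's [ess_sup] is the essential supremum of one single function. *)
Definition is_esssup (S : set (Omega -> \bar R)) (g : Omega -> \bar R) : Prop :=
  [/\ measurable_fun setT g,
      forall f, S f -> {ae P, forall w, (f w <= g w)%E} &
      forall h, measurable_fun setT h ->
        (forall f, S f -> {ae P, forall w, (f w <= h w)%E}) ->
        {ae P, forall w, (g w <= h w)%E}].

Definition is_essinf (S : set (Omega -> \bar R)) (g : Omega -> \bar R) : Prop :=
  [/\ measurable_fun setT g,
      forall f, S f -> {ae P, forall w, (g w <= f w)%E} &
      forall h, measurable_fun setT h ->
        (forall f, S f -> {ae P, forall w, (h w <= f w)%E}) ->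
        {ae P, forall w, (h w <= g w)%E}].

Definition esssup (S : set (Omega -> \bar R)) : Omega -> \bar R :=
  xget (cst 0%E) (is_esssup S).

Definition essinf (S : set (Omega -> \bar R)) : Omega -> \bar R :=
  xget (cst 0%E) (is_essinf S).

Variable F : nat -> set (set Omega).

Definition filtration : Prop :=
  [/\ forall t, sigma_algebra setT (F t),
      forall t, F t `<=` measurable &
      forall s t, (s <= t)%N -> F s `<=` F t].

Definition stopping_time (tau : time) : Prop :=
  forall t : nat, F t [set w | le_time (tau w) (Some t)].

Definition ae_finite (tau : time) : Prop := {ae P, forall w, tau w != None}.

Definition ae_le_time (sigma tau : time) : Prop :=
  {ae P, forall w, le_time (sigma w) (tau w)}.

(* The sigma-algebra F_tau. *)
Definition stopped (tau : time) : set (set Omega) :=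
  [set A | measurable A /\
     forall t : nat, F t (A `&` [set w | le_time (tau w) (Some t)])].

Definition cst_time (t : nat) : time := cst (Some t).

Definition R0 (X : process) : Prop := forall t, L0 (F t) (X t).

Definition Rinf (X : process) : Prop :=
  R0 X /\ exists m : R, {ae P, forall w, forall t, `|X t w| <= m}.

Definition proj (tau theta : time) (X : process) : process :=
  fun t w => if le_time (tau w) (Some t) then X (min_time t (theta w)) w else 0.

(* The image of a class of processes under [proj], up to a.s. equality. *)
Definition proj_image (tau theta : time) (S : process -> Prop) (X : process)
    : Prop :=
  R0 X /\ exists2 Y, S Y & aeqp X (proj tau theta Y).

Definition Rinf_on (tau theta : time) : process -> Prop :=
  proj_image tau theta Rinf.

(* 1_[tau, oo) and 1_[tau, theta) *)
Definition ind_from (tau : time) : process :=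
  fun t w => (le_time (tau w) (Some t))%:R.

Definition ind_between (tau theta : time) : process :=
  fun t w =>
    (le_time (tau w) (Some t) && ~~ le_time (theta w) (Some t))%:R.

(* a_{t-1}, with a_{-1} = 0 *)
Definition prev (a : process) (t : nat) (w : Omega) : R :=
  if t is s.+1 then a s w else 0.

(* a_{theta-1}; the value on {theta = oo} is immaterial *)
Definition prev_at (a : process) (theta : time) (w : Omega) : R :=
  if theta w is Some t then prev a t w else 0.

Definition increment (a : process) : process :=
  fun t w => a t w - prev a t w.

Definition A1_norm (a : process) : \bar R :=
  (\int[P]_w \sum_(t <oo) `|increment a t w|%:E)%E.

Definition A1 (a : process) : Prop := R0 a /\ (A1_norm a < +oo)%E.

Definition A1_pos (a : process) : Prop :=
  A1 a /\ {ae P, forall w, forall t, 0 <= increment a t w}.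

Definition pairing (tau theta : time) (X a : process) : Omega -> R :=
  condexp (stopped tau) (fun w => limn (fun n : nat =>
    \sum_(0 <= s < n | le_time (tau w) (Some s) && le_time (Some s) (theta w))
      X s w * increment a s w)).

(* <1, a>_{tau, theta} *)
Definition mass (tau theta : time) (a : process) : Omega -> R :=
  pairing tau theta (fun _ _ => 1) a.

Definition A1_pos_on (tau theta : time) : process -> Prop :=
  proj_image tau theta A1_pos.

Definition dual (tau theta : time) : set process :=
  [set a | A1_pos_on tau theta a /\ aeq (mass tau theta a) (cst 1)].

Definition monetary_utility_functional (tau theta : time)
    (phi : process -> Omega -> R) : Prop :=
  [/\ forall X, Rinf_on tau theta X -> Linf (stopped tau) (phi X),
      forall X A, Rinf_on tau theta X -> stopped tau A ->
        aeq (phi (fun t w => \1_A w * X t w)) (fun w => \1_A w * phi X w),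
      forall X Y, Rinf_on tau theta X -> Rinf_on tau theta Y ->
        {ae P, forall w, forall t, X t w <= Y t w} ->
        {ae P, forall w, phi X w <= phi Y w} &
      forall X m, Rinf_on tau theta X -> Linf (stopped tau) m ->
        aeq (phi (fun t w => X t w + m w * ind_from tau t w))
            (fun w => phi X w + m w)].

Definition concave_monetary_utility_functional (tau theta : time)
    (phi : process -> Omega -> R) : Prop :=
  monetary_utility_functional tau theta phi /\
  forall X Y l, Rinf_on tau theta X -> Rinf_on tau theta Y ->
    Linf (stopped tau) l -> {ae P, forall w, 0 <= l w <= 1} ->
    {ae P, forall w,
      l w * phi X w + (1 - l w) * phi Y w
      <= phi (fun t w' => l w' * X t w' + (1 - l w') * Y t w') w}.

Variable T : option nat.
Local Notation Tmax := (cst T : time).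

(* [phi t] is phi_{t,T}; it is only relevant for t <= T. *)
Definition utility_process (phi : nat -> process -> Omega -> R) : Prop :=
  forall t, le_time (Some t) T ->
    concave_monetary_utility_functional (cst_time t) Tmax (phi t).

(* phi_{tau,T} *)
Definition utility_at (phi : nat -> process -> Omega -> R) (tau : time)
    (X : process) : Omega -> R :=
  fun w => limn (fun n : nat => \sum_(0 <= t < n | le_time (Some t) T)
    phi t (fun s w' => (tau w' == Some t)%:R * X s w') w).

Definition time_consistent (phi : nat -> process -> Omega -> R) : Prop :=
  forall t, le_time (Some t) T ->
  forall theta, stopping_time theta -> ae_finite theta ->
    ae_le_time (cst_time t) theta -> ae_le_time theta Tmax ->
  forall X, Rinf_on (cst_time t) Tmax X ->
    aeq (phi t X)
        (phi t (fun s w =>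
           X s w * ind_between (cst_time t) theta s w +
           utility_at phi theta (proj theta Tmax X) w * ind_from theta s w)).

(* The second clause says that gamma is defined on a.s. classes. *)
Definition penalty (tau theta : time) (gamma : process -> Omega -> \bar R)
    : Prop :=
  [/\ forall a, dual tau theta a ->
        L0 (stopped tau) (gamma a) /\ {ae P, forall w, (gamma a w <= 0)%E},
      forall a b, dual tau theta a -> dual tau theta b -> aeqp a b ->
        aeq (gamma a) (gamma b) &
      aeq (esssup [set gamma a | a in dual tau theta]) (cst 0%E)].

Definition special_penalty (tau theta : time)
    (gamma : process -> Omega -> \bar R) : Prop :=
  penalty tau theta gamma /\
  forall a b A, dual tau theta a -> dual tau theta b -> stopped tau A ->
    aeq (gamma (fun t w => \1_A w * a t w + \1_(~` A) w * b t w))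
        (fun w => (\1_A w)%:E * gamma a w + (\1_(~` A) w)%:E * gamma b w)%E.

(* gamma_{theta,T} *)
Definition penalty_at (gamma : nat -> process -> Omega -> \bar R)
    (theta : time) (a : process) : Omega -> \bar R :=
  fun w => (\sum_(t <oo | le_time (Some t) T)
    (theta w == Some t)%:R%:E *
    gamma t (fun s w' => ((theta w' == Some t)%:R * a s w' +
                (theta w' != Some t)%:R * ind_from (cst_time t) s w')%R) w)%E.

(* The renormalized future part of a after theta. *)
Definition future (theta : time) (a : process) : process :=
  fun t w =>
    if 0 < mass theta Tmax a w then
      (a t w - prev_at a theta w) / mass theta Tmax a w * ind_from theta t w
    else ind_from theta t w.

Definition penalty_ext (gamma : nat -> process -> Omega -> \bar R)
    (theta : time) (a : process) : Omega -> \bar R :=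
  fun w =>
    if 0 < mass theta Tmax a w then
      ((mass theta Tmax a w)%:E * penalty_at gamma theta (future theta a) w)%E
    else 0%E.

Definition concat (theta : time) (A : set Omega) (a b : process) : process :=
  let infty : time := cst None in
  fun t w =>
    if [&& le_time (theta w) (Some t), w \in A & 0 < mass theta infty b w] then
      prev_at a theta w +
      mass theta infty a w / mass theta infty b w *
      (b t w - prev_at b theta w)
    else a t w.

Definition penalty_decomposition (gamma : nat -> process -> Omega -> \bar R)
    (t : nat) (theta : time) : Prop :=
  forall a, dual (cst_time t) Tmax a ->
    aeq (gamma t a)
        (fun w =>
           esssup [set gamma t (concat theta setT a b) | b in dual theta Tmax] w
           + condexp_npos (stopped (cst_time t)) (penalty_ext gamma theta a) w)%E.

End Defs.

(* Main.v *)
From Pilot Require Import Defs.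
From HB Require Import structures.
From mathcomp Require Import all_boot all_order all_algebra.
From mathcomp Require Import all_classical all_reals all_analysis.
From mathcomp Require Import measurable_realfun.
From mathcomp Require Import ring.

(** Let theta be a stopping time between t and T, let X be bounded on [t, T],
    and let Z be the process that follows X before theta and stays at
    Phi = phi_{theta,T}(X) from theta on.  The claim is phi_t(X) = phi_t(Z).

    For a in D_{t,T} put m = <1, a>_{theta,T}.  The pairings of X and of Z with
    a differ only from theta on, and the tower property gives
<<
      <X, a>_t - <Z, a>_t = E[v - m Phi | F_t],
>>
    where v is the conditional expectation, given F_theta, of the integral of X
    against a over [theta, oo) ([pairing_sub_stopped_utility]).  On
    {theta = s, m > 0} the variable v is m times the pairing of X with the
    normalized future of a, an element of D_{s,T} ([later_cond_future]).
    Moreover a and its concatenation with any b in D_{theta,T} have the same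
    conditional mass from theta on, where Z is constant, so that they give the
    same pairing with Z ([pairing_stopped_utility_concat]).

    phi_t(Z) <= phi_t(X): the representation of phi_s, applied to the normalized
    future of a, gives gamma^ext_theta(a) <= v - m Phi, whence
    E[gamma^ext_theta(a) | F_t] <= <X, a>_t - <Z, a>_t.  The representation of
    phi_t(Z), applied to the concatenations, bounds the essential supremum of
    their penalties by <Z, a>_t - phi_t(Z).  Adding up,
    gamma_t(a) <= <X, a>_t - phi_t(Z) for all a ([stopped_utility_le]).

    phi_t(X) - e <= phi_t(Z): a measurable selection on each {theta = s}
    produces b in D_{theta,T} that is optimal up to e for Phi.  Let c be the
    concatenation of a and b.  Where m > 0 its normalized future is b, so
    gamma^ext_theta(c) >= v_c - m Phi - e m, where E[m | F_t] <= 1.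
    Concatenating c again with b' is the same as concatenating a with b', and
    the decomposition of gamma_t(c), together with
    phi_t(X) <= <X, c>_t - gamma_t(c), bounds the essential supremum of the
    penalties of the concatenations of a, hence gamma_t(a), by
    <Z, a>_t + e - phi_t(X) ([le_stopped_utility_add]).

    This settles the first condition.  The second one gives the identity for
    theta = t+1 only; backward induction on t extends it to all theta, using
    max(theta, t+1) on the event {theta > t} and the locality of phi_t
    ([time_consistent_recursion]).

    Conditional expectations are Radon-Nikodym derivatives; they are local on
    events where two sigma-algebras have the same trace, which is what relates
    F_theta to F_s on {theta = s}.  The essential infimum of a family is the
    infimum of a sequence of its members, which makes the selection possible.
    The dual sets are handled through a pathwise description ([dualP]). *)

Set Implicit Arguments.
Unset Strict Implicit.
Unset Printing Implicit Defensive.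

Import Order.TTheory GRing.Theory Num.Theory.
Import numFieldNormedType.Exports.

Local Open Scope classical_set_scope.
Local Open Scope ring_scope.

(* These names also denote operations on cyclic sequences and on products. *)
Local Notation prev := Pilot.Defs.prev.
Local Notation proj := Pilot.Defs.proj.
Local Notation prev_at := Pilot.Defs.prev_at.

(** * Sub-sigma-algebras *)

Section SubSigma.
Context (d : measure_display) (Omega : measurableType d) (R : realType).
Variable P : probability Omega R.

(** A sub-sigma-algebra of the ambient one. *)
Definition subsigma (G : set (set Omega)) : Prop :=
  sigma_algebra setT G /\ G `<=` measurable.

Variable G : set (set Omega).
Hypothesis sG : subsigma G.

Lemma subsigma_measurable A : G A -> measurable A.
Proof. by case: sG => _; apply. Qed.

Lemma subsigma_generated : <<s G >> = G.
Proof. by apply: sigma_algebra_id; case: sG. Qed.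

Lemma subsigma0 : G set0.
Proof. by case: sG => -[]. Qed.

Lemma subsigmaC A : G A -> G (~` A).
Proof. by case: sG => -[_ h _] _ /h; rewrite setTD. Qed.

Lemma subsigma_bigcup (A : (set Omega)^nat) :
  (forall i, G (A i)) -> G (\bigcup_i A i).
Proof. by case: sG => -[_ _ h] _ /h. Qed.

Lemma subsigmaT : G setT.
Proof. by rewrite -setC0; apply: subsigmaC; exact: subsigma0. Qed.

Lemma subsigma_cst (Q : Prop) : G [set _ | Q].
Proof.
have [q|q] := pselect Q.
- rewrite (_ : [set _ | _] = setT); first exact: subsigmaT.
  by apply/seteqP; split.
- rewrite (_ : [set _ | _] = set0); first exact: subsigma0.
  by apply/seteqP; split.
Qed.

Lemma subsigmaU A B : G A -> G B -> G (A `|` B).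
Proof.
move=> GA GB; rewrite -bigcup2E; apply: subsigma_bigcup => -[|[|n]] //=.
exact: subsigma0.
Qed.

Lemma subsigmaI A B : G A -> G B -> G (A `&` B).
Proof.
move=> GA GB; rewrite -(setCK (A `&` B)) setCI.
by apply: subsigmaC; apply: subsigmaU; exact: subsigmaC.
Qed.

Lemma subsigmaD A B : G A -> G B -> G (A `\` B).
Proof. by move=> GA GB; rewrite setDE; apply: subsigmaI => //; apply: subsigmaC. Qed.

Lemma measurable_wrtP d' (U : measurableType d') (f : Omega -> U) :
  measurable_wrt G f <-> forall B, measurable B -> G (f @^-1` B).
Proof.
split=> [mf B mB|h _ B mB].
- by have := mf measurableT B mB; rewrite setTI /measurable /= subsigma_generated.
- by rewrite setTI /measurable /= subsigma_generated; exact: h.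
Qed.

Lemma measurable_wrt_preimage d' (U : measurableType d') (f : Omega -> U) B :
  measurable_wrt G f -> measurable B -> G (f @^-1` B).
Proof. by move=> /measurable_wrtP; apply. Qed.

Lemma measurable_wrt_ltr (f g : Omega -> R) : measurable_wrt G f ->
  measurable_wrt G g -> G [set w | f w < g w].
Proof.
move=> mf mg; have mB : measurable_wrt G (fun w => g w - f w).
  by apply: measurable_funB.
have := measurable_wrt_preimage mB (measurable_itv `]0, +oo[).
congr (G _); apply/seteqP.
by split=> w /=; rewrite in_itv/= andbT subr_gt0.
Qed.

Lemma measurable_wrt_fun d' (U : measurableType d') (f : Omega -> U) :
  measurable_wrt G f -> measurable_fun setT f.
Proof.
move=> /measurable_wrtP h _ B mB; rewrite setTI.
exact/subsigma_measurable/h.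
Qed.

Lemma measurable_wrt_indic A : G A -> measurable_wrt G (\1_A : Omega -> R).
Proof.
move=> GA; rewrite /measurable_wrt.
by apply: (@measurable_indic _ (g_sigma_algebraType G) R); rewrite /measurable /= subsigma_generated.
Qed.

Lemma measurable_id_wrt :
  measurable_fun setT (id : Omega -> g_sigma_algebraType G).
Proof.
by move=> _ B; rewrite setTI /measurable /= subsigma_generated => /subsigma_measurable.
Qed.

Local Open Scope ereal_scope.
Import HBNNSimple.

(** The integral of Y f is computed from the integrals of f over sets of G,
   by approximating Y by G-measurable simple functions. *)
Let pull_expand (Y : Omega -> R) : measurable_wrt G Y ->
  (forall w, 0 <= Y w)%R ->
  exists (h : nat -> Omega -> R), (forall n r, G (h n @^-1` [set r])) /\
    forall (f : Omega -> R) A,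
      measurable_fun setT f -> (forall w, 0 <= f w)%R -> G A ->
  \int[P]_(w in A) (Y w * f w)%:E =
  limn (fun n => \sum_(r \in range (h n))
     (r%:E * \int[P]_(w in A `&` h n @^-1` [set r]) (f w)%:E)).
Proof.
move=> mY Y0.
have mY' : measurable_fun [set: g_sigma_algebraType G] (EFin \o Y) by exact/measurable_EFinP.
pose h := nnsfun_approx measurableT mY'.
have hG n r : G (h n @^-1` [set r]).
  rewrite -(congr1 (@^~ (h n @^-1` [set r])) subsigma_generated).
  exact: (measurable_sfunP (h n) (measurable_set1 r)).
have mh n : measurable_fun [set: Omega] (h n : Omega -> R).
  by apply: measurable_wrt_fun; exact: measurable_funP (h n).
exists (fun n => h n); split => // f A mf f0 GA.
have mA := subsigma_measurable GA.
transitivity (limn (fun n => \int[P]_(w in A) ((h n w)%:E * (f w)%:E))).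
  rewrite -monotone_convergence //.
  - apply: eq_integral => w _; apply/esym/cvg_lim => //.
    rewrite EFinM; apply: cvgeZr => //.
    apply: (@cvg_nnsfun_approx _ (g_sigma_algebraType G) R setT measurableT _ mY') => //.
    by move=> x _; rewrite lee_fin.
  - move=> n; apply: emeasurable_funM; apply: measurable_funTS; exact/measurable_EFinP.
  - by move=> n w _; rewrite mule_ge0 ?lee_fin.
  - move=> w _ m n mn; rewrite lee_wpmul2r ?lee_fin//.
    by have /lefP := @nd_nnsfun_approx _ (g_sigma_algebraType G) R setT measurableT _ mY' _ _ mn.
congr (limn _); apply/funext => n.
transitivity (\int[P]_(x in A) (\sum_(y \in range (h n))
    (y * \1_(h n @^-1` [set y]) x)%:E * (f x)%:E)).
  apply: eq_integral => x xE.
  rewrite -ge0_mule_fsuml => [|y].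
    by rewrite fsumEFin //; congr (_%:E * _); exact: fimfunE.
  exact: (nnfun_muleindic_ge0 (h n)).
have mind r : measurable_fun A (fun x => (r * \1_(h n @^-1` [set r]) x)%:E).
  apply/measurable_EFinP; apply: measurable_funTS; apply: measurable_funM => //.
  by apply: measurable_indic; exact/subsigma_measurable/hG.
rewrite ge0_integral_fsum//; last 2 first.
  - by move=> y; apply: emeasurable_funM => //; apply/measurable_EFinP/measurable_funTS.
  - move=> m y Ay; rewrite mule_ge0 ?lee_fin//.
    exact: (nnfun_muleindic_ge0 (h n)).
apply: eq_fsbigr => r rhn.
have r0 : (0 <= r)%R by move: rhn; rewrite inE => -[t _ <-].
rewrite setIC.
under eq_integral do rewrite EFinM -muleA.
rewrite ge0_integralZl//.
- congr (_ * _); rewrite integral_mkcondl. apply: eq_integral => x _.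
  by rewrite epatch_indic muleC.
- apply: emeasurable_funM; apply/measurable_EFinP/measurable_funTS => //.
  by apply: measurable_indic; exact/subsigma_measurable/hG.
- by move=> w Aw; rewrite mule_ge0 ?lee_fin.
Qed.

(** Integrals over the sets of G determine the integrals against nonnegative
    G-measurable functions. *)
Lemma ge0_integral_pull (Y f g : Omega -> R) : measurable_wrt G Y ->
  (forall w, 0 <= Y w)%R ->
  measurable_fun setT f -> (forall w, 0 <= f w)%R ->
  measurable_fun setT g -> (forall w, 0 <= g w)%R ->
  (forall A, G A -> \int[P]_(w in A) (f w)%:E = \int[P]_(w in A) (g w)%:E) ->
  forall A, G A ->
  \int[P]_(w in A) (Y w * f w)%:E = \int[P]_(w in A) (Y w * g w)%:E.
Proof.
move=> mY Y0 mf f0 mg g0 fg A GA.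
have [h [hG hE]] := pull_expand mY Y0.
rewrite !hE//; congr (limn _); apply/funext => n.
by apply: eq_fsbigr => r _; rewrite fg//; exact: subsigmaI.
Qed.

End SubSigma.

(** * Integrability and conditional expectation *)

Section Integrability.
Context (d : measure_display) (Omega : measurableType d) (R : realType).
Variable P : probability Omega R.
Implicit Types f g : Omega -> R.
Local Notation intg f := (P.-integrable setT (EFin \o f)).

Lemma integrable_measurable f : intg f -> measurable_fun setT f.
Proof. by move=> /measurable_int/measurable_EFinP. Qed.

Lemma integrable_dominated f g : measurable_fun setT f -> intg g ->
  {ae P, forall w, `|f w| <= g w} -> intg f.
Proof.
move=> mf /integrableP[mg ig] fg; apply/integrableP.
split; first exact/measurable_EFinP.
apply: le_lt_trans ig; apply: ae_ge0_le_integral => //.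
- by apply: measurableT_comp => //; exact/measurable_EFinP.
- exact: measurableT_comp.
- apply: filterS fg => w h _ /=; rewrite lee_fin (le_trans h)//.
  exact: ler_norm.
Qed.

Lemma integrable_aeq f g : measurable_fun setT g -> aeq P f g -> intg f -> intg g.
Proof.
move=> mg fg fi; apply: (@integrable_dominated g (fun w => `|f w|)) => //.
- exact: integrable_norm.
- by apply: filterS fg => w ->.
Qed.

Lemma integrable_add f g : intg f -> intg g -> intg (fun w => f w + g w).
Proof. by move=> fi gi; have := integrableD measurableT fi gi. Qed.

Lemma integrable_sub f g : intg f -> intg g -> intg (fun w => f w - g w).
Proof. by move=> fi gi; have := integrableB measurableT fi gi. Qed.

Lemma integrable_scale c f : intg f -> intg (fun w => c * f w).
Proof. by move=> fi; have := integrableZl measurableT c fi. Qed.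

Lemma integrable_const (c : R) : intg (cst c).
Proof. exact: finite_measure_integrable_cst. Qed.

Lemma integrable_bounded c f : measurable_fun setT f ->
  {ae P, forall w, `|f w| <= c} -> intg f.
Proof. by move=> mf h; apply: (integrable_dominated mf (integrable_const c)). Qed.

Lemma integrable_mul_bounded c f g : measurable_fun setT f -> intg g ->
  {ae P, forall w, `|f w| <= c} -> intg (fun w => f w * g w).
Proof.
move=> mf gi fc; apply: (@integrable_dominated _ (fun w => c * `|g w|)).
- by apply: measurable_funM => //; exact: integrable_measurable.
- by apply: integrable_scale; exact: integrable_norm.
- by apply: filterS fc => w h; rewrite normrM ler_wpM2r.
Qed.

Local Open Scope ereal_scope.

Lemma integral_aeq f g A : measurable A -> measurable_fun setT f ->
  measurable_fun setT g -> {ae P, forall w, A w -> f w = g w} ->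
  \int[P]_(w in A) (f w)%:E = \int[P]_(w in A) (g w)%:E.
Proof.
move=> mA mf mg fg; apply: ae_eq_integral => //.
- by apply/measurable_EFinP; exact: measurable_funTS.
- by apply/measurable_EFinP; exact: measurable_funTS.
- by apply: filterS fg => w h Aw; rewrite h.
Qed.

Lemma integrable_onS f A : measurable A -> intg f -> P.-integrable A (EFin \o f).
Proof. by move=> mA; apply: integrableS. Qed.

Lemma ae_le_integral f g A : measurable A -> intg f -> intg g ->
  {ae P, forall w, A w -> (f w <= g w)%R} ->
  \int[P]_(w in A) (f w)%:E <= \int[P]_(w in A) (g w)%:E.
Proof.
move=> mA fi gi fg.
have mf : measurable_fun A (EFin \o f) by apply: measurable_int (integrable_onS mA fi).
have mg : measurable_fun A (EFin \o g) by apply: measurable_int (integrable_onS mA gi).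
rewrite integralE [leRHS]integralE leeB//.
- apply: ae_ge0_le_integral => //; [exact: measurable_funepos..|].
  apply: filterS fg => w h Aw; apply: (@funepos_le _ _ [set w] (EFin \o f) (EFin \o g)) => //.
    by move=> x /set_mem ->; rewrite lee_fin h.
  exact: mem_set.
- apply: ae_ge0_le_integral => //; [exact: measurable_funeneg..|].
  apply: filterS fg => w h Aw; apply: (@funeneg_le _ _ [set w] (EFin \o f) (EFin \o g)) => //.
    by move=> x /set_mem ->; rewrite lee_fin h.
  exact: mem_set.
Qed.

Lemma integral_subE f g A : measurable A -> intg f -> intg g ->
  \int[P]_(w in A) (f w - g w)%:E =
  \int[P]_(w in A) (f w)%:E - \int[P]_(w in A) (g w)%:E.
Proof. by move=> mA fi gi; rewrite -integralB_EFin//; exact: integrable_onS. Qed.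

Lemma integral_addE f g A : measurable A -> intg f -> intg g ->
  \int[P]_(w in A) (f w + g w)%:E =
  \int[P]_(w in A) (f w)%:E + \int[P]_(w in A) (g w)%:E.
Proof. by move=> mA fi gi; rewrite -integralD_EFin//; exact: integrable_onS. Qed.

Lemma integral_ae_set f A B : measurable A -> measurable B ->
  measurable_fun setT f -> {ae P, forall w, A w <-> B w} ->
  \int[P]_(w in A) (f w)%:E = \int[P]_(w in B) (f w)%:E.
Proof.
move=> mA mB mf AB; rewrite integral_mkcond [RHS]integral_mkcond.
apply: ae_eq_integral => //.
- by apply/(measurable_restrictT _ mA); apply: measurable_funTS; exact/measurable_EFinP.
- by apply/(measurable_restrictT _ mB); apply: measurable_funTS; exact/measurable_EFinP.
- apply: filterS AB => w ABw _; rewrite /patch.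
  have -> // : (w \in A) = (w \in B).
  by apply/idP/idP => /set_mem h; apply/mem_set; apply/ABw.
Qed.

Lemma integral_fin f A : measurable A -> intg f ->
  \int[P]_(w in A) (f w)%:E \is a fin_num.
Proof. by move=> mA fi; apply: integrable_fin_num => //; exact: integrable_onS. Qed.

End Integrability.

Section Condexp.
Context (d : measure_display) (Omega : measurableType d) (R : realType).
Variable P : probability Omega R.
Implicit Types (f g : Omega -> R) (G H : set (set Omega)).
Local Notation intg f := (P.-integrable setT (EFin \o f)).
Local Open Scope ereal_scope.
Local Open Scope charge_scope.

(** The conditional expectation is the Radon-Nikodym derivative, on G, of the
   charge A |-> int_A f. *)
Lemma condexp_exists G f : subsigma G -> intg f ->
  exists g, is_condexp P G f g.
Proof.
move=> sG fi.
pose gT := g_sigma_algebraType G.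
have mid := measurable_id_wrt sG.
pose idm : {mfun Omega >-> gT} := HB.pack (id : Omega -> gT) (isMeasurableFun.Build _ _ _ _ _ mid).
pose mu := distribution P idm.
pose nu0 := induced_charge fi.
pose nu_ : {charge set gT -> \bar R} := pushforward nu0 (idm : Omega -> gT).
pose nu := nu_ mid.
have numu : nu `<< mu.
  apply/null_content_dominatesP => A mA muA0.
  rewrite /nu /nu_ /= /pushforward /nu0 /induced_charge.
  apply: null_set_integral => //=.
  - by rewrite -[X in measurable X]setTI; exact: (mid).
  - by apply/measurable_EFinP/measurable_funTS; exact: integrable_measurable fi.
have gint := Radon_Nikodym_integrable numu.
pose g := fine \o 'd nu '/d mu.
have gE : EFin \o g = 'd nu '/d mu.
  by apply/funext => w; rewrite /g /= fineK//; exact: Radon_Nikodym_fin_num.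
have mg : measurable_wrt G g.
  by apply: measurableT_comp => //; exact: measurable_int gint.
have gi : intg g.
  apply/integrableP; split.
    by apply/measurable_EFinP; exact: measurable_wrt_fun mg.
  move/integrableP : (gint) => [mg' +].
  rewrite ge0_integral_distribution//; last exact: measurableT_comp.
  by rewrite -gE.
exists g; split => // A GA.
have mA : measurable (A : set gT) by rewrite /measurable /= subsigma_generated.
have := Radon_Nikodym_integral numu mA.
rewrite -gE integral_pushforward//=.
- exact/measurable_EFinP.
- by apply: integrableS gi => //; exact: (subsigma_measurable sG GA).
Qed.

Lemma condexpP G f : subsigma G -> intg f -> is_condexp P G f (condexp P G f).
Proof. by move=> sG fi; apply: xgetPex; exact: condexp_exists. Qed.

Lemma condexp_measurable_wrt G f : subsigma G ->
  measurable_wrt G (condexp P G f).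
Proof.
move=> sG; rewrite /condexp; case: xgetP => [g -> []//|_].
by apply/measurable_wrtP => // B mB; rewrite preimage_cst; case: ifP => _;
  [exact: subsigmaT|exact: subsigma0].
Qed.

Lemma measurable_condexp G f : subsigma G ->
  measurable_fun setT (condexp P G f).
Proof.
by move=> sG; exact: measurable_wrt_fun (condexp_measurable_wrt f sG).
Qed.

(** A pointwise comparison follows from the comparison of the integrals. *)
Lemma ae_le_of_integral f g B : measurable B -> intg f -> intg g ->
  \int[P]_(w in B `&` [set w | (g w < f w)%R]) (f w)%:E <=
  \int[P]_(w in B `&` [set w | (g w < f w)%R]) (g w)%:E ->
  {ae P, forall w, B w -> (f w <= g w)%R}.
Proof.
move=> mB fi gi.
set A := (X in \int[P]_(w in X) _ <= _) => fg.
have mf := integrable_measurable fi; have mg := integrable_measurable gi.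
have mA : measurable A.
  apply: measurableI => //; rewrite -[X in measurable X]setTI.
  exact: measurable_fun_ltr.
have mfg : measurable_fun A (fun w => (f w - g w)%:E).
  by apply/measurable_EFinP; apply: measurable_funTS; exact: measurable_funB.
have : \int[P]_(w in A) `|(f w - g w)%:E| = 0.
  apply/eqP; rewrite eq_le integral_ge0// andbT.
  rewrite (eq_integral (fun w => (f w - g w)%:E)); last first.
    move=> w; rewrite inE => -[_ /= h].
    by rewrite gtr0_norm// subr_gt0.
  rewrite integral_subE// leeBlDr ?add0e//.
  exact: integral_fin.
move/ae_eq_integral_abs => /(_ mA mfg); apply: filterS => w h Bw.
rewrite leNgt; apply/negP => gf.
have Aw : A w by [].
by have [/eqP] := h Aw; rewrite subr_eq0 => /eqP E; rewrite E ltxx in gf.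
Qed.

Lemma measurable_wrt_trace G H B (k : Omega -> R) : subsigma G -> subsigma H -> G B ->
  H B -> (forall A, A `<=` B -> H A -> G A) ->
  measurable_wrt H k -> measurable_wrt G (fun w => \1_B w * k w)%R.
Proof.
move=> sG sH GB HB tr /(measurable_wrtP sH) mk.
apply/(measurable_wrtP sG) => C mC.
have GC : G (B `&` k @^-1` C).
  by apply: tr; [exact: subIsetl|apply: subsigmaI => //; exact: mk].
have [C0|C0] := pselect (C 0%R).
- have -> : (fun w => \1_B w * k w)%R @^-1` C = (B `&` k @^-1` C) `|` ~` B.
    apply/seteqP; split => w /=; rewrite indicE; have [|] := pselect (B w).
    + by move=> Bw; rewrite mem_set// mul1r; left.
    + by right.
    + by move=> Bw; rewrite mem_set// mul1r => -[[]|].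
    + by move=> Bw; rewrite memNset// mul0r.
  by apply: subsigmaU => //; exact: subsigmaC.
- have -> : (fun w => \1_B w * k w)%R @^-1` C = (B `&` k @^-1` C) => //.
    apply/seteqP; split => w /=; rewrite indicE; have [|] := pselect (B w).
    + by move=> Bw; rewrite mem_set// mul1r.
    + by move=> Bw; rewrite memNset// mul0r.
    + by move=> Bw; rewrite mem_set// mul1r => -[].
    + by move=> Bw; rewrite memNset// mul0r => -[].
Qed.

(** Conditional expectations are local and monotone: the two sigma-algebras
    need only have the same trace on B. *)
Lemma condexp_le_local G H B f g : subsigma G -> subsigma H ->
  G B -> H B -> (forall A, A `<=` B -> G A <-> H A) ->
  intg f -> intg g -> {ae P, forall w, B w -> (f w <= g w)%R} ->
  {ae P, forall w, B w -> (condexp P G f w <= condexp P H g w)%R}.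
Proof.
move=> sG sH GB HB tr fi gi fg.
have [mf' if' If] := condexpP sG fi; have [mg' ig' Ig] := condexpP sH gi.
apply: ae_le_of_integral => //; first exact: subsigma_measurable GB.
set A := _ `&` _.
have GA : G A.
  have -> : A = B `&` [set w | \1_B w * condexp P H g w < condexp P G f w]%R.
    by apply/seteqP; split => w [Bw /=]; rewrite indicE mem_set// mul1r.
  apply: subsigmaI => //; apply: measurable_wrt_ltr => //.
  by apply: measurable_wrt_trace (HB) _ mg' => // C CB /tr; exact.
have HA : H A by apply/tr => //; exact: subIsetl.
rewrite If// Ig//; apply: ae_le_integral => //; first exact: subsigma_measurable GA.
by apply: filterS fg => w h [/h].
Qed.
End Condexp.

Section CondexpTheory.
Context (d : measure_display) (Omega : measurableType d) (R : realType).
Variable P : probability Omega R.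
Implicit Types (f g Y : Omega -> R) (G H : set (set Omega)).
Local Notation intg f := (P.-integrable setT (EFin \o f)).

Lemma integrable_condexp G f : subsigma G -> intg f -> intg (condexp P G f).
Proof. by move=> sG fi; have [] := condexpP sG fi. Qed.

Lemma integral_condexp G f A : subsigma G -> intg f -> G A ->
  (\int[P]_(w in A) (condexp P G f w)%:E = \int[P]_(w in A) (f w)%:E)%E.
Proof. by move=> sG fi GA; have [_ _ ->] := condexpP sG fi. Qed.

Lemma condexp_le G f g : subsigma G -> intg f -> intg g ->
  {ae P, forall w, f w <= g w} ->
  {ae P, forall w, condexp P G f w <= condexp P G g w}.
Proof.
move=> sG fi gi fg.
have := @condexp_le_local _ _ _ P G G setT f g sG sG (subsigmaT sG) (subsigmaT sG)
  (fun A _ => conj id id) fi gi.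
move=> /(_ _)/filterS h; apply: h; first by move=> w /(_ I).
by apply: filterS fg => w.
Qed.

Lemma condexp_aeq_local G H B f g : subsigma G -> subsigma H ->
  G B -> H B -> (forall A, A `<=` B -> G A <-> H A) ->
  intg f -> intg g -> {ae P, forall w, B w -> f w = g w} ->
  {ae P, forall w, B w -> condexp P G f w = condexp P H g w}.
Proof.
move=> sG sH GB HB tr fi gi fg.
have h1 : {ae P, forall w, B w -> f w <= g w}.
  by apply: filterS fg => w h /h ->.
have h2 : {ae P, forall w, B w -> g w <= f w}.
  by apply: filterS fg => w h /h ->.
have := condexp_le_local sH sG HB GB (fun A AB => iff_sym (tr A AB)) gi fi h2.
apply: filterS2 (condexp_le_local sG sH GB HB tr fi gi h1) => w le1 le2 Bw.
by apply/eqP; rewrite eq_le le1// le2.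
Qed.

Lemma is_condexp_unique G f g1 g2 : subsigma G ->
  is_condexp P G f g1 -> is_condexp P G f g2 -> aeq P g1 g2.
Proof.
move=> sG [m1 i1 I1] [m2 i2 I2].
have key g g' : measurable_wrt G g -> intg g -> measurable_wrt G g' -> intg g' ->
   (forall A, G A -> \int[P]_(w in A) (g w)%:E = \int[P]_(w in A) (g' w)%:E)%E ->
   {ae P, forall w, g w <= g' w}.
  move=> mg gi mg' gi' gg'.
  have : {ae P, forall w, setT w -> g w <= g' w}.
    apply: ae_le_of_integral => //; rewrite gg'// setTI.
    exact: measurable_wrt_ltr.
  by apply: filterS => w /(_ I).
have le12 : {ae P, forall w, g1 w <= g2 w}.
  by apply: key => // A GA; rewrite I1// I2.
have le21 : {ae P, forall w, g2 w <= g1 w}.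
  by apply: key => // A GA; rewrite I1// I2.
by apply: filterS2 le12 le21 => w h1 h2; apply/eqP; rewrite eq_le h1 h2.
Qed.

Lemma condexp_unique G f g : subsigma G -> intg f ->
  is_condexp P G f g -> aeq P (condexp P G f) g.
Proof. by move=> sG fi; apply: is_condexp_unique => //; exact: condexpP. Qed.

Lemma is_condexp_version G f g g' : subsigma G -> measurable_wrt G g' ->
  aeq P g g' -> is_condexp P G f g -> is_condexp P G f g'.
Proof.
move=> sG mg' gg' [mg ig Ig].
have mgf := measurable_wrt_fun sG mg; have mgf' := measurable_wrt_fun sG mg'.
split; [exact: mg'|exact: integrable_aeq gg' ig|move=> A GA].
rewrite -Ig//; apply: integral_aeq => //; first exact: (subsigma_measurable sG GA).
by apply: filterS gg' => w ->.
Qed.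

Lemma condexp_cst G (c : R) : subsigma G -> aeq P (condexp P G (cst c)) (cst c).
Proof.
move=> sG; apply: condexp_unique => //; first exact: integrable_const.
split => [| |//]; first exact: measurable_cst.
exact: integrable_const.
Qed.

Lemma condexp_ge0 G f : subsigma G -> intg f -> {ae P, forall w, 0 <= f w} ->
  {ae P, forall w, 0 <= condexp P G f w}.
Proof.
move=> sG fi f0; have := condexp_le sG (integrable_const P 0) fi f0.
by apply: filterS2 (condexp_cst 0 sG) => w /= ->.
Qed.

Lemma is_condexp_sub G f1 f2 g1 g2 : subsigma G -> intg f1 -> intg f2 ->
  is_condexp P G f1 g1 -> is_condexp P G f2 g2 ->
  is_condexp P G (fun w => f1 w - f2 w) (fun w => g1 w - g2 w).
Proof.
move=> sG fi1 fi2 [m1 i1 I1] [m2 i2 I2]; split.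
- exact: measurable_funB.
- exact: integrable_sub.
- move=> A GA; have mA := subsigma_measurable sG GA.
  by rewrite !integral_subE// I1// I2.
Qed.

Lemma is_condexp_scale G c f g : subsigma G -> intg f ->
  is_condexp P G f g -> is_condexp P G (fun w => c * f w) (fun w => c * g w).
Proof.
move=> sG fi [m i I]; split.
- exact: measurable_funM.
- exact: integrable_scale.
- move=> A GA; have mA := subsigma_measurable sG GA.
  under eq_integral do rewrite EFinM.
  under [RHS]eq_integral do rewrite EFinM.
  by rewrite !integralZl//; [rewrite I|exact: integrable_onS..].
Qed.

(** The nonnegative pull-out formula, with almost sure sign conditions. *)
Lemma ae_ge0_integral_pull G Y f g : subsigma G -> measurable_wrt G Y ->
  (forall w, 0 <= Y w) ->
  measurable_fun setT f -> {ae P, forall w, 0 <= f w} ->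
  measurable_fun setT g -> {ae P, forall w, 0 <= g w} ->
  (forall A, G A -> \int[P]_(w in A) (f w)%:E = \int[P]_(w in A) (g w)%:E)%E ->
  forall A, G A ->
  (\int[P]_(w in A) (Y w * f w)%:E = \int[P]_(w in A) (Y w * g w)%:E)%E.
Proof.
move=> sG mY Y0 mf f0 mg g0 fg A GA.
have mYm := measurable_wrt_fun sG mY.
have mnf : measurable_fun setT (fun w => `|f w|) by exact: measurableT_comp.
have mng : measurable_fun setT (fun w => `|g w|) by exact: measurableT_comp.
have mA := subsigma_measurable sG GA.
transitivity (\int[P]_(w in A) (Y w * `|f w|)%:E)%E.
  apply: integral_aeq => //; [exact: measurable_funM..|].
  by apply: filterS f0 => w h _; rewrite ger0_norm.
transitivity (\int[P]_(w in A) (Y w * `|g w|)%:E)%E; last first.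
  apply: integral_aeq => //; [exact: measurable_funM..|].
  by apply: filterS g0 => w h _; rewrite ger0_norm.
apply: (ge0_integral_pull sG) => // B GB.
have mB := subsigma_measurable sG GB.
transitivity (\int[P]_(w in B) (f w)%:E)%E.
  apply: integral_aeq => //.
  by apply: filterS f0 => w h _; rewrite ger0_norm.
rewrite fg//; apply: integral_aeq => //.
by apply: filterS g0 => w h _; rewrite ger0_norm.
Qed.

Let pull_ge0 G Y f g : subsigma G -> measurable_wrt G Y ->
  (forall w, 0 <= Y w) -> intg f -> {ae P, forall w, 0 <= f w} ->
  intg (fun w => Y w * f w) -> is_condexp P G f g ->
  is_condexp P G (fun w => Y w * f w) (fun w => Y w * g w).
Proof.
move=> sG mY Y0 fi f0 Yfi cg; have [mg gi gI] := cg.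
have g0 : {ae P, forall w, 0 <= g w}.
  apply: filterS2 (condexp_ge0 sG fi f0) (condexp_unique sG fi cg) => w.
  by move=> + <-.
have mY' := measurable_wrt_fun sG mY; have mg' := measurable_wrt_fun sG mg.
have E A : G A -> (\int[P]_(w in A) (Y w * g w)%:E = \int[P]_(w in A) (Y w * f w)%:E)%E.
  move=> GA; apply: (ae_ge0_integral_pull sG mY Y0 mg' g0 _ f0) => //.
  exact: integrable_measurable fi.
split=> //; first exact: measurable_funM.
have mYg : measurable_fun setT (fun w => Y w * g w) by exact: measurable_funM.
apply/integrableP; split; first exact/measurable_EFinP.
have -> : (\int[P]_x `|(EFin \o (fun w => (Y w * g w)%R)) x| = \int[P]_x (Y x * g x)%:E)%E.
  apply: (@integral_aeq _ _ _ P (fun x => `|Y x * g x|)) => //.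
    exact: measurableT_comp.
  by apply: filterS g0 => w h _; rewrite ger0_norm// mulr_ge0.
rewrite E; last exact: subsigmaT.
by rewrite ltey_eq integral_fin.
Qed.

Let half_pos (x : R) : 0 <= 2^-1 * (`|x| + x).
Proof. by rewrite mulr_ge0// -lerBlDr sub0r -normrN ler_norm. Qed.

Let half_le (x : R) : 2^-1 * (`|x| + x) <= `|x|.
Proof. by rewrite ler_pdivrMl// mulr_natl mulr2n lerD2l ler_norm. Qed.

Let half_sub (x : R) : 2^-1 * (`|x| + x) - 2^-1 * (`|- x| + - x) = x.
Proof. by rewrite normrN; field. Qed.

Let pull_posY G Y f : subsigma G -> measurable_wrt G Y ->
  (forall w, 0 <= Y w) -> intg f -> intg (fun w => Y w * f w) ->
  is_condexp P G (fun w => Y w * f w) (fun w => Y w * condexp P G f w).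
Proof.
move=> sG mY Y0 fi Yfi.
pose h (g : Omega -> R) w := 2^-1 * (`|g w| + g w).
have mf := integrable_measurable fi.
have mYm := measurable_wrt_fun sG mY.
have mh g : measurable_fun setT g -> measurable_fun setT (h g).
  move=> mg; apply: measurable_funM => //; apply: measurable_funD => //.
  exact: measurableT_comp.
have hi g : intg g -> intg (h g).
  move=> gi; apply: integrable_dominated (mh _ (integrable_measurable gi)) (integrable_norm gi) _.
  by apply: aeW => w; rewrite ger0_norm ?half_pos// half_le.
have Yhi g : intg g -> intg (fun w => Y w * g w) -> intg (fun w => Y w * h g w).
  move=> gi Ygi; have mg := integrable_measurable gi.
  apply: integrable_dominated (integrable_norm Ygi) _.
    by apply: measurable_funM => //; exact: mh.
  by apply: aeW => w; rewrite /= normrM [leRHS]normrM ler_wpM2l// ger0_norm ?half_pos// half_le.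
have fiN : intg (fun w => - f w).
  by have := integrable_scale (-1) fi; apply: eq_integrable => // w _; rewrite /= mulN1r.
have YfiN : intg (fun w => Y w * - f w).
  by have := integrable_scale (-1) Yfi; apply: eq_integrable => // w _; rewrite /= mulN1r mulrN.
have p1 := pull_ge0 sG mY Y0 (hi _ fi) (aeW _ (fun w => half_pos (f w))) (Yhi _ fi Yfi) (condexpP sG (hi _ fi)).
have p2 := pull_ge0 sG mY Y0 (hi _ fiN) (aeW _ (fun w => half_pos (- f w))) (Yhi _ fiN YfiN) (condexpP sG (hi _ fiN)).
have [_ i3 I3] := is_condexp_sub sG (Yhi _ fi Yfi) (Yhi _ fiN YfiN) p1 p2.
have cd : aeq P (condexp P G f) (fun w => condexp P G (h f) w - condexp P G (h (fun w => - f w)) w).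
  apply: condexp_unique => //.
  have := is_condexp_sub sG (hi _ fi) (hi _ fiN) (condexpP sG (hi _ fi)) (condexpP sG (hi _ fiN)).
  congr is_condexp; apply/funext => w; exact: half_sub.
have mc := condexp_measurable_wrt P f sG.
have mYc : measurable_wrt G (fun w => Y w * condexp P G f w) by exact: measurable_funM.
have cd' : aeq P (fun w => Y w * condexp P G (h f) w - Y w * condexp P G (h (fun w => - f w)) w)
   (fun w => Y w * condexp P G f w).
  by apply: filterS cd => w ->; rewrite mulrBr.
split=> //.
- apply: integrable_aeq cd' i3; exact: measurable_wrt_fun mYc.
- move=> A GA; have mA := subsigma_measurable sG GA.
  transitivity (\int[P]_(w in A) (Y w * condexp P G (h f) w - Y w * condexp P G (h (fun w => - f w)) w)%:E)%E.
    apply: integral_aeq => //.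
    + exact: measurable_wrt_fun mYc.
    + exact: integrable_measurable i3.
    + by apply: filterS cd' => w ->.
  rewrite I3//; apply: eq_integral => w _; congr EFin.
  by rewrite -mulrBr half_sub.
Qed.

(** Taking out what is known. *)
Lemma condexp_pull G Y f : subsigma G -> measurable_wrt G Y ->
  intg f -> intg (fun w => Y w * f w) ->
  is_condexp P G (fun w => Y w * f w) (fun w => Y w * condexp P G f w).
Proof.
move=> sG mY fi Yfi.
pose h (x : R) := 2^-1 * (`|x| + x).
have mf := integrable_measurable fi.
have mh g : measurable_wrt G g -> measurable_wrt G (h \o g).
  move=> mg; apply: measurable_funM => //; apply: measurable_funD => //.
  exact: measurableT_comp.
have mN : measurable_wrt G (fun w => - Y w) by apply: measurableT_comp.
have hi g : measurable_wrt G g -> (forall w, `|g w| = `|Y w|) ->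
    intg (fun w => h (g w) * f w).
  move=> mg gY; apply: integrable_dominated (integrable_norm Yfi) _.
    by apply: measurable_funM => //; exact: (measurable_wrt_fun sG (mh _ mg)).
  by apply: aeW => w; rewrite /= normrM [leRHS]normrM ler_wpM2r// ger0_norm ?half_pos// -gY half_le.
have NY w : `|- Y w| = `|Y w| by rewrite normrN.
have p1 := pull_posY sG (mh _ mY) (fun w => half_pos (Y w)) fi (hi _ mY (fun=> erefl)).
have p2 := pull_posY sG (mh _ mN) (fun w => half_pos (- Y w)) fi (hi _ mN NY).
have := is_condexp_sub sG (hi _ mY (fun=> erefl)) (hi _ mN NY) p1 p2.
by congr is_condexp; apply/funext => w; rewrite -mulrBl half_sub.
Qed.

End CondexpTheory.

(** * Essential infima and suprema *)

Lemma invrS_lt (R : realType) (e : R) : 0 < e -> exists k : nat, k.+1%:R^-1 < e.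
Proof.
move=> e0; have /cvgrPdist_lt/(_ _ e0)[N _ /(_ N (leqnn N))] := @cvg_harmonic R.
by rewrite sub0r normrN ger0_norm /harmonic//= => h; exists N.
Qed.

Lemma measurable_invr (R : realType) : measurable_fun setT (fun x : R => x^-1).
Proof.
rewrite -(setUv [set 0 : R]); apply/measurable_funU => //.
  exact: measurableC.
split; first exact: measurable_fun_set1.
apply: open_continuous_measurable_fun.
  by apply: closed_openC; exact: closed_eq.
by move=> x /set_mem /= /eqP x0; exact: inv_continuous.
Qed.

Lemma measurable_bool_ind d (U : measurableType d) (R : realType) (b : U -> bool) :
  measurable_fun setT b -> measurable_fun setT (fun w => (b w)%:R : R).
Proof.
move=> mb; rewrite (_ : (fun w => _) = (fun w => if b w then 1 else 0 : R)).
  by apply: measurable_fun_ifT => //; exact: measurable_cst.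
by apply/funext => w; case: (b w).
Qed.

Section MeasurableLim.
Context (d : measure_display) (Omega : measurableType d) (R : realType).

(** Where the sequence diverges the limit takes its default value, 0. *)
Lemma measurable_limn (u : nat -> Omega -> R) :
  (forall n, measurable_fun setT (u n)) ->
  measurable_fun setT (fun w => limn (u^~ w)).
Proof.
move=> mu.
pose C := [set w | cvgn (u^~ w)].
pose v w := fine (limn_esup (fun n => (u n w)%:E)).
have mv : measurable_fun setT v.
  apply: measurableT_comp => //.
  by apply: measurable_fun_limn_esup => n; exact/measurable_EFinP.
pose eu w n := (u n w)%:E.
have mesup : measurable_fun setT (fun w => limn_esup (eu w)).
  by apply: measurable_fun_limn_esup => n; exact/measurable_EFinP.
have meinf : measurable_fun setT (fun w => limn_einf (eu w)).
  have : measurable_fun setT (fun w => - limn_esup (fun n => - eu w n))%E.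
    apply: measurableT_comp => //; apply: measurable_fun_limn_esup => n.
    by apply: measurableT_comp => //; exact/measurable_EFinP.
  by congr measurable_fun; apply/funext => w; rewrite limn_esupN oppeK.
have CE : C = [set w | (limn_esup (eu w) <= limn_einf (eu w))%E] `&`
              [set w | (`|limn_esup (eu w)| < +oo)%E].
  apply/seteqP; split => w /=.
  - move=> cw; have /cvg_limn_einf_sup[-> ->] : eu w @ \oo --> (limn (u^~ w))%:E.
      by apply: cvg_EFin => //; exact: nearW.
    by split => //=; rewrite ltry.
  - move=> [le fi].
    have E : limn_einf (eu w) = limn_esup (eu w).
      by apply/eqP; rewrite eq_le le andbT limn_einf_sup.
    have fin : limn_esup (eu w) \is a fin_num by rewrite fin_num_abs.
    have : eu w @ \oo --> (fine (limn_esup (eu w)))%:E.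
      rewrite fineK//.
      apply: (@squeeze_cvge _ _ _ _ (einfs (eu w)) _ (esups (eu w))).
      + apply: nearW => n; apply/andP; split.
        * by apply: ereal_inf_lbound; exists n => /=.
        * by apply: ereal_sup_ubound; exists n => /=.
      + by rewrite -E limn_einf_lim; exact: is_cvg_einfs.
      + by rewrite limn_esup_lim; exact: is_cvg_esups.
    move=> /fine_cvgP[_ h]; apply/cvg_ex; exists (fine (limn_esup (eu w))).
    exact: h.
have mC : measurable C.
  rewrite CE; apply: measurableI; rewrite -[X in measurable X]setTI.
  - exact: measurable_lee.
  - by apply: measurable_lte => //; exact: measurableT_comp.
have -> : (fun w => limn (u^~ w)) = (fun w => \1_C w * v w).
  apply/funext => w; rewrite indicE; have [Cw|Cw] := pselect (C w).
  - rewrite mem_set// mul1r /v.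
    have /cvg_limn_einf_sup[_ ->//] : eu w @ \oo --> (limn (u^~ w))%:E.
    by apply: cvg_EFin => //; exact: nearW.
  - by rewrite memNset// mul0r; exact: dvgP.
by apply: measurable_funM => //; exact: measurable_indic.
Qed.

End MeasurableLim.

Section EssInf.
Context (d : measure_display) (Omega : measurableType d) (R : realType).
Variable P : probability Omega R.
Implicit Types (S : set (Omega -> \bar R)) (f g h : Omega -> \bar R).

Lemma ereal_rat_between (x y : \bar R) : (x < y)%E ->
  exists q : rat, (x < (ratr q)%:E < y)%E.
Proof.
have bd (a b : R) : a < b -> exists q : rat, (a%:E < (ratr q)%:E < b%:E)%E.
  by move=> /rat_in_itvoo[q]; rewrite in_itv/= => h; exists q; rewrite !lte_fin.
case: x y => [x||] [y||] //= h.
- exact: bd.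
- have [|q /andP[h1 h2]] := bd x (x + 1); first by rewrite ltrDl.
  by exists q; rewrite h1 ltry.
- have [|q /andP[h1 h2]] := bd (y - 1) y; first by rewrite gtrBl.
  by exists q; rewrite h2 ltNyr.
- by exists 0; rewrite ltry ltNyr.
Qed.

(** A family of events has a countable subfamily whose union is an essential
    upper bound of the family. *)
Lemma essential_union (F : set (set Omega)) : F !=set0 -> F `<=` measurable ->
  exists A : nat -> set Omega, (forall n, F (A n)) /\
    forall B, F B -> P (B `\` \bigcup_n A n) = 0%E.
Proof.
move=> [A0 FA0] mF.
pose V := [set P (\bigcup_n A n) | A in [set A : nat -> set Omega | forall n, F (A n)]].
have V0 : V (P (\bigcup_(n : nat) A0)) by exists (fun=> A0).
have mU (A : nat -> set Omega) : (forall n, F (A n)) -> measurable (\bigcup_n A n).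
  by move=> FA; apply: bigcup_measurable => n _; exact/mF.
have Vfin : ereal_sup V \is a fin_num.
  rewrite ge0_fin_numE.
  - apply: (@le_lt_trans _ _ 1%E); last exact: ltry.
    by apply: ge_ereal_sup => _ [A FA <-]; apply: probability_le1; exact: mU.
  - by apply: le_trans (ereal_sup_ubound V0).
have /choice[A hA] : forall k : nat, exists A : nat -> set Omega,
    (forall n, F (A n)) /\ (ereal_sup V - (k.+1%:R^-1)%:E < P (\bigcup_n A n))%E.
  move=> k; have [|_ [A FA <-] h] := @ub_ereal_sup_adherent _ V k.+1%:R^-1 _ Vfin.
    by rewrite invr_gt0.
  by exists A.
(* B enumerates sequences A k whose unions have nearly maximal probability. *)
pose B m := if unpickle m is Some (k, n) then A k n else A0 : set Omega.
have FB m : F (B m).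
  by rewrite /B; case: (unpickle m) => [[k n]|//]; exact: (hA k).1.
have AB k n : A k n = B (pickle (k, n)) by rewrite /B pickleK.
have PB : (ereal_sup V <= P (\bigcup_m B m))%E.
  apply/lee_addgt0Pr => e e0.
  have [k ke] := invrS_lt e0.
  rewrite -leeBlDr//; apply: (@le_trans _ _ (ereal_sup V - (k.+1%:R^-1)%:E)%E).
    by apply: leeB => //; rewrite lee_fin ltW.
  apply: (le_trans (ltW (hA k).2)); apply: le_measure; rewrite ?inE; [|exact: mU|].
    by apply: mU; exact: (hA k).1.
  by move=> w [n _ Aw]; exists (pickle (k, n)) => //; rewrite -AB.
exists B; split => // C FC.
have mC := mF _ FC; have mB := mU _ FB.
pose B' m := if m is m'.+1 then B m' else C.
have FB' m : F (B' m) by case: m.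
have BB' : \bigcup_m B' m = (\bigcup_m B m) `|` (C `\` \bigcup_m B m).
  apply/seteqP; split => [w [[|m] _ /= h]|w [[m _ h]|[h _]]].
  - by have [?|?] := pselect ((\bigcup_m B m) w); [left|right].
  - by left; exists m.
  - by exists m.+1.
  - by exists 0%N.
have : (P (\bigcup_m B' m) <= P (\bigcup_m B m))%E.
  by apply: le_trans PB; apply: ereal_sup_ubound; exists B'.
rewrite BB' measureU//; last 2 first.
- exact: measurableD.
- by rewrite setDIK.
have Bfin : P (\bigcup_m B m) \is a fin_num by exact: fin_num_measure.
rewrite -[leRHS]adde0 leeD2lE// => h; apply/eqP; rewrite eq_le h/=.
exact: measure_ge0.
Qed.

(** The essential infimum of a nonempty family of measurable functions is the
    pointwise infimum of a sequence of members. *)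
Lemma is_essinf_sequence S : S !=set0 ->
  (forall f, S f -> measurable_fun setT f) ->
  exists f_ : nat -> Omega -> \bar R, (forall n, S (f_ n)) /\
    is_essinf P S (fun w => ereal_inf (range (f_^~ w))).
Proof.
move=> [f0 Sf0] mS.
(* Whether f is below g at a point is decided by the rational level sets. *)
pose lvl (q : rat) f := [set w | (f w < (ratr q)%:E)%E].
have mlvl q f : S f -> measurable (lvl q f).
  move=> /mS mf; rewrite /lvl -[X in measurable X]setTI.
  by apply: measurable_lte => //; exact: measurable_cst.
have /choice[f_ hf] : forall q : rat, exists f_ : nat -> Omega -> \bar R,
    (forall n, S (f_ n)) /\ forall f, S f ->
      P (lvl q f `\` \bigcup_n lvl q (f_ n)) = 0%E.
  move=> q; have [||A [FA hA]] := @essential_union [set lvl q f | f in S].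
  - by exists (lvl q f0), f0.
  - by move=> _ [f Sf <-]; exact: mlvl.
  - have /choice[f_ f_P] : forall n, exists f, S f /\ lvl q f = A n.
      by move=> n; have [f Sf <-] := FA n; exists f.
    exists f_; split => [n|f Sf]; first exact: (f_P n).1.
    have -> : \bigcup_n lvl q (f_ n) = \bigcup_n A n.
      by apply: eq_bigcup => // n _; exact: (f_P n).2.
    by apply: hA; exists f.
pose g_ m := if unpickle m is Some (q, n) then f_ q n else f0.
have Sg m : S (g_ m).
  by rewrite /g_; case: (unpickle m) => [[q n]|//]; exact: (hf q).1.
have fg q n : f_ q n = g_ (pickle (q, n)) by rewrite /g_ pickleK.
exists g_; split => //; split.
- have := @measurable_fun_einfs _ _ _ setT g_ (fun m => mS _ (Sg m)) 0%N.
  congr measurable_fun; apply/funext => w; rewrite /einfs; congr ereal_inf.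
  by apply/seteqP; split => [_ [m _ <-]|_ [m _ <-]]; exists m.
- move=> f Sf.
  have nul : {ae P, forall w, forall k : nat, forall q, unpickle k = Some q ->
      ~ (lvl q f `\` \bigcup_n lvl q (f_ q n)) w}.
    apply: ae_foralln => k; case: (unpickle k) => [q|]; last exact: aeW.
    exists (lvl q f `\` \bigcup_n lvl q (f_ q n)); split.
    + apply: measurableD; first exact: mlvl.
      by apply: bigcup_measurable => n _; apply: mlvl; exact: (hf q).1.
    + exact: (hf q).2.
    + by move=> w /= h; apply: contrapT => h2; apply: h => _ [<-].
  apply: filterS nul => w h; rewrite leNgt; apply/negP => /ereal_rat_between[q /andP[q1 q2]].
  apply: (h (pickle q) q (pickleK q)); split => // -[n _ /= q3].
  have : (ereal_inf (range (g_^~ w)) <= f_ q n w)%E.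
    by apply: ereal_inf_lbound; exists (pickle (q, n)) => //; rewrite -fg.
  by rewrite leNgt (lt_trans q3 q2).
- move=> h mh hS.
  have : {ae P, forall w, forall m, (h w <= g_ m w)%E}.
    by apply: ae_foralln => m; exact: hS.
  by apply: filterS => w hw; apply: le_ereal_inf_tmp => _ [m _ <-].
Qed.

Lemma is_essinf_unique S g1 g2 :
  is_essinf P S g1 -> is_essinf P S g2 -> aeq P g1 g2.
Proof.
move=> [m1 l1 u1] [m2 l2 u2].
apply: filterS2 (u1 _ m2 l2) (u2 _ m1 l1) => w h1 h2.
by apply/eqP; rewrite eq_le h1 h2.
Qed.

Lemma essinfP S : S !=set0 -> (forall f, S f -> measurable_fun setT f) ->
  is_essinf P S (essinf P S).
Proof.
move=> S0 mS; apply: xgetPex.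
by have [f_ [_ h]] := is_essinf_sequence S0 mS; eexists; exact: h.
Qed.

Lemma essinf_sequence S : S !=set0 ->
  (forall f, S f -> measurable_fun setT f) ->
  exists f_ : nat -> Omega -> \bar R, (forall n, S (f_ n)) /\
    aeq P (essinf P S) (fun w => ereal_inf (range (f_^~ w))).
Proof.
move=> S0 mS; have [f_ [Sf h]] := is_essinf_sequence S0 mS.
by exists f_; split => //; apply: is_essinf_unique h; exact: essinfP.
Qed.

Lemma esssupP S : S !=set0 -> (forall f, S f -> measurable_fun setT f) ->
  is_esssup P S (esssup P S).
Proof.
move=> [f0 Sf0] mS; apply: xgetPex.
pose S' := [set (fun w => - f w)%E | f in S].
have [||f_ [_ [mg lg ug]]] := @is_essinf_sequence S'.
- by exists (fun w => - f0 w)%E, f0.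
- by move=> _ [f Sf <-]; apply: measurableT_comp => //; exact: mS.
set g := fun w => _ in mg lg ug.
exists (fun w => - g w)%E; split.
- exact: measurableT_comp.
- move=> f Sf; have := lg (fun w => - f w)%E (ex_intro2 _ _ _ Sf erefl).
  by apply: filterS => w; rewrite leeNr.
- move=> h mh hS; have : {ae P, forall w, (- h w <= g w)%E}.
    apply: ug; first exact: measurableT_comp.
    by move=> _ [f Sf <-]; have := hS f Sf; apply: filterS => w; rewrite leeN2.
  by apply: filterS => w; rewrite leeNl.
Qed.

(** Almost surely equal families have the same essential supremum. *)
Lemma esssup_aeq (I : Type) (D : set I) (f g : I -> Omega -> \bar R) :
  D !=set0 -> (forall i, D i -> measurable_fun setT (f i)) ->
  (forall i, D i -> measurable_fun setT (g i)) ->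
  (forall i, D i -> aeq P (f i) (g i)) ->
  aeq P (esssup P [set f i | i in D]) (esssup P [set g i | i in D]).
Proof.
move=> [i0 Di0] mf mg fg.
have [||m1 u1 l1] := @esssupP [set f i | i in D].
- by exists (f i0), i0.
- by move=> _ [i Di <-]; exact: mf.
have [||m2 u2 l2] := @esssupP [set g i | i in D].
- by exists (g i0), i0.
- by move=> _ [i Di <-]; exact: mg.
have le12 := l1 _ m2; have le21 := l2 _ m1.
apply: filterS2 (le12 _) (le21 _) => [w h1 h2||].
- by apply/eqP; rewrite eq_le h1 h2.
- move=> _ [i Di <-].
  by apply: filterS2 (u2 (g i) (ex_intro2 _ _ i Di erefl)) (fg i Di) => w + ->.
- move=> _ [i Di <-].
  by apply: filterS2 (u1 (f i) (ex_intro2 _ _ i Di erefl)) (fg i Di) => w + <-.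
Qed.

End EssInf.

(** * Conditional expectation of nonpositive extended random variables *)

Section CondexpNpos.
Context (d : measure_display) (Omega : measurableType d) (R : realType).
Variable P : probability Omega R.
Implicit Types (h : Omega -> R) (f : Omega -> \bar R).
Local Notation intg f := (P.-integrable setT (EFin \o f)).
Variable G : set (set Omega).
Hypothesis sG : subsigma G.

Let trunc f n w : R := fine (maxe (f w) (- n%:R)%:E).

Let measurable_trunc f n : measurable_fun setT f -> measurable_fun setT (trunc f n).
Proof.
move=> mf; apply: measurableT_comp => //.
by apply: measurable_maxe => //; exact: measurable_cst.
Qed.

Let trunc_bounds f n w : (f w <= 0)%E -> - n%:R <= trunc f n w <= 0.
Proof.
rewrite /trunc; move: (f w) => [x||]//=.
- rewrite lee_fin => x0; rewrite -EFin_max /= le_max lexx orbT /=.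
  by rewrite ge_max x0 oppr_le0 ler0n.
- by move=> _; rewrite maxNye /= lexx oppr_le0 ler0n.
Qed.

Let truncE f n w : (f w <= 0)%E -> (trunc f n w)%:E = maxe (f w) (- n%:R)%:E.
Proof.
rewrite /trunc; move: (f w) => [x||]//= _.
- by rewrite -EFin_max.
- by rewrite maxNye.
Qed.

Let integrable_trunc f n : measurable_fun setT f ->
  {ae P, forall w, (f w <= 0)%E} -> intg (trunc f n).
Proof.
move=> mf f0; apply: (@integrable_bounded _ _ _ P n%:R); first exact: measurable_trunc.
apply: filterS f0 => w /(trunc_bounds n) /andP[h1 h2].
by rewrite ler_norml h1 (le_trans h2).
Qed.

Let condexp_trunc_nonincreasing f : measurable_fun setT f ->
  {ae P, forall w, (f w <= 0)%E} ->
  {ae P, forall w, nonincreasing_seq (fun n => (condexp P G (trunc f n) w)%:E)}.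
Proof.
move=> mf f0.
have : {ae P, forall w, forall n, condexp P G (trunc f n.+1) w <= condexp P G (trunc f n) w}.
  apply: ae_foralln => n; apply: condexp_le => //; [exact: integrable_trunc..|].
  apply: filterS f0 => w h; rewrite -lee_fin !truncE// ge_max !le_max lexx/=.
  by apply/orP; right; rewrite lee_fin lerN2 ler_nat.
apply: filterS => w h; apply/nonincreasing_seqP => n.
by rewrite lee_fin.
Qed.

(** A lower bound of f by an integrable h passes to conditional expectations:
    it bounds all the truncations of f. *)
Lemma condexp_npos_ge f h : measurable_fun setT f ->
  {ae P, forall w, (f w <= 0)%E} -> intg h ->
  {ae P, forall w, ((h w)%:E <= f w)%E} ->
  {ae P, forall w, ((condexp P G h w)%:E <= condexp_npos P G f w)%E}.
Proof.
move=> mf f0 hi hf.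
have : {ae P, forall w, forall n, condexp P G h w <= condexp P G (trunc f n) w}.
  apply: ae_foralln => n; apply: condexp_le => //; first exact: integrable_trunc.
  by apply: filterS2 hf f0 => w h1 h2; rewrite -lee_fin truncE// le_max h1.
apply: filterS2 (condexp_trunc_nonincreasing mf f0) => w ni le.
apply: lime_ge; first exact: ereal_nonincreasing_is_cvgn.
by apply: nearW => n; rewrite lee_fin; exact: le.
Qed.

(** So does an upper bound.  It does not bound the truncations f \/ -n, but the
    excess over h is at most 0 \/ (-n - h), whose expectation tends to 0. *)
Lemma condexp_npos_le f h : measurable_fun setT f ->
  {ae P, forall w, (f w <= 0)%E} -> intg h ->
  {ae P, forall w, (f w <= (h w)%:E)%E} ->
  {ae P, forall w, (condexp_npos P G f w <= (condexp P G h w)%:E)%E}.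
Proof.
move=> mf f0 hi fh.
have mh := integrable_measurable hi.
pose k n w := Num.max 0 (- n%:R - h w).
have mk n : measurable_fun setT (k n).
  by apply: measurable_maxr => //; apply: measurable_funB.
have k0 n w : 0 <= k n w by rewrite le_max lexx.
have kh n w : `|k n w| <= `|h w|.
  rewrite ger0_norm// ge_max normr_ge0/=.
  rewrite lerBlDr (@le_trans _ _ 0)// ?oppr_le0//.
  by rewrite -lerBlDr sub0r -normrN ler_norm.
have ki n : intg (k n).
  apply: integrable_dominated (integrable_norm hi) _ => //.
  by apply: aeW => w; exact: kh.
(* E[f \/ -n | G] <= E[h | G] + E[k n | G] and k n decreases to 0 *)
have fk : {ae P, forall w, forall n,
    condexp P G (trunc f n) w - condexp P G h w <= condexp P G (k n) w}.
  apply: ae_foralln => n.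
  have ti := integrable_trunc n mf f0.
  have : {ae P, forall w, condexp P G (fun w => trunc f n w - h w) w
      <= condexp P G (k n) w}.
    apply: condexp_le => //; first exact: integrable_sub.
    apply: filterS2 f0 fh => w h1 h2.
    rewrite lerBlDr -lee_fin truncE// ge_max; apply/andP; split.
    - by apply: (le_trans h2); rewrite lee_fin lerDr.
    - by rewrite lee_fin -lerBlDr le_max lexx orbT.
  have : aeq P (condexp P G (fun w => trunc f n w - h w))
     (fun w => condexp P G (trunc f n) w - condexp P G h w).
    apply: condexp_unique => //; first exact: integrable_sub.
    by apply: is_condexp_sub => //; exact: condexpP.
  by apply: filterS2 => w ->.
have ikn0 : (\int[P]_w (k n w)%:E)%E @[n --> \oo] --> 0%E.
  have [|||||_ _] := @dominated_convergence _ _ _ P setT measurableT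
    (fun n w => (k n w)%:E) (cst 0%E) (fun w => `|(h w)%:E|%E).
  - by move=> n; exact/measurable_EFinP.
  - exact: measurable_cst.
  - apply: aeW => w _; apply: cvg_near_cst.
    apply: filterS (nbhs_infty_ger (- h w)) => n nh.
    by rewrite /k max_l// lerBlDr add0r lerNl.
  - exact: integrable_norm.
  - by apply: aeW => w n _; rewrite lee_fin; exact: kh.
  by rewrite integral_cst// mul0e.
have small : {ae P, forall w, forall j, exists n, condexp P G (k n) w < j.+1%:R^-1}.
  apply: ae_foralln => j.
  pose A := ~` \bigcup_n [set w | condexp P G (k n) w < j.+1%:R^-1].
  have GA : G A.
    apply: subsigmaC => //; apply: subsigma_bigcup => // n.
    apply: measurable_wrt_ltr => //; first exact: condexp_measurable_wrt.
    exact: measurable_cst.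
  have mA := subsigma_measurable sG GA.
  exists A; split => //; last by move=> w /= h1 [n _ h2]; apply: h1; exists n.
  apply/eqP; rewrite eq_le measure_ge0 andbT.
  have : (j.+1%:R^-1%:E * P A <= 0)%E.
    rewrite -integral_cst// -(cvg_lim _ ikn0)//.
    apply: lime_ge; first exact: cvgP ikn0.
    apply: nearW => n.
    apply: (@le_trans _ _ (\int[P]_(w in A) (k n w)%:E)%E).
      rewrite -(integral_condexp sG (ki n) GA).
      apply: (ae_le_integral mA (integrable_const P (j.+1%:R^-1))) => //.
        exact: integrable_condexp.
      apply: aeW => w Aw; rewrite leNgt; apply/negP => h1.
      by apply: Aw; exists n.
    apply: ge0_subset_integral => //; first exact/measurable_EFinP.
    by move=> w _; rewrite lee_fin.
  by rewrite pmule_rle0// lte_fin invr_gt0.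
apply: filterS3 fk small (condexp_trunc_nonincreasing mf f0) => w h1 h2 h3.
apply/lee_addgt0Pr => e e0; have [j je] := invrS_lt e0.
have [n hn] := h2 j.
apply: (@le_trans _ _ (condexp P G (trunc f n) w)%:E).
  rewrite /condexp_npos (cvg_lim _ (ereal_nonincreasing_cvgn h3))//.
  by apply: ereal_inf_lbound; exists n.
rewrite lee_fin -lerBlDl (le_trans (h1 n))// ltW//.
exact: lt_trans hn je.
Qed.

End CondexpNpos.

(** * Gluing measurable functions *)

Section Glue.
Context (d : measure_display) (Omega : measurableType d) (R : realType).
Variable P : probability Omega R.

(** Gluing countably many measurable functions along a measurable index. *)
Lemma measurable_glue dT (T : measurableType dT) dU (U : measurableType dU)
    (I : countType) (K : T -> I) (f : I -> T -> U) :
  (forall i, measurable (K @^-1` [set i])) ->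
  (forall i, measurable_fun setT (f i)) ->
  measurable_fun setT (fun w => f (K w) w).
Proof.
move=> mK mf _ B mB; rewrite setTI.
have -> : (fun w => f (K w) w) @^-1` B = \bigcup_n
    (if @unpickle I n is Some i then K @^-1` [set i] `&` f i @^-1` B else set0).
  apply/seteqP; split => [w /= Bw|w [n _]].
  - by exists (pickle (K w)) => //; rewrite pickleK.
  - by case: (unpickle n) => // i [/= <-].
apply: bigcupT_measurable => n; case: (unpickle n) => // i.
by apply: measurableI => //; rewrite -[X in measurable X]setTI; exact: mf.
Qed.

Section OneSigma.
Variable G : set (set Omega).
Hypothesis sG : subsigma G.

Lemma measurable_wrt_glue dU (U : measurableType dU) (I : countType)
    (K : Omega -> I) (f : I -> Omega -> U) :
  (forall i, G (K @^-1` [set i])) -> (forall i, measurable_wrt G (f i)) ->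
  measurable_wrt G (fun w => f (K w) w).
Proof.
move=> GK mf; apply: (@measurable_glue _ (g_sigma_algebraType G)) => // i.
by rewrite /measurable /= (subsigma_generated sG).
Qed.

Lemma L0_wrt dU (U : measurableType dU) (f : Omega -> U) :
  measurable_wrt G f -> L0 P G f.
Proof.
move=> mf; split; first exact: measurable_wrt_fun mf.
by exists f => //; exact: aeW.
Qed.

Lemma L0_aeq dU (U : measurableType dU) (f g : Omega -> U) :
  measurable_fun setT f -> aeq P f g -> L0 P G g -> L0 P G f.
Proof.
move=> mf fg [mg [g' mg' gg']]; split => //; exists g' => //.
by apply: filterS2 fg gg' => w -> ->.
Qed.

Lemma L0_glue dU (U : measurableType dU) (I : countType)
    (K : Omega -> I) (f : I -> Omega -> U) :
  (forall i, G (K @^-1` [set i])) -> (forall i, L0 P G (f i)) ->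
  L0 P G (fun w => f (K w) w).
Proof.
move=> GK Lf; split.
  apply: measurable_glue => [i|i]; last by have [] := Lf i.
  exact: subsigma_measurable (GK i).
have /choice[g hg] : forall i, exists g, measurable_wrt G g /\ aeq P (f i) g.
  by move=> i; have [_ [g mg fg]] := Lf i; exists g.
exists (fun w => g (K w) w).
  by apply: measurable_wrt_glue => // i; exact: (hg i).1.
have : {ae P, forall w, forall n i, @unpickle I n = Some i -> f i w = g i w}.
  apply: ae_foralln => n; case: (unpickle n) => [i|]; last exact: aeW.
  by have := (hg i).2; apply: filterS => w h _ [<-].
by apply: filterS => w h; apply: (h (pickle (K w))); rewrite pickleK.
Qed.

Lemma L0_comp2 (op : R -> R -> R) (f g : Omega -> R) :
  (forall dT (T : measurableType dT) (a b : T -> R), measurable_fun setT a ->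
     measurable_fun setT b -> measurable_fun setT (fun w => op (a w) (b w))) ->
  L0 P G f -> L0 P G g -> L0 P G (fun w => op (f w) (g w)).
Proof.
move=> mop [mf [f' mf' ff']] [mg [g' mg' gg']]; split; first exact: mop.
exists (fun w => op (f' w) (g' w)); first exact: mop.
by apply: filterS2 ff' gg' => w -> ->.
Qed.

Lemma L0_add (f g : Omega -> R) :
  L0 P G f -> L0 P G g -> L0 P G (fun w => f w + g w).
Proof. by apply: (@L0_comp2 +%R) => *; exact: measurable_funD. Qed.

Lemma L0_sub (f g : Omega -> R) :
  L0 P G f -> L0 P G g -> L0 P G (fun w => f w - g w).
Proof.
by apply: (@L0_comp2 (fun x y => x - y)) => *; exact: measurable_funB.
Qed.

Lemma L0_mul (f g : Omega -> R) :
  L0 P G f -> L0 P G g -> L0 P G (fun w => f w * g w).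
Proof. by apply: (@L0_comp2 *%R) => *; exact: measurable_funM. Qed.

Lemma L0_cst (c : R) : L0 P G (cst c).
Proof. by apply: L0_wrt; exact: measurable_cst. Qed.

Lemma L0_indic A : G A -> L0 P G (\1_A : Omega -> R).
Proof. by move=> GA; apply: L0_wrt; exact: measurable_wrt_indic. Qed.

End OneSigma.

Lemma measurable_wrt_sub (G H : set (set Omega)) dU (U : measurableType dU)
    (f : Omega -> U) : subsigma G -> subsigma H -> G `<=` H ->
  measurable_wrt G f -> measurable_wrt H f.
Proof.
move=> sG sH GH /(measurable_wrtP sG) mf; apply/(measurable_wrtP sH) => B mB.
exact/GH/mf.
Qed.

Lemma L0_subsigma (G H : set (set Omega)) dU (U : measurableType dU)
    (f : Omega -> U) : subsigma G -> subsigma H -> G `<=` H ->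
  L0 P G f -> L0 P H f.
Proof.
move=> sG sH GH [mf [g mg fg]]; split => //; exists g => //.
exact: measurable_wrt_sub mg.
Qed.

End Glue.

(** Among countably many events one that contains the given point can be
    selected measurably; J is arbitrary outside of their union. *)
Lemma measurable_selection (d : measure_display) (Omega : measurableType d)
    (G : set (set Omega)) (A : nat -> set Omega) :
  subsigma G -> (forall k, G (A k)) ->
  exists2 J : Omega -> nat, forall k, G [set w | J w = k] &
    forall w n, A n w -> A (J w) w.
Proof.
move=> sG GA.
pose B n := A n `\` \bigcup_m (if (m < n)%N then A m else set0).
have GB n : G (B n).
  apply: (subsigmaD sG) => //; apply: (subsigma_bigcup sG) => m.
  by case: ifP => // _; exact: subsigma0.
have uB w n m : B n w -> B m w -> n = m.
  move=> [An nA] [Am mA]; have [nm|mn|//] := ltngtP n m.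
  - by exfalso; apply: mA; exists n => //; rewrite nm.
  - by exfalso; apply: nA; exists m => //; rewrite mn.
have eB w n : A n w -> exists m, B m w.
  move=> An; have ex : exists k, `[< A k w >] by exists n; apply/asboolP.
  case: (ex_minnP ex) => m /asboolP Am hm; exists m; split => // -[k _].
  case: ifP => // km /asboolP /hm; by rewrite leqNgt km.
exists (fun w => xget 0%N [set n | B n w]).
- move=> k; rewrite (_ : [set w | _] = B k `|` (if k == 0%N then ~` \bigcup_n B n else set0)).
    apply: (subsigmaU sG) => //; case: ifP => _; last exact: subsigma0.
    by apply: (subsigmaC sG); exact: (subsigma_bigcup sG).
  apply/seteqP; split => w /=.
  + case: xgetP => [m -> Bm <-|nB <-]; first by left.
    by right; rewrite eqxx => -[m _ /nB].
  + move=> [Bk|]; first by case: xgetP => [m -> Bm|/(_ k)//]; exact: uB Bm Bk.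
    case: eqP => // -> nB; case: xgetP => // m _ Bm.
    by exfalso; apply: nB; exists m.
- move=> w n /eB[m Bm]; case: xgetP => [k _ []//|/(_ m)//].
Qed.

Lemma lee_sub_swap (R : realType) (x y : R) (g : \bar R) :
  (x%:E <= y%:E - g)%E = (g <= (y - x)%:E)%E.
Proof.
case: g => [g||] //; last by rewrite leey leNye.
by rewrite -EFinB !lee_fin lerBrDr addrC -lerBrDr.
Qed.

(** * Stopping times *)

Section Filtered.
Context (d : measure_display) (Omega : measurableType d) (R : realType).
Variable P : probability Omega R.
Variable F : nat -> set (set Omega).
Hypothesis hF : filtration F.
Variable T : option nat.
Local Notation process := (nat -> Omega -> R).
Local Notation Tm := (cst T : Omega -> option nat).
Local Notation infty := (cst None : Omega -> option nat).
Local Notation intg f := (P.-integrable setT (EFin \o f)).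
Local Notation bra s X a := (pairing P F (cst_time s) Tm X a).
Implicit Types (a b y z : process) (w : Omega).

Lemma subsigma_filtration t : subsigma (F t).
Proof. by case: hF => s m _; split; [exact: s|exact: m]. Qed.
Local Notation sF := subsigma_filtration.

Lemma filtration_le s t : (s <= t)%N -> F s `<=` F t.
Proof. by case: hF => _ _; apply. Qed.

Lemma le_time_trans (x y z : option nat) : le_time x y -> le_time y z -> le_time x z.
Proof. by case: x y z => [x|] [y|] [z|] //=; exact: leq_trans. Qed.

Lemma leq_min_time (s u : nat) : le_time (Some s) T ->
  (s <= min_time u T)%N = (s <= u)%N.
Proof.
by case: T => //= N sN; rewrite /min_time leq_min sN andbT.
Qed.

Lemma ae_forall_time (Q : nat -> Omega -> Prop) :
  (forall s, le_time (Some s) T -> {ae P, forall w, Q s w}) ->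
  {ae P, forall w, forall s, le_time (Some s) T -> Q s w}.
Proof.
move=> h; apply: ae_foralln => s; case sT : (le_time (Some s) T); last exact: aeW.
by apply: filterS (h s sT).
Qed.

(** Deterministic times, including oo, are stopping times. *)
Lemma stopping_cst_option x : stopping_time F (cst x : Omega -> option nat).
Proof. by move=> s; exact: (subsigma_cst (sF s) (le_time x (Some s))). Qed.

Lemma stopping_cst t : stopping_time F (cst_time t : Omega -> option nat).
Proof. exact: stopping_cst_option. Qed.

Lemma measurable_le_time tau u : stopping_time F tau ->
  measurable_fun setT (fun w : Omega => le_time (tau w) (Some u)).
Proof.
move=> htau; apply: (measurable_fun_bool true); rewrite setTI.
exact: (subsigma_measurable (sF u) (htau u)).
Qed.

Lemma measurable_ge_time tau u : stopping_time F tau ->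
  measurable_fun setT (fun w : Omega => le_time (Some u) (tau w)).
Proof.
case: u => [|u] htau.
  rewrite (_ : (fun w => _) = cst true); first exact: measurable_cst.
  by apply/funext => w; case: (tau w).
rewrite (_ : (fun w => _) = (fun w => ~~ le_time (tau w) (Some u))).
  by apply: measurable_neg; exact: measurable_le_time.
by apply/funext => w; case: (tau w) => //= v; rewrite ltnNge.
Qed.

Section OneTime.
Variable tau : Omega -> option nat.
Hypothesis htau : stopping_time F tau.

Lemma stopping_eq s : F s [set w | tau w = Some s].
Proof.
have -> : [set w | tau w = Some s] = [set w | le_time (tau w) (Some s)] `\`
    (if s is s'.+1 then [set w | le_time (tau w) (Some s')] else set0).
  apply/seteqP; split => w /=.
  - move=> E; split; first by rewrite E /=.
    by case: s E => [|s] E //=; rewrite E /= ltnn.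
  - case: s => [|s] /=; case: (tau w) => [u|] /=.
    + by rewrite leqn0 => -[/eqP -> _].
    + by case.
    + move=> [us /negP]; rewrite -ltnNge => su; congr Some.
      by apply/eqP; rewrite eqn_leq us.
    + by case.
apply: (subsigmaD (sF s)); first exact: htau.
case: s => [|s]; first exact: subsigma0 (sF _).
exact: filtration_le (leqnSn s) _ (htau s).
Qed.

Lemma subsigma_stopped : subsigma (stopped F tau).
Proof.
split; last by move=> A [].
split.
- split => // t; rewrite set0I; exact: subsigma0 (sF t).
- move=> A [mA hA]; split; first by rewrite setTD; exact: measurableC.
  move=> t; rewrite setTD.
  have -> : ~` A `&` [set w | le_time (tau w) (Some t)] =
    [set w | le_time (tau w) (Some t)] `\` (A `&` [set w | le_time (tau w) (Some t)]).
    apply/seteqP; split => w /=; first by case=> nA h; split => // -[].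
    by case=> h nA; split => // Aw; apply: nA.
  by apply: (subsigmaD (sF t)); [exact: htau|exact: hA].
- move=> A hA; split.
    by apply: bigcupT_measurable => i; have [] := hA i.
  move=> t; rewrite setI_bigcupl; apply: (subsigma_bigcup (sF t)) => i.
  by have [_] := hA i; apply.
Qed.

(** On {tau = s} the sigma-algebras F_tau and F_s have the same trace. *)
Lemma stopped_trace s A : A `<=` [set w | tau w = Some s] ->
  stopped F tau A <-> F s A.
Proof.
move=> As; split => [[mA hA]|FA].
- have := hA s; congr (F s _); apply/setIidPl => w /As /= ->.
  exact: leqnn.
- split.   exact: (subsigma_measurable (sF s) FA).
  move=> t; have [st|ts] := leqP s t.
  + have -> : A `&` [set w | le_time (tau w) (Some t)] = A.
      by apply/setIidPl => w /As /= ->.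
    exact: filtration_le FA.
  + have -> : A `&` [set w | le_time (tau w) (Some t)] = set0.
      by apply/seteqP; split => w // [/As /= ->]; rewrite /= leqNgt ts.
    exact: subsigma0 (sF t).
Qed.

Lemma stopped_eq s : stopped F tau [set w | tau w = Some s].
Proof. by apply/(@stopped_trace s) => //; exact: stopping_eq. Qed.

Lemma stopped_eqN : stopped F tau [set w | tau w = None].
Proof.
have -> : [set w | tau w = None] = ~` \bigcup_s [set w | tau w = Some s].
  apply/seteqP; split => w /=.
  - by move=> E [s _ /=]; rewrite E.
  - by case E : (tau w) => [s|//] h; exfalso; apply: h; exists s.
apply: (subsigmaC subsigma_stopped); apply: (subsigma_bigcup subsigma_stopped).
exact: stopped_eq.
Qed.

(** The value of tau if it has occurred at time u. *)
Definition occurred (u : nat) (w : Omega) : option nat :=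
  if le_time (tau w) (Some u) then tau w else None.

Lemma measurable_occurred u i : F u (occurred u @^-1` [set i]).
Proof.
case: i => [s|].
- have [su|us] := leqP s u.
  + have -> : occurred u @^-1` [set Some s] = [set w | tau w = Some s].
      apply/seteqP; split => w /=; rewrite /occurred; first by case: ifP.
      by move=> ->; rewrite /= su.
    exact: filtration_le su _ (stopping_eq s).
  + have -> : occurred u @^-1` [set Some s] = set0.
      apply/seteqP; split => w //=; rewrite /occurred; case: ifP => // + E.
      by rewrite E /= leqNgt us.
    exact: subsigma0 (sF u).
- have -> : occurred u @^-1` [set None] = ~` [set w | le_time (tau w) (Some u)].
    apply/seteqP; split => w /=; rewrite /occurred; case: ifP => //.
    by case: (tau w).
  by apply: (subsigmaC (sF u)); exact: htau.
Qed.

(** When t <= tau almost surely, every event of F_t is almost surely equal to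
    an event of F_tau. *)
Lemma stopped_approx t A : ae_le_time P (cst_time t) tau -> F t A ->
  exists2 A', stopped F tau A' & {ae P, forall w, A w <-> A' w}.
Proof.
move=> ttau FA; pose B := [set w | le_time (Some t) (tau w)].
have BE : B = ~` \bigcup_s (if (s < t)%N then [set w | tau w = Some s] else set0).
  apply/seteqP; split => w /=; rewrite /B /=.
  - move=> h [s _]; case: ifP => // st /= E; move: h.
    by rewrite E /= leqNgt st.
  - case E : (tau w) => [s|//] /= h; rewrite leqNgt; apply/negP => st.
    by apply: h; exists s => //; rewrite st.
exists (A `&` B); last by apply: filterS ttau => w h; split => [|[]].
split.
  apply: measurableI; first exact: (subsigma_measurable (sF t) FA).
  rewrite BE; apply: measurableC; apply: bigcupT_measurable => s.
  case: ifP => // _; exact: (subsigma_measurable (sF s) (stopping_eq s)).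
move=> u; have [tu|ut] := leqP t u.
- rewrite -setIA; apply: (subsigmaI (sF u)); first exact: filtration_le FA.
  apply: (subsigmaI (sF u)); last exact: htau.
  rewrite BE; apply: (subsigmaC (sF u)); apply: (subsigma_bigcup (sF u)) => s.
  case: ifP => st; last exact: subsigma0 (sF u).
  exact: filtration_le (leq_trans (ltnW st) tu) _ (stopping_eq s).
- have -> : A `&` B `&` [set w | le_time (tau w) (Some u)] = set0.
    apply/seteqP; split => w // -[[_]]; rewrite /B /=.
    move=> h1 h2; have := @le_time_trans (Some t) _ _ h1 h2.
    by rewrite /= leqNgt ut.
  exact: subsigma0 (sF u).
Qed.

End OneTime.

Lemma stopped_cst t : stopped F (cst_time t) = F t.
Proof.
apply/seteqP; split => A.
- by move=> h; apply/(@stopped_trace (cst_time t) t).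
- by move=> h; apply/(@stopped_trace (cst_time t) t).
Qed.

(** * Pathwise integrals and the dual sets *)

(** The pathwise integral sum_(s >= 0) y_s Delta a_s. *)
Definition ser y a w : R :=
  limn (fun n => \sum_(0 <= s < n) y s w * increment a s w).

(** The limit of a at infinity. *)
Definition total a w : R := limn (a^~ w).

(** The paths of the elements of the dual sets: nondecreasing and nonnegative,
    zero before tau, constant after T, and convergent. *)
Definition good (tau : Omega -> option nat) a w : Prop :=
  [/\ forall u, 0 <= increment a u w,
      forall u, ~~ le_time (tau w) (Some u) -> a u w = 0,
      forall u, a u w = a (min_time u T) w &
      cvgn (a^~ w)].

Lemma sum_increment a w n : \sum_(0 <= s < n) increment a s w = prev a n w.
Proof.
elim: n => [|n IH]; first by rewrite big_geq.
by rewrite big_nat_recr//= IH /increment addrC subrK.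
Qed.

Lemma increment0 tau a w u : good tau a w ->
  ~~ (le_time (tau w) (Some u) && le_time (Some u) T) -> increment a u w = 0.
Proof.
move=> [_ h0 hT _]; rewrite negb_and => /orP[h|h].
- rewrite /increment h0// sub0r; case: u h => [|u] h //=; first by rewrite oppr0.
  rewrite h0 ?oppr0//; apply: contra h; case: (tau w) => //= v vu.
  exact: leqW.
- rewrite /increment; case: u h => [|u] h /=; first by case: T h.
  rewrite (hT u.+1) (hT u); move: h; rewrite /min_time; case: T => //= N.
  rewrite -ltnNge ltnS => Nu.
  by rewrite (minn_idPr Nu) (minn_idPr (leqW Nu)) subrr.
Qed.

Lemma nondecreasing_increment a w : (forall u, 0 <= increment a u w) ->
  nondecreasing_seq (a^~ w).
Proof.
move=> h; apply/nondecreasing_seqP => n.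
by have := h n.+1; rewrite /increment /= subr_ge0.
Qed.

Lemma prev_cvg a w : cvgn (a^~ w) -> (fun n => prev a n w) @ \oo --> total a w.
Proof.
move=> h; rewrite -cvg_shiftS /=.
exact: h.
Qed.

Lemma ser1 a w : cvgn (a^~ w) -> ser (fun _ _ => 1) a w = total a w.
Proof.
move=> h; apply/cvg_lim => //.
under eq_fun => n do under eq_bigr do rewrite mul1r.
under eq_fun do rewrite sum_increment.
exact: prev_cvg.
Qed.

Lemma prev_le_total a w n : (forall u, 0 <= increment a u w) ->
  cvgn (a^~ w) -> prev a n w <= total a w.
Proof.
move=> h c; have nd := nondecreasing_increment h.
have le m : a m w <= total a w by exact: nondecreasing_cvgn_le.
case: n => [|n] //=; apply: le_trans (le 0%N).
by have := h 0%N; rewrite /increment /= subr0.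
Qed.

Lemma total_ge0 tau a w : good tau a w -> 0 <= total a w.
Proof. by move=> [h _ _ c]; exact: (prev_le_total 0 h c). Qed.

Section Bounded.
Variables (tau : Omega -> option nat) (a : process) (w : Omega) (C : R).
Hypothesis ga : good tau a w.

Lemma is_cvg_ser y : (forall s, `|y s w| <= C) ->
  cvgn (fun n => \sum_(0 <= s < n) y s w * increment a s w).
Proof.
move=> yC; have [h _ _ c] := ga.
pose u s := y s w * increment a s w.
suff : cvgn [normed series u] by move=> /normed_cvg.
apply: nondecreasing_is_cvgn.
  by apply/nondecreasing_seqP => n; rewrite -subr_ge0 seriesSB /=.
exists (C * total a w) => _ [n _ <-] /=.
apply: (@le_trans _ _ (\sum_(0 <= s < n) C * increment a s w)).
  by apply: ler_sum => s _; rewrite normrM (ger0_norm (h s)) ler_wpM2r.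
rewrite -mulr_sumr sum_increment ler_wpM2l ?prev_le_total//.
exact: le_trans (yC 0%N).
Qed.

Lemma ser_bound y : (forall s, `|y s w| <= C) ->
  `|ser y a w| <= C * total a w.
Proof.
move=> yC; have [h _ _ c] := ga.
have cs := is_cvg_ser yC.
have C0 : 0 <= C by exact: le_trans (yC 0%N).
have bd n : `|\sum_(0 <= s < n) y s w * increment a s w| <= C * total a w.
  apply: (@le_trans _ _ (\sum_(0 <= s < n) C * increment a s w)).
    apply: le_trans (ler_norm_sum _ _ _) _.
    by apply: ler_sum => s _; rewrite normrM (ger0_norm (h s)) ler_wpM2r.
  by rewrite -mulr_sumr sum_increment ler_wpM2l ?prev_le_total.
rewrite ler_norml; apply/andP; split.
- apply: limr_ge => //; apply: nearW => n.
  by have := bd n; rewrite ler_norml => /andP[].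
- apply: limr_le => //; apply: nearW => n.
  by have := bd n; rewrite ler_norml => /andP[].
Qed.

Lemma ser_ge0 y : (forall s, `|y s w| <= C) -> (forall s, 0 <= y s w) ->
  0 <= ser y a w.
Proof.
move=> yC y0; have [h _ _ c] := ga.
apply: limr_ge; first exact: is_cvg_ser.
by apply: nearW => n; apply: sumr_ge0 => s _; exact: mulr_ge0.
Qed.

End Bounded.

Lemma ser_add tau a w C C' y z : good tau a w ->
  (forall s, `|y s w| <= C) -> (forall s, `|z s w| <= C') ->
  ser (fun s w => y s w + z s w) a w = ser y a w + ser z a w.
Proof.
move=> ga yC zC; have cy := is_cvg_ser ga yC; have cz := is_cvg_ser ga zC.
apply/cvg_lim => //.
rewrite (_ : (fun n => _) = fun n => \sum_(0 <= s < n) y s w * increment a s w +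
    \sum_(0 <= s < n) z s w * increment a s w); first exact: cvgD cy cz.
apply/funext => n.
by rewrite -big_split /=; apply: eq_bigr => s _; rewrite mulrDl.
Qed.

Lemma ser_scale tau a w C c y : good tau a w -> (forall s, `|y s w| <= C) ->
  ser (fun s w' => c * y s w') a w = c * ser y a w.
Proof.
move=> ga yC; have cy := is_cvg_ser ga yC; apply/cvg_lim => //.
rewrite (_ : (fun n => _) = fun n => c * \sum_(0 <= s < n) y s w * increment a s w).
  by apply: cvgM => //; exact: cvg_cst.
apply/funext => n.
by rewrite mulr_sumr; apply: eq_bigr => s _; rewrite mulrA.
Qed.

Lemma ser_le tau a w C C' y z : good tau a w ->
  (forall s, `|y s w| <= C) -> (forall s, `|z s w| <= C') ->
  (forall s, y s w <= z s w) -> ser y a w <= ser z a w.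
Proof.
move=> ga yC zC yz.
have yN s : `|-1 * y s w| <= C by rewrite mulN1r normrN.
have := @ser_ge0 tau a w (C' + C) ga (fun s w' => z s w' + -1 * y s w').
rewrite (ser_add ga zC yN) (ser_scale _ ga yC) mulN1r subr_ge0; apply.
- by move=> s; apply: le_trans (ler_normD _ _) _; apply: lerD.
- by move=> s; rewrite mulN1r subr_ge0.
Qed.

Lemma eq_ser y a z b w : (forall s, y s w * increment a s w = z s w * increment b s w) ->
  ser y a w = ser z b w.
Proof. by move=> h; rewrite /ser; congr (limn _); apply/funext => n; apply: eq_bigr. Qed.

Lemma measurable_increment a s : (forall u, measurable_fun setT (a u)) ->
  measurable_fun setT (increment a s).
Proof.
move=> ma; apply: measurable_funB; first exact: ma.
by case: s => [|s]; [exact: measurable_cst|exact: ma].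
Qed.

Lemma measurable_ser y a : (forall u, measurable_fun setT (y u)) ->
  (forall u, measurable_fun setT (a u)) -> measurable_fun setT (ser y a).
Proof.
move=> my ma; apply: measurable_limn => n.
apply: measurable_sum => s; apply: measurable_funM => //.
exact: measurable_increment.
Qed.

Lemma measurable_total a : (forall u, measurable_fun setT (a u)) ->
  measurable_fun setT (total a).
Proof. by move=> ma; apply: measurable_limn. Qed.

(** X restricted to the time interval [tau, theta]. *)
Definition window (tau theta : Omega -> option nat) y : process :=
  fun s w => if le_time (tau w) (Some s) && le_time (Some s) (theta w)
             then y s w else 0.

Lemma raw_pairingE tau theta y a :
  (fun w => limn (fun n : nat =>
    \sum_(0 <= s < n | le_time (tau w) (Some s) && le_time (Some s) (theta w))
      y s w * increment a s w)) = ser (window tau theta y) a.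
Proof.
apply/funext => w; rewrite /ser; congr (limn _); apply/funext => n.
rewrite big_mkcond /=; apply: eq_bigr => s _; rewrite /window.
by case: ifP => // _; rewrite mul0r.
Qed.

(** A path that is constant outside of [tau, T] does not see the window. *)
Lemma ser_window tau y a w : good tau a w ->
  ser (window tau (cst T) y) a w = ser y a w.
Proof.
move=> ga; apply: eq_ser => s; rewrite /window; case: ifPn => // h.
by rewrite (increment0 ga h) !mulr0.
Qed.

Lemma integral_one A : measurable A -> (\int[P]_(w in A) (1 : R)%:E = P A)%E.
Proof. by move=> mA; rewrite -[RHS]mul1e -integral_cst. Qed.

Lemma R0_measurable a u : R0 P F a -> measurable_fun setT (a u).
Proof. by move=> /(_ u) []. Qed.

(** An explicit description of the dual set D_(tau,T). *)
Definition in_dual (tau : Omega -> option nat) a : Prop :=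
  [/\ R0 P F a, {ae P, forall w, good tau a w} &
      forall A, stopped F tau A ->
        (\int[P]_(w in A) (total a w)%:E = P A)%E].

Lemma measurable_window tau theta y s : stopping_time F tau ->
  stopping_time F theta ->
  (forall u, measurable_fun setT (y u)) -> measurable_fun setT (window tau theta y s).
Proof.
move=> htau htheta my; apply: measurable_fun_ifT => //.
by apply: measurable_and; [exact: measurable_le_time|exact: measurable_ge_time].
Qed.

Lemma in_dual_integrable tau a : stopping_time F tau -> in_dual tau a -> intg (total a).
Proof.
move=> htau [Ra ga ia].
have mt : measurable_fun setT (total a) by apply: measurable_total => u; exact: R0_measurable.
apply/integrableP; split; first exact/measurable_EFinP.
rewrite (_ : (\int[P]_x `|(EFin \o total a) x| = \int[P]_x (total a x)%:E)%E).
  rewrite ia; last exact: subsigmaT (subsigma_stopped htau).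
  by rewrite probability_setT ltry.
apply: (@integral_aeq _ _ _ P (fun w => `|total a w|)) => //.
  exact: measurableT_comp.
by apply: filterS ga => w /total_ge0 h _; rewrite ger0_norm.
Qed.

Lemma min_timeK u : min_time (min_time u T) T = min_time u T.
Proof. by case: T => //= N; rewrite /min_time -minnA minnn. Qed.

(** The elements of A^1 with nonnegative increments are dominated, uniformly in
    time, by an integrable variable. *)
Lemma A1_total_bound b : A1 P F b -> {ae P, forall w, forall t, 0 <= increment b t w} ->
  exists2 S : Omega -> R, intg S & {ae P, forall w, forall n, b n w <= S w}.
Proof.
move=> [Rb nb] b0.
pose E w := (\sum_(t <oo) `|increment b t w|%:E)%E.
have mb u : measurable_fun setT (b u) by exact: R0_measurable.
have mE : measurable_fun setT E.
  apply: ge0_emeasurable_sum => t; first by move=> w _; rewrite lee_fin.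
  move=> _; apply/measurable_EFinP; apply: measurableT_comp => //.
  exact: measurable_increment.
have E0 w : (0 <= E w)%E by apply: nneseries_ge0 => t _ _; rewrite lee_fin.
have iE : P.-integrable setT E.
  apply/integrableP; split => //.
  by under eq_integral do rewrite gee0_abs//.
have fE : {ae P, forall w, E w \is a fin_num}.
  by have := integrable_ae measurableT iE; apply: filterS => w /(_ I).
exists (fine \o E).
  apply/integrableP; split; first by apply/measurable_EFinP; exact: measurableT_comp.
  move/integrableP: iE => [_]; apply: le_lt_trans.
  apply: ae_ge0_le_integral => //.
  - by apply: measurableT_comp => //; apply/measurable_EFinP; exact: measurableT_comp.
  - exact: measurableT_comp.
  - by apply: filterS fE => w h _ /=; rewrite -{2}(fineK h).
apply: filterS2 fE b0 => w h h0 n; rewrite -lee_fin /= fineK//.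
have -> : (b n w)%:E = (\sum_(0 <= t < n.+1) `|increment b t w|%:E)%E.
  rewrite sumEFin; congr EFin.
  by under eq_bigr => t _ do rewrite ger0_norm//; rewrite sum_increment.
by apply: nneseries_lim_ge => t _ _; rewrite lee_fin.
Qed.

Lemma good_proj tau b w (S : R) : (forall t, 0 <= increment b t w) ->
  (forall n, b n w <= S) -> le_time (tau w) T ->
  good tau (proj tau Tm b) w.
Proof.
move=> b0 bS tauT.
have nd := nondecreasing_increment b0.
have b0' n : 0 <= b n w.
  apply: le_trans (nd 0%N n (leq0n n)).
  by have := b0 0%N; rewrite /increment /= subr0.
have ndp : nondecreasing_seq ((proj tau Tm b)^~ w).
  apply/nondecreasing_seqP => n; rewrite /proj; case: ifP => h.
  - have -> : le_time (tau w) (Some n.+1).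
      by move: h; case: (tau w) => //= v; exact: leqW.
    apply: nd; case: T => //= N; by rewrite /min_time leq_min geq_minr andbT (leq_trans (geq_minl _ _)).
  - by case: ifP.
split.
- move=> [|u]; rewrite /increment /=; last by rewrite subr_ge0 ndp.
  by rewrite subr0 /proj; case: ifP.
- by move=> u /negbTE h; rewrite /proj h.
- move=> u; rewrite /proj /= min_timeK.
  have -> : le_time (tau w) (Some (min_time u T)) = le_time (tau w) (Some u).
    by move: tauT; case: (tau w) => //= v; exact: leq_min_time.
  by [].
- apply: nondecreasing_is_cvgn => //; exists (Num.max 0 S) => _ [n _ <-].
  by rewrite /proj; case: ifP => _; rewrite le_max ?bS ?orbT ?lexx.
Qed.

Lemma measurable_pairing_raw tau theta y a : stopping_time F tau -> stopping_time F theta ->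
  (forall u, measurable_fun setT (y u)) -> R0 P F a ->
  measurable_fun setT (ser (window tau theta y) a).
Proof.
move=> h1 h2 my Ra; apply: measurable_ser => u; last exact: R0_measurable.
exact: measurable_window.
Qed.

Lemma good_aeq tau a b : {ae P, forall w, good tau b w} -> aeqp P a b ->
  {ae P, forall w, good tau a w}.
Proof.
apply: filterS2 => w gb ab.
suff E : a^~ w = b^~ w.
  have Ei u : increment a u w = increment b u w.
    by rewrite /increment /prev ab; case: u => // u; rewrite ab.
  case: gb => h1 h2 h3 h4; split => [u|u|u|].
  - by rewrite Ei.
  - by rewrite ab; exact: h2.
  - by rewrite !ab.
  - by rewrite E.
by apply/funext => u; exact: ab.
Qed.

(** This description avoids projections and pairings: an element of the dual set
    is its own projection, and <1, a> = 1 says that the total mass has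
    conditional expectation 1. *)
Lemma dualP tau a : stopping_time F tau -> ae_le_time P tau Tm ->
  dual P F tau Tm a <-> in_dual tau a.
Proof.
move=> htau tauT; have stau := subsigma_stopped htau.
have m1 (u : nat) : measurable_fun setT (((fun _ _ => 1) : process) u) by exact: measurable_cst.
have rawE : {ae P, forall w, good tau a w} ->
    aeq P (ser (window tau Tm (fun _ _ => 1)) a) (total a).
  by apply: filterS => w ga; rewrite ser_window// ser1//; case: ga.
split.
- move=> [[Ra [b [Ab b0] ab]]]; rewrite /mass /pairing raw_pairingE => ma.
  have [S iS bS] := A1_total_bound Ab b0.
  have gb : {ae P, forall w, good tau (proj tau Tm b) w}.
    apply: filterS3 b0 bS tauT => w h1 h2 h3; exact: good_proj h2 h3.
  have ga := good_aeq gb ab.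
  have mt : measurable_fun setT (total a) by apply: measurable_total => u; exact: R0_measurable.
  have it : intg (total a).
    apply: integrable_dominated (integrable_norm iS) _ => //.
    apply: filterS3 ga ab bS => w gaw abw bSw.
    rewrite ger0_norm ?(total_ge0 gaw)//.
    apply: limr_le; first by case: gaw.
    apply: nearW => n; rewrite abw /proj /=; case: ifP => _; last exact: normr_ge0.
    by apply: le_trans (ler_norm _); exact: bSw.
  split => // A sA; have mA := subsigma_measurable stau sA.
  have mr := measurable_pairing_raw htau (stopping_cst_option T) m1 Ra.
  have ir : intg (ser (window tau Tm (fun _ _ => 1)) a).
    apply: integrable_aeq it => //.
    by have := rawE ga; apply: filterS => w ->.
  transitivity (\int[P]_(w in A) (ser (window tau Tm (fun _ _ => 1)) a w)%:E)%E.
    by apply: integral_aeq => //; apply: filterS (rawE ga) => w ->.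
  rewrite -(integral_condexp stau ir sA).
  transitivity (\int[P]_(w in A) ((cst 1 w : R))%:E)%E.
    apply: integral_aeq => //; first exact: measurable_condexp.
    by apply: filterS ma => w ->.
  exact: integral_one.
- move=> ha; have it := in_dual_integrable htau ha; have [Ra ga ia] := ha.
  have mr := measurable_pairing_raw htau (stopping_cst_option T) m1 Ra.
  have ir : intg (ser (window tau Tm (fun _ _ => 1)) a).
    apply: integrable_aeq it => //.
    by have := rawE ga; apply: filterS => w ->.
  split; last first.
    rewrite /mass /pairing raw_pairingE; apply: condexp_unique => //.
    split; [exact: measurable_cst|exact: integrable_const|].
    move=> A sA; have mA := subsigma_measurable stau sA.
    rewrite [LHS]integral_one// -ia//; apply: integral_aeq => //.
      by apply: measurable_total => u; exact: R0_measurable.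
    by apply: filterS (rawE ga) => w ->.
  split => //; exists a; last first.
    apply: filterS ga => w [h1 h2 h3 h4] u; rewrite /proj; case: ifPn => h.
    + exact: h3.
    + exact: h2.
  split; last by apply: filterS ga => w [].
  split => //; rewrite /A1_norm.
  have -> : (\int[P]_w \sum_(t <oo) `|increment a t w|%:E = \int[P]_w (total a w)%:E)%E.
    apply: ae_eq_integral => //.
    + apply: ge0_emeasurable_sum => t; first by move=> w _; rewrite lee_fin.
      move=> _; apply/measurable_EFinP; apply: measurableT_comp => //.
      by apply: measurable_increment => u; exact: R0_measurable.
    + by apply/measurable_EFinP; apply: measurable_total => u; exact: R0_measurable.
    + apply: filterS ga => w [h1 h2 h3 h4] _.
      apply/cvg_lim => //.
      rewrite (_ : (fun n => _) = (fun n => (prev a n w)%:E)).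
        by apply: cvg_EFin; [exact: nearW|exact: prev_cvg].
      apply/funext => n; rewrite sumEFin -sum_increment; congr EFin.
      by apply: eq_bigr => s _; rewrite ger0_norm.
  rewrite ia ?probability_setT ?ltry//; exact: subsigmaT stau.
Qed.

Lemma is_condexp_aeq G f f' g : subsigma G -> measurable_fun setT f ->
  measurable_fun setT f' -> aeq P f f' -> is_condexp P G f g ->
  is_condexp P G f' g.
Proof.
move=> sG mf mf' ff' [mg ig Ig]; split => // A GA.
rewrite Ig//; apply: integral_aeq => //; first exact: subsigma_measurable GA.
by apply: filterS ff' => w ->.
Qed.

(** * Monetary utility functionals *)

(** Bounded processes on [s, T], described through their paths. *)
Definition bounded_on (s : nat) (C : R) X : Prop :=
  R0 P F X /\ {ae P, forall w, forall u, [/\ `|X u w| <= C,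
    (u < s)%N -> X u w = 0 & X u w = X (min_time u T) w]}.

Lemma Rinf_onP s X : le_time (Some s) T ->
  Rinf_on P F (cst_time s) Tm X <-> exists C, bounded_on s C X.
Proof.
move=> sT.
have min_s u := leq_min_time u sT.
split.
- move=> [RX [Y [RY [C YC]] XY]]; exists `|C|; split => //.
  apply: filterS2 YC XY => w h1 h2 u; rewrite !h2 /proj /= min_s; split.
  + case: ifP => _; last by rewrite normr0.
    by apply: (le_trans (h1 _)); exact: ler_norm.
  + by move=> us; rewrite leqNgt us.
  + by case: ifP => //; rewrite (min_timeK).
- move=> [C [RX h]]; split => //; exists X.
    by split => //; exists C; apply: filterS h => w h u; have [] := h u.
  apply: filterS h => w h u; rewrite /proj /=; have [_ h2 h3] := h u.
  by case: leqP => // us; rewrite h2.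
Qed.

(** The restriction of X to [s, oo). *)
Definition start (s : nat) X : process := proj (cst_time s) Tm X.

Lemma startE s X u w : start s X u w = if (s <= u)%N then X (min_time u T) w else 0.
Proof. by []. Qed.

Lemma start_aeq t C s X : bounded_on t C X ->
  {ae P, forall w, forall u, start s X u w = if (s <= u)%N then X u w else 0}.
Proof.
move=> [_ h]; apply: filterS h => w h u; rewrite startE.
by have [_ _ <-] := h u.
Qed.

Lemma R0_subfiltration X s u : R0 P F X -> (s <= u)%N -> L0 P (F u) (X s).
Proof.
move=> RX su; exact: (L0_subsigma (sF s) (sF u) (filtration_le su) (RX s)).
Qed.

Lemma bounded_on_ge0 s C X : bounded_on s C X -> 0 <= C.
Proof.
move=> [_ h]; rewrite leNgt; apply/negP => C0.
have h0 : {ae P, forall w, False}.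
  apply: filterS h => w h; have [h1 _ _] := h 0%N.
  by have := lt_le_trans C0 (le_trans (normr_ge0 _) h1); rewrite ltxx.
have [N [mN N0 sN]] := h0.
have NT : N = setT by apply/seteqP; split => // w _; exact: sN.
by move: N0; rewrite NT probability_setT => /eqP; rewrite onee_eq0.
Qed.

Lemma start_bounded t C s X : le_time (Some s) T -> bounded_on t C X ->
  bounded_on s C (start s X).
Proof.
move=> sT bX; have C0 := bounded_on_ge0 bX; have [RX h] := bX; split.
- move=> u; rewrite /start (_ : proj _ _ _ u = if (s <= u)%N then X (min_time u T) else cst 0).
    case: leqP => _; last exact: (L0_cst P (sF u)).
    by apply: R0_subfiltration => //; case: T => //= N; exact: geq_minl.
  by apply/funext => w; rewrite /proj /=; case: ifP.
- apply: filterS h => w h u; rewrite !startE (min_timeK).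
  rewrite (leq_min_time u sT).
  split => //.
  + by case: ifP => _; [have [] := h (min_time u T)|rewrite normr0].
  + by move=> us; rewrite leqNgt us.
Qed.

Variable phi : nat -> process -> Omega -> R.
Hypothesis hphi : utility_process P F T phi.

Section OneTime.
Variable s : nat.
Hypothesis sT : le_time (Some s) T.

Let phi_monetary : monetary_utility_functional P F (cst_time s) Tm (phi s).
Proof. by have [] := hphi sT. Qed.

Lemma phi_Linf C X : bounded_on s C X -> Linf P (F s) (phi s X).
Proof.
move=> bX; have [h _ _ _] := phi_monetary.
by rewrite -stopped_cst; apply: h; apply/(Rinf_onP _ sT); exists C.
Qed.

Lemma phi_indic C X A : bounded_on s C X -> F s A ->
  aeq P (phi s (fun t w => \1_A w * X t w)) (fun w => \1_A w * phi s X w).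
Proof.
move=> bX FA; have [_ h _ _] := phi_monetary.
by apply: h; [apply/(Rinf_onP _ sT); exists C|rewrite stopped_cst].
Qed.

Lemma phi_le C C' X Y : bounded_on s C X -> bounded_on s C' Y ->
  {ae P, forall w, forall u, X u w <= Y u w} ->
  {ae P, forall w, phi s X w <= phi s Y w}.
Proof.
move=> bX bY; have [_ _ h _] := phi_monetary.
by apply: h; apply/(Rinf_onP _ sT); [exists C|exists C'].
Qed.

Lemma phi_aeqp C C' X Y : bounded_on s C X -> bounded_on s C' Y ->
  aeqp P X Y -> aeq P (phi s X) (phi s Y).
Proof.
move=> bX bY XY.
have h1 : {ae P, forall w, phi s X w <= phi s Y w}.
  by apply: phi_le bX bY _; apply: filterS XY => w h u; rewrite h.
have h2 : {ae P, forall w, phi s Y w <= phi s X w}.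
  by apply: phi_le bY bX _; apply: filterS XY => w h u; rewrite h.
by apply: filterS2 h1 h2 => w l1 l2; apply/eqP; rewrite eq_le l1 l2.
Qed.

Lemma bounded_indic C X A : bounded_on s C X -> F s A ->
  bounded_on s C (fun t w => \1_A w * X t w).
Proof.
move=> bX FA; have [RX h] := bX; split.
- move=> u; have [su|us] := leqP s u.
    apply: L0_mul => //; apply: (L0_indic P (sF u)).
    exact: (filtration_le su).
  apply: (L0_aeq _ _ (L0_cst P (sF u) 0)).
    apply: measurable_funM; last exact: (R0_measurable _ RX).
    by apply: measurable_indic; exact: (subsigma_measurable (sF s)).
  by apply: filterS h => w h; have [_ -> // _] := h u; rewrite mulr0.
- apply: filterS h => w h u; have [h1 h2 h3] := h u; split.
  + rewrite normrM (le_trans _ h1)// -[leRHS]mul1r ler_wpM2r//.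
    by rewrite indicE; case: (w \in A); rewrite ?normr1 ?normr0 ?ler01.
  + by move=> us; rewrite h2// mulr0.
  + by rewrite -h3.
Qed.

(** phi depends locally on its argument. *)
Lemma phi_local C C' X Y A : bounded_on s C X -> bounded_on s C' Y -> F s A ->
  {ae P, forall w, A w -> forall u, X u w = Y u w} ->
  {ae P, forall w, A w -> phi s X w = phi s Y w}.
Proof.
move=> bX bY FA XY.
have h : aeq P (phi s (fun t w => \1_A w * X t w)) (phi s (fun t w => \1_A w * Y t w)).
  apply: phi_aeqp (bounded_indic bX FA) (bounded_indic bY FA) _.
  apply: filterS XY => w h u; rewrite indicE; have [Aw|nA] := pselect (A w).
    by rewrite h.
  by rewrite memNset// !mul0r.
apply: filterS3 (phi_indic bX FA) (phi_indic bY FA) h => w h1 h2 h3 Aw.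
have iA : \1_A w = 1 :> R by rewrite indicE mem_set.
have E1 : phi s (fun t w => \1_A w * X t w) w = phi s X w by rewrite h1 iA mul1r.
have E2 : phi s (fun t w => \1_A w * Y t w) w = phi s Y w by rewrite h2 iA mul1r.
by rewrite -E1 -E2.
Qed.

Let zero : process := fun _ _ => 0.

Let zero_bounded : bounded_on s 0 zero.
Proof.
split; first by move=> u; exact: (L0_cst P (sF u)).
by apply: aeW => w u; split => //; rewrite normr0.
Qed.

Let phi_zero : aeq P (phi s zero) (cst 0).
Proof.
have := phi_indic zero_bounded (subsigma0 (sF s)).
have -> : (fun (t : nat) w => \1_set0 w * zero t w) = zero.
  by apply/funext => u; apply/funext => w; rewrite /zero mulr0.
by apply: filterS => w ->; rewrite indicE in_set0 mul0r.
Qed.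

(** phi is normalized: it sends a payment of m at time s to m. *)
Lemma phi_payment (m : Omega -> R) : Linf P (F s) m ->
  aeq P (phi s (fun u w => m w * ind_from R (cst_time s) u w)) m.
Proof.
move=> Lm; have [_ _ _ h] := phi_monetary.
have := h zero m; rewrite stopped_cst => /(_ _ Lm) {}h.
have := h ((Rinf_onP _ sT).2 (ex_intro _ 0 zero_bounded)).
rewrite (_ : (fun _ _ => _) = (fun u w => m w * ind_from R (cst_time s) u w)).
  by apply: filterS2 phi_zero => w -> ->; rewrite add0r.
by apply/funext => u; apply/funext => w; rewrite /zero add0r.
Qed.

Lemma payment_bounded (m : Omega -> R) C : L0 P (F s) m ->
  {ae P, forall w, `|m w| <= C} -> 0 <= C ->
  bounded_on s C (fun u w => m w * ind_from R (cst_time s) u w).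
Proof.
move=> Lm mC C0; split.
- move=> u; have [su|us] := leqP s u.
    rewrite (_ : (fun _ => _) = m).
      exact: (L0_subsigma (sF s) (sF u) (filtration_le su) Lm).
    by apply/funext => w; rewrite /ind_from /= su mulr1.
  rewrite (_ : (fun _ => _) = cst 0); first exact: (L0_cst P (sF u)).
  by apply/funext => w; rewrite /ind_from /= leqNgt us mulr0.
- apply: filterS mC => w mC u; rewrite /ind_from /=; split.
  + by case: leqP; rewrite ?mulr1// mulr0 normr0.
  + by move=> us; rewrite leqNgt us mulr0.
  + by rewrite (leq_min_time u sT).
Qed.

Lemma phi_bound C X : bounded_on s C X -> {ae P, forall w, `|phi s X w| <= C}.
Proof.
move=> bX; have C0 := bounded_on_ge0 bX; have [RX hX] := bX.
have key (c : R) : `|c| <= C ->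
    bounded_on s C (fun u w => c * ind_from R (cst_time s) u w) /\
    aeq P (phi s (fun u w => c * ind_from R (cst_time s) u w)) (cst c).
  move=> cC; split.
    by apply: payment_bounded => //; [exact: (L0_cst P (sF s))|exact: aeW].
  apply: (phi_payment (m := cst c)); split; first exact: (L0_cst P (sF s)).
  by exists C; exact: aeW.
have [|b1 p1] := key C; first by rewrite ger0_norm.
have [|b2 p2] := key (- C); first by rewrite normrN ger0_norm.
have le1 : {ae P, forall w, phi s X w <= phi s (fun u w => C * ind_from R (cst_time s) u w) w}.
  apply: phi_le bX b1 _; apply: filterS hX => w h u; have [h1 h2 _] := h u.
  rewrite /ind_from /=; case: leqP => us; last by rewrite h2// mulr0.
  by rewrite mulr1 (le_trans (ler_norm _)).
have le2 : {ae P, forall w, phi s (fun u w => - C * ind_from R (cst_time s) u w) w <= phi s X w}.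
  apply: phi_le b2 bX _; apply: filterS hX => w h u; have [h1 h2 _] := h u.
  rewrite /ind_from /=; case: leqP => us; last by rewrite h2// mulr0.
  by rewrite mulr1; move: h1; rewrite ler_norml => /andP[].
have c1 : {ae P, forall w, phi s X w <= C}.
  apply: filterS2 le1 p1 => w h1 h2.
  exact: (eq_ind _ (fun x => phi s X w <= x) h1 _ h2).
have c2 : {ae P, forall w, - C <= phi s X w}.
  apply: filterS2 le2 p2 => w h1 h2.
  exact: (eq_ind _ (fun x => x <= phi s X w) h1 _ h2).
by apply: filterS2 c1 c2 => w h1 h2; rewrite ler_norml h1 h2.
Qed.

End OneTime.

Section AtStoppingTime.
Variables (t : nat) (theta : Omega -> option nat) (X : process) (C : R).
Hypothesis tT : le_time (Some t) T.
Hypothesis htheta : stopping_time F theta.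
Hypothesis fin_theta : ae_finite P theta.
Hypothesis t_theta : ae_le_time P (cst_time t) theta.
Hypothesis theta_T : ae_le_time P theta Tm.
Hypothesis bX : bounded_on t C X.

Let Phi := utility_at T phi theta (proj theta Tm X).

(** phi_{theta,T} is obtained by gluing the phi_{s,T} on {theta = s}. *)
Lemma utility_atE :
  {ae P, forall w, forall s, theta w = Some s -> Phi w = phi s (start s X) w}.
Proof.
pose A s := [set w | theta w = Some s].
have h : {ae P, forall w, forall s, le_time (Some s) T ->
    phi s (fun u w' => (theta w' == Some s)%:R * proj theta Tm X u w') w =
    \1_(A s) w * phi s (start s X) w}.
  apply: ae_forall_time => s sT.
  have := phi_indic sT (start_bounded sT bX) (stopping_eq htheta s).
  rewrite (_ : (fun _ _ => _) = (fun u w' => (theta w' == Some s)%:R * proj theta Tm X u w')).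
    by apply: filterS => w.
  apply/funext => u; apply/funext => w; rewrite indicE /start /proj.
  case: eqP => [E|nE]; first by rewrite mem_set// E.
  by rewrite memNset// !mul0r.
apply: filterS2 h theta_T => w h wT s E.
have sT : le_time (Some s) T by move: wT; rewrite E.
rewrite /Phi /utility_at; apply/cvg_lim => //.
apply: cvg_near_cst; exists s.+1 => // n sn; have {}sn : (s < n)%N := sn.
rewrite big_mkcond (bigD1_seq s) ?mem_index_iota ?iota_uniq//.
rewrite sT h// indicE mem_set// mul1r big1 => [|i is_]; first exact: addr0.
case: ifP => // iT; rewrite h// indicE memNset ?mul0r//.
by rewrite /A /= E => -[si]; rewrite si eqxx in is_.
Qed.

Lemma measurable_utility_at : measurable_fun setT Phi.
Proof.
rewrite /Phi /utility_at.
have -> : (fun w => limn (fun n => \sum_(0 <= s < n | le_time (Some s) T)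
    phi s (fun u w' => (theta w' == Some s)%:R * proj theta Tm X u w') w)) =
  (fun w => limn (fun n => \sum_(0 <= s < n)
    (if le_time (Some s) T then
    phi s (fun u w' => (theta w' == Some s)%:R * proj theta Tm X u w') else cst 0) w)).
  apply/funext => w; congr (limn _); apply/funext => n; rewrite big_mkcond.
  by apply: eq_bigr => s _; case: ifP.
apply: measurable_limn => n; apply: measurable_sum => s.
case: ifP => sT; last exact: measurable_cst.
rewrite (_ : (fun _ _ => _) = (fun u w' => \1_[set w | theta w = Some s] w' * start s X u w')).
  have b := bounded_indic (start_bounded sT bX) (stopping_eq htheta s).
  by have [[]] := phi_Linf sT b.
apply/funext => u; apply/funext => w; rewrite indicE /start /proj.
case: eqP => [E|nE]; first by rewrite mem_set// E.
by rewrite memNset// !mul0r.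
Qed.

Lemma utility_at_bound : {ae P, forall w, `|Phi w| <= C}.
Proof.
have h : {ae P, forall w, forall s, le_time (Some s) T -> `|phi s (start s X) w| <= C}.
  by apply: ae_forall_time => s sT; exact: (phi_bound sT (start_bounded sT bX)).
have h2 : {ae P, forall w, theta w != None /\ le_time (theta w) T}.
  by apply: filterS2 fin_theta theta_T.
apply: filterS3 h h2 utility_atE => w h1 [].
by case E : (theta w) => [s|//] _ sT /(_ _ erefl) ->; exact: h1.
Qed.

(** An F_theta-measurable version of phi_{theta,T}(X). *)
Lemma utility_at_version : exists2 Psi, measurable_wrt (stopped F theta) Psi &
  aeq P Phi Psi.
Proof.
have /choice[g hg] : forall s, exists g : Omega -> R, measurable_wrt (F s) g /\
    (le_time (Some s) T -> aeq P (phi s (start s X)) g).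
  move=> s; have [sT|sT] := boolP (le_time (Some s) T).
    by have [[_ [g mg h]] _] := phi_Linf sT (start_bounded sT bX); exists g.
  by exists (cst 0); split => //; exact: measurable_cst.
pose f (i : option nat) : Omega -> R := if i is Some s then (fun w => \1_[set w | theta w = Some s] w * g s w) else cst 0.
have sG := subsigma_stopped htheta.
exists (fun w => f (theta w) w).
  apply: (@measurable_wrt_glue _ _ _ sG _ _ _ theta f) => [[s|]|[s|]].
  - exact: stopped_eq.
  - exact: stopped_eqN.
  - apply: (measurable_wrt_trace sG (sF s) _ _ _ (hg s).1).
    + exact: stopped_eq.
    + exact: stopping_eq.
    + by move=> A sA FA; apply/(stopped_trace sA).
  - exact: measurable_cst.
have h : {ae P, forall w, forall s, le_time (Some s) T -> phi s (start s X) w = g s w}.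
  by apply: ae_forall_time => s sT; exact: (hg s).2.
have h2 : {ae P, forall w, theta w != None /\ le_time (theta w) T}.
  by apply: filterS2 fin_theta theta_T.
apply: filterS3 h h2 utility_atE => w h1 [].
case E : (theta w) => [s|//] _ sT /(_ _ erefl) ->.
by rewrite h1// /f indicE mem_set// mul1r.
Qed.

(** The process X before theta, continued by phi_{theta,T}(X). *)
Definition stopped_utility : process := fun s w =>
  X s w * ind_between R (cst_time t) theta s w + Phi w * ind_from R theta s w.

Lemma stopped_utilityE : {ae P, forall w, exists2 s, theta w = Some s &
  [/\ (t <= s)%N, le_time (Some s) T &
   forall u, stopped_utility u w = if (s <= u)%N then Phi w else X u w]}.
Proof.
have h2 : {ae P, forall w, [/\ theta w != None, le_time (Some t) (theta w) & le_time (theta w) T]}.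
  by apply: filterS3 fin_theta t_theta theta_T.
apply: filterS2 bX.2 h2 => w hX [].
case E : (theta w) => [s|//] _ ts sT; exists s => //; split => // u.
rewrite /stopped_utility /ind_between /ind_from E /=.
have [su|us] := leqP s u; first by rewrite andbF mulr0 add0r mulr1.
rewrite mulr0 addr0 andbT; have [tu|ut] := leqP t u; first by rewrite mulr1.
by have [_ -> // _] := hX u; rewrite mul0r.
Qed.

Lemma stopped_utility_bounded : bounded_on t C stopped_utility.
Proof.
have [RX hX] := bX; split.
- move=> u.
  pose f (i : option nat) : Omega -> R := if i is Some s then
    (if (s <= u)%N && le_time (Some s) T then phi s (start s X) else cst 0) else X u.
  apply: (@L0_aeq _ _ _ P _ _ _ _ (fun w => f (occurred theta u w) w)).
  + apply: measurable_funD; apply: measurable_funM.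
    * exact: (R0_measurable _ RX).
    * apply: (measurable_bool_ind (b := fun w => (t <= u)%N && ~~ le_time (theta w) (Some u))).
      apply: measurable_and; first exact: measurable_cst.
      by apply: measurable_neg; exact: measurable_le_time.
    * exact: measurable_utility_at.
    * exact: (measurable_bool_ind (measurable_le_time u htheta)).
  + apply: filterS2 stopped_utilityE utility_atE => w [s E [ts sT h]] hPhi.
    rewrite h /occurred E [le_time _ _]/=; case: (leqP s u) => su; last by [].
    by rewrite /f su sT; exact: hPhi.
  + apply: (L0_glue (sF u)) => [i|[s|]]; first exact: measurable_occurred.
    * rewrite /f; case: ifP => [/andP[su sT]|_]; last exact: (L0_cst P (sF u)).
      have [L _] := phi_Linf sT (start_bounded sT bX).
      exact: (L0_subsigma (sF s) (sF u) (filtration_le su) L).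
    * exact: RX.
- apply: filterS3 stopped_utilityE utility_at_bound hX => w [s E [ts sT h]] hPhi hX' u.
  have [h1 h2 h3] := hX' u; rewrite !h.
  rewrite (leq_min_time u sT).
  split.
  + by case: ifP.
  + by move=> ut; rewrite leqNgt (leq_trans ut ts) h2.
  + by rewrite -h3.
Qed.

End AtStoppingTime.

(** * Concatenation at a stopping time *)

Section AtTheta.
Variable theta : Omega -> option nat.
Hypothesis htheta : stopping_time F theta.
Hypothesis fin_theta : ae_finite P theta.
Hypothesis theta_T : ae_le_time P theta Tm.
Local Notation Gt := (stopped F theta).
Local Notation sG := (subsigma_stopped htheta).
Local Notation mT a := (mass P F theta Tm a).
Local Notation mI a := (mass P F theta infty a).

Lemma measurable_theta_eq i : measurable (theta @^-1` [set i]).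
Proof.
by case: i => [s|]; apply: (subsigma_measurable sG); [exact: stopped_eq|exact: stopped_eqN].
Qed.

Lemma measurable_prev a s : (forall u, measurable_fun setT (a u)) ->
  measurable_fun setT (prev a s).
Proof. by move=> ma; case: s => [|s]; [exact: measurable_cst|exact: ma]. Qed.

Lemma L0_prev a u s : R0 P F a -> (s <= u)%N -> L0 P (F u) (prev a s).
Proof.
move=> Ra su; case: s su => [|s] su; first exact: (L0_cst P (sF u) 0).
by apply: L0_subsigma (sF s) (sF u) _ (Ra s); apply: filtration_le; exact: ltnW.
Qed.

Lemma measurable_prev_at a : (forall u, measurable_fun setT (a u)) ->
  measurable_fun setT (prev_at a theta).
Proof.
move=> ma.
pose f (i : option nat) : Omega -> R := if i is Some s then prev a s else cst 0.
have -> : prev_at a theta = (fun w => f (theta w) w).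
  by apply/funext => w; rewrite /prev_at /f; case: (theta w).
apply: (@measurable_glue _ _ _ _ _ theta f) => [i|[s|]]; first exact: measurable_theta_eq.
- exact: measurable_prev.
- exact: measurable_cst.
Qed.

(** The mass of a on [theta, oo). *)
Definition tail a (w : Omega) : R := total a w - prev_at a theta w.

Lemma measurable_tail a : R0 P F a -> measurable_fun setT (tail a).
Proof.
move=> Ra; apply: measurable_funB.
- by apply: measurable_total => u; exact: R0_measurable.
- by apply: measurable_prev_at => u; exact: R0_measurable.
Qed.

Lemma prev_at_bounds tau a w : good tau a w ->
  0 <= prev_at a theta w <= total a w.
Proof.
move=> ga; have [h _ _ c] := ga; rewrite /prev_at; case: (theta w) => [s|].
- apply/andP; split; last exact: prev_le_total.
  case: s => [|s] //=; apply: le_trans (nondecreasing_increment h (leq0n s)).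
  by have := h 0%N; rewrite /increment /= subr0.
- by rewrite lexx (total_ge0 ga).
Qed.

Lemma tail_ge0 tau a w : good tau a w -> 0 <= tail a w.
Proof. by move=> /prev_at_bounds/andP[_]; rewrite subr_ge0. Qed.

(** The part of y from theta on. *)
Definition after y : process :=
  fun s w => if le_time (theta w) (Some s) then y s w else 0.

Lemma ser_after1 a w s : cvgn (a^~ w) -> theta w = Some s ->
  ser (after (fun _ _ => 1)) a w = tail a w.
Proof.
move=> c E; apply/cvg_lim => //; rewrite /tail /prev_at E.
have : (fun n => prev a n w - prev a s w) @ \oo --> total a w - prev a s w.
  by apply: cvgB; [exact: prev_cvg|exact: cvg_cst].
apply: cvg_trans; apply: near_eq_cvg.
exists s => // n /= sn.
rewrite -!sum_increment (big_cat_nat (leq0n s) sn)//= addrAC subrr add0r.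
rewrite [RHS](big_cat_nat (leq0n s) sn)//=.
rewrite (_ : \sum_(0 <= i < s) after _ i w * _ = 0); last first.
  rewrite big_nat big1// => i /andP[_ is_].
  by rewrite /after E /= leqNgt is_ mul0r.
rewrite add0r !big_nat; apply: eq_bigr => i /andP[si _].
by rewrite /after E /= si mul1r.
Qed.

Lemma raw_tail tau rho a w : good tau a w -> theta w != None ->
  (forall u, le_time (Some u) T -> le_time (Some u) (rho w)) ->
  ser (window theta rho (fun _ _ => 1)) a w = tail a w.
Proof.
move=> ga; case E : (theta w) => [s|//] _ h.
rewrite -(@ser_after1 a w s)//; last by case: ga.
apply: eq_ser => u; rewrite /window /after.
case uT : (le_time (Some u) T); first by rewrite h// andbT.
by rewrite (increment0 ga) ?mulr0// uT andbF.
Qed.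

(** Adapted processes whose paths are as in the dual sets and whose total mass is
    integrable; the total mass need not have conditional expectation 1. *)
Definition adm tau a := [/\ R0 P F a, {ae P, forall w, good tau a w} & intg (total a)].

Lemma in_dual_adm tau a : stopping_time F tau -> in_dual tau a -> adm tau a.
Proof.
by move=> htau ha; split; [case: ha..|exact: (in_dual_integrable htau ha)].
Qed.

Lemma integrable_tail tau a : adm tau a -> intg (tail a).
Proof.
move=> [Ra ga it]; apply: integrable_dominated it _; first exact: measurable_tail.
apply: filterS ga => w ga; rewrite ger0_norm ?(tail_ge0 ga)//.
by rewrite /tail lerBlDr lerDl; have /andP[] := prev_at_bounds ga.
Qed.

Lemma integrable_prev_at tau a : adm tau a -> intg (prev_at a theta).
Proof.
move=> [Ra ga it]; apply: integrable_dominated it _.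
  by apply: measurable_prev_at => u; exact: R0_measurable.
by apply: filterS ga => w /prev_at_bounds /andP[h1 h2]; rewrite ger0_norm.
Qed.

(** <1, a>_{theta,rho} is the conditional expectation of the mass of a on
    [theta, oo) as soon as rho >= T. *)
Lemma mass_condexp tau rho a : adm tau a -> stopping_time F rho ->
  (forall w u, le_time (Some u) T -> le_time (Some u) (rho w)) ->
  is_condexp P Gt (tail a) (mass P F theta rho a).
Proof.
move=> aa hrho h; have [Ra ga it] := aa.
rewrite /mass /pairing raw_pairingE.
have m1 (u : nat) : measurable_fun setT (((fun _ _ => 1) : process) u) by exact: measurable_cst.
have mr := measurable_pairing_raw htheta hrho m1 Ra.
have E : aeq P (ser (window theta rho (fun _ _ => 1)) a) (tail a).
  by apply: filterS2 ga fin_theta => w gaw fw; exact: raw_tail gaw fw (h w).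
apply: (is_condexp_aeq sG mr (measurable_tail Ra) E).
apply: condexpP; first exact: sG.
apply: integrable_aeq (integrable_tail aa) => //.
by apply: filterS E => w ->.
Qed.

Lemma mass_T tau a : adm tau a -> is_condexp P Gt (tail a) (mT a).
Proof. by move=> aa; apply: mass_condexp aa (stopping_cst_option T) _. Qed.

Lemma mass_infty tau a : adm tau a -> is_condexp P Gt (tail a) (mI a).
Proof.
by move=> aa; apply: mass_condexp aa (stopping_cst_option None) _ => w u.
Qed.

Lemma mass_aeq tau a : adm tau a -> aeq P (mI a) (mT a).
Proof.
by move=> aa; apply: (is_condexp_unique sG (mass_infty aa) (mass_T aa)).
Qed.

Lemma is_condexp_ge0 G f g : subsigma G -> intg f -> is_condexp P G f g ->
  {ae P, forall w, 0 <= f w} -> {ae P, forall w, 0 <= g w}.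
Proof.
move=> sG' fi fg f0.
by apply: filterS2 (condexp_ge0 sG' fi f0) (condexp_unique sG' fi fg) => w + <-.
Qed.

Lemma mass_ge0 tau a : adm tau a -> {ae P, forall w, 0 <= mT a w}.
Proof.
move=> aa; apply: is_condexp_ge0 (sG) (integrable_tail aa) (mass_T aa) _.
by have [_ ga _] := aa; apply: filterS ga => w; exact: tail_ge0.
Qed.

Lemma prev_at0 b w : good theta b w -> prev_at b theta w = 0.
Proof.
move=> [_ h _ _]; rewrite /prev_at; case E : (theta w) => [[|s]|] //=.
by rewrite h// E /= -ltnNge.
Qed.

(** For b in D_theta and Y nonnegative, F_theta-measurable and integrable,
    Y b_oo is integrable with conditional expectation Y. *)
Lemma mul_total_condexp b Y : in_dual theta b -> measurable_wrt Gt Y ->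
  intg Y -> {ae P, forall w, 0 <= Y w} ->
  intg (fun w => Y w * total b w) /\
  is_condexp P Gt (fun w => Y w * total b w) Y.
Proof.
move=> hb mY iY Y0; have [Rb gb ib] := hb.
have mt : measurable_fun setT (total b) by apply: measurable_total => u; exact: R0_measurable.
have t0 : {ae P, forall w, 0 <= total b w} by apply: filterS gb => w /total_ge0.
have mYf := measurable_wrt_fun sG mY.
have mYt : measurable_fun setT (fun w => Y w * total b w) by exact: measurable_funM.
have E A : Gt A -> (\int[P]_(w in A) (Y w)%:E = \int[P]_(w in A) (Y w * total b w)%:E)%E.
  move=> GA; have mA := subsigma_measurable sG GA.
  pose Z w := `|Y w|.
  have mZ : measurable_wrt Gt Z by exact: measurableT_comp.
  have mZf := measurable_wrt_fun sG mZ.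
  transitivity (\int[P]_(w in A) (Z w * cst 1 w)%:E)%E.
    apply: integral_aeq => //; first exact: measurable_funM.
    by apply: filterS Y0 => w h _; rewrite /Z /= mulr1 ger0_norm.
  transitivity (\int[P]_(w in A) (Z w * total b w)%:E)%E; last first.
    apply: integral_aeq => //; first exact: measurable_funM.
    by apply: filterS Y0 => w h _; rewrite /Z ger0_norm.
  apply: (ae_ge0_integral_pull sG mZ (fun w => normr_ge0 _)) => //; first by apply: aeW.
  by move=> B GB; rewrite ib// integral_one//; exact: (subsigma_measurable sG GB).
have iYt : intg (fun w => Y w * total b w).
  apply/integrableP; split; first exact/measurable_EFinP.
  rewrite (_ : (\int[P]_x `|(EFin \o (fun w => (Y w * total b w)%R)) x| = \int[P]_x (Y x * total b x)%:E)%E).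
    rewrite -E; last exact: subsigmaT sG.
    by rewrite ltey_eq integral_fin.
  apply: (@integral_aeq _ _ _ P (fun w => `|Y w * total b w|)) => //.
    exact: measurableT_comp.
  by apply: filterS2 Y0 t0 => w h1 h2 _; rewrite ger0_norm// mulr_ge0.
by split.
Qed.

(** On {theta = s} an F_theta-measurable variable is F_s-measurable. *)
Lemma measurable_wrt_at s (Y : Omega -> R) : measurable_wrt Gt Y ->
  measurable_wrt (F s) (fun w => \1_[set w | theta w = Some s] w * Y w).
Proof.
move=> mY; apply: measurable_wrt_trace (sF s) (sG) _ _ _ mY.
- exact: stopping_eq.
- exact: stopped_eq.
- by move=> A AB /(stopped_trace AB).
Qed.

(** Equality of the integrals over F_theta passes to F_t when t <= theta. *)
Lemma integral_tower t f g : ae_le_time P (cst_time t) theta ->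
  intg f -> intg g ->
  (forall A, Gt A -> \int[P]_(w in A) (f w)%:E = \int[P]_(w in A) (g w)%:E)%E ->
  forall A, F t A -> (\int[P]_(w in A) (f w)%:E = \int[P]_(w in A) (g w)%:E)%E.
Proof.
move=> t_theta fi gi fg A FA; have mA := subsigma_measurable (sF t) FA.
have [A' GA' AA'] := stopped_approx htheta t_theta FA.
have mA' := subsigma_measurable sG GA'.
rewrite (integral_ae_set mA mA' (integrable_measurable fi) AA').
by rewrite (integral_ae_set mA mA' (integrable_measurable gi) AA') fg.
Qed.

Section Concat.
Variables (t : nat) (a b : process).
Hypothesis ha : in_dual (cst_time t) a.
Hypothesis hb : in_dual theta b.
Hypothesis t_theta : ae_le_time P (cst_time t) theta.

Let aa : adm (cst_time t) a.
Proof. by apply: in_dual_adm => //; exact: stopping_cst. Qed.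
Let ab : adm theta b.
Proof. exact: in_dual_adm. Qed.

(** The points at which the formulas for the concatenation hold; almost all
    points are regular by [ae_regular]. *)
Let regular w := [/\ good (cst_time t) a w, good theta b w,
  0 <= mI a w, mI b w = 1 & exists s, [/\ theta w = Some s, (t <= s)%N & le_time (Some s) T]].

Let ae_regular : {ae P, forall w, regular w}.
Proof.
have [_ ga _] := aa; have [_ gb _] := ab.
have m0 : {ae P, forall w, 0 <= mI a w}.
  by apply: filterS2 (mass_ge0 aa) (mass_aeq aa) => w + ->.
have mb : {ae P, forall w, mI b w = 1}.
  have [_ mb1] := (dualP b htheta theta_T).2 hb.
  by apply: filterS2 (mass_aeq ab) mb1 => w -> ->.
have h1 : {ae P, forall w, [/\ good (cst_time t) a w, good theta b w & 0 <= mI a w]}.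
  by apply: filterS3 ga gb m0 => w.
have h2 : {ae P, forall w, exists s, [/\ theta w = Some s, (t <= s)%N & le_time (Some s) T]}.
  apply: filterS3 fin_theta t_theta theta_T => w.
  by case: (theta w) => // s _ ts sT; exists s.
by apply: filterS3 h1 mb h2 => w [].
Qed.

Let c := concat P F theta setT a b.

Let concatE w u : regular w ->
  c u w = if le_time (theta w) (Some u) then prev_at a theta w + mI a w * b u w
          else a u w.
Proof.
move=> [ga gb m0 mb [s [E ts sT]]]; rewrite /c /concat /=.
rewrite mb ltr01 in_setT !andbT (prev_at0 gb) subr0 divr1.
by [].
Qed.

Let increment_concatE w u : regular w -> increment c u w =
  if le_time (theta w) (Some u) then mI a w * increment b u w else increment a u w.
Proof.
move=> rw; have [ga gb m0 mb [s [E ts sT]]] := rw.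
have [_ b0 _ _] := gb.
rewrite /increment; case: u => [|u] /=; rewrite !concatE// E /=.
- rewrite !subr0; case: ifPn => // s0; rewrite /prev_at E.
  by move: s0; rewrite leqn0 => /eqP -> /=; rewrite add0r.
- have [su|us] := leqP s u.
    by rewrite (leqW su) opprD addrACA subrr add0r -mulrBr.
  have [su1|//] := leqP s u.+1.
  have Es : s = u.+1 by apply/eqP; rewrite eqn_leq su1 us.
  rewrite /prev_at E Es /= (b0 u) ?subr0; last by rewrite E /= -ltnNge.
  by rewrite addrAC subrr add0r.
Qed.

Let concat_cvg w : regular w -> c^~ w @ \oo --> prev_at a theta w + mI a w * total b w.
Proof.
move=> rw; have [ga gb m0 mb [s [E ts sT]]] := rw.
have cb : (fun n => prev_at a theta w + mI a w * b n w) @ \oo -->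
     prev_at a theta w + mI a w * total b w.
  apply: cvgD; first exact: cvg_cst.
  apply: cvgM; first exact: cvg_cst.
  by case: gb.
apply: cvg_trans cb; apply: near_eq_cvg; exists s => // n /= sn.
by rewrite concatE// E /= sn.
Qed.

Lemma concat_good : {ae P, forall w, good (cst_time t) c w}.
Proof.
apply: filterS ae_regular => w rw; have [ga gb m0 mb [s [E ts sT]]] := rw.
have [a1 a2 a3 a4] := ga; have [b1 b2 b3 b4] := gb.
split.
- by move=> u; rewrite increment_concatE//; case: ifP => // _; exact: mulr_ge0.
- move=> u /= h; rewrite concatE// E /= ifF ?a2//.
  by apply/negbTE; rewrite -ltnNge (leq_trans _ ts)// ltnNge.
- move=> u; rewrite !concatE//.
  have -> : le_time (theta w) (Some (min_time u T)) = le_time (theta w) (Some u).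
    by rewrite E; exact: leq_min_time.
  by rewrite a3 b3.
- by apply/cvg_ex; eexists; exact: concat_cvg.
Qed.

(** The paths of the concatenation: as <1, b> = 1 and b vanishes before theta,
    the formula simplifies. *)
Lemma concat_path : {ae P, forall w, exists2 s, theta w = Some s &
  [/\ (t <= s)%N, le_time (Some s) T & forall u, c u w =
   if (s <= u)%N then prev a s w + mI a w * b u w else a u w]}.
Proof.
apply: filterS ae_regular => w rw; have [_ _ _ _ [s [E ts sT]]] := rw.
by exists s => //; split => // u; rewrite concatE// /prev_at E.
Qed.

Lemma tail_concat : aeq P (tail c) (fun w => mI a w * total b w).
Proof.
apply: filterS ae_regular => w rw; rewrite /tail /total (cvg_lim _ (concat_cvg rw))//.
have [ga gb m0 mb [s [E ts sT]]] := rw.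
have -> : prev_at c theta w = prev_at a theta w.
  rewrite /prev_at E; case: s E ts sT => [|s] E ts sT //=.
  by rewrite concatE// E /= ltnn.
by rewrite addrAC subrr add0r.
Qed.

Let L0_concat u : L0 P (F u) (c u).
Proof.
have [Ra _ _] := aa; have [Rb _ _] := ab.
have mmI y : measurable_wrt Gt (mI y) by exact: condexp_measurable_wrt sG.
have mmf y : measurable_fun setT (mI y) := measurable_wrt_fun sG (mmI y).
pose f i : Omega -> R := if i is Some s then
   (if (s <= u)%N then (fun w => prev a s w + \1_[set w | theta w = Some s] w * mI a w * b u w) else cst 0)
   else a u.
apply: (@L0_aeq _ _ _ P _ _ _ _ (fun w => f (occurred theta u w) w)).
- have ma := @R0_measurable a; have mb := @R0_measurable b.
  apply: measurable_fun_ifT; last exact: ma.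
    apply: measurable_and; first exact: measurable_le_time.
    apply: measurable_and; last by apply: measurable_fun_ltr.
    by rewrite (_ : (fun w => _) = cst true)//; apply/funext => w; rewrite in_setT.
  apply: measurable_funD; first by apply: measurable_prev_at => v; exact: ma.
  apply: measurable_funM.
    by apply: measurable_funM => //; exact: (measurableT_comp (@measurable_invr R)).
  apply: measurable_funB; first exact: mb.
  by apply: measurable_prev_at => v; exact: mb.
- apply: filterS ae_regular => w rw; rewrite concatE//.
  have [ga gb m0 mb [s [E ts sT]]] := rw.
  rewrite /occurred E /=; case: ifPn => [su|_] //=.
  by rewrite su indicE mem_set// mul1r /prev_at E.
- apply: (L0_glue (sF u)) => [i|[s|]]; first exact: measurable_occurred.
  + rewrite /f; case: ifP => su; last exact: (L0_cst _ (sF u)).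
    apply: L0_add; first exact: L0_prev.
    apply: L0_mul; last exact: Rb.
    apply: L0_subsigma (sF s) (sF u) (filtration_le su) _.
    by apply: (L0_wrt _ (sF s)); exact: measurable_wrt_at.
  + exact: Ra.
Qed.

(** The concatenation preserves D_(t,T): it replaces the mass of a from theta on
    by one with the same conditional expectation given F_theta. *)
Lemma concat_in_dual : in_dual (cst_time t) c.
Proof.
split; [by move=> u; exact: L0_concat|exact: concat_good|].
move=> A; rewrite stopped_cst => FA; have mA := subsigma_measurable (sF t) FA.
have mmI : measurable_wrt Gt (mI a) by exact: condexp_measurable_wrt sG.
have [_ imI ImI] := mass_infty aa.
have m0 : {ae P, forall w, 0 <= mI a w}.
  by apply: filterS ae_regular => w [].
have [imt [_ _ Imt]] := mul_total_condexp hb mmI imI m0.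
have ip := integrable_prev_at aa; have itl := integrable_tail aa.
have [Ra _ ia] := ha; have [Rb _ _] := ab.
have Rc : R0 P F c by move=> u; exact: L0_concat.
have mtb : measurable_fun setT (total b) by apply: measurable_total => u; exact: R0_measurable.
have mta : measurable_fun setT (total a) by apply: measurable_total => u; exact: R0_measurable.
have mtc : measurable_fun setT (total c) by apply: measurable_total => u; exact: R0_measurable.
transitivity (\int[P]_(w in A) (prev_at a theta w + mI a w * total b w)%:E)%E.
  apply: integral_aeq => //.
    exact: (integrable_measurable (integrable_add ip imt)).
  by apply: filterS ae_regular => w rw _; rewrite /total (cvg_lim _ (concat_cvg rw)).
rewrite integral_addE// (@integral_tower t _ (tail a) t_theta imt itl)//; last first.
  by move=> B GB; rewrite -Imt// ImI.
rewrite -integral_addE//.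
rewrite -ia ?stopped_cst//; apply: eq_integral => w _; congr EFin.
by rewrite /tail addrC subrK.
Qed.

End Concat.

(** * Normalized futures and gluing in the dual sets *)

Lemma ind_from_R0 s : R0 P F (ind_from R (cst_time s)).
Proof.
move=> u; have -> : ind_from R (cst_time s : Omega -> option nat) u = cst ((s <= u)%N)%:R.
  exact/funext.
exact: (L0_cst P (sF u)).
Qed.

(** 1_[s, oo) belongs to D_(s,T). *)
Lemma ind_from_in_dual s : le_time (Some s) T ->
  in_dual (cst_time s) (ind_from R (cst_time s)).
Proof.
move=> sT; split; first exact: ind_from_R0.
- apply: aeW => w; split.
  + move=> u; rewrite /increment /ind_from /cst_time /=; case: u => [|u] /=.
      by rewrite subr0 ler0n.
    by rewrite subr_ge0 ler_nat; case: (leqP s u) => // su; rewrite (leqW su).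
  + by move=> u; rewrite /ind_from => /negbTE ->.
  + move=> u; rewrite /ind_from /cst_time /=; congr (_%:R); congr nat_of_bool.
    by rewrite (leq_min_time u sT).
  + apply/cvg_ex; exists 1; apply: cvg_near_cst; exists s => // n /= sn.
    by rewrite /ind_from /= sn.
- move=> A [mA _]; rewrite -integral_one//.
    apply: eq_integral => w _; congr EFin; apply/cvg_lim => //.
    by apply: cvg_near_cst; exists s => // n /= sn; rewrite /ind_from /= sn.
Qed.

(** The element of D_(s,T) which is a on {theta = s} and trivial elsewhere. *)
Definition mix s a : process :=
  fun u w => (theta w == Some s)%:R * a u w +
             (theta w != Some s)%:R * ind_from R (cst_time s) u w.

Section Future.
Variables (t s : nat) (a : process).
Hypothesis ha : in_dual (cst_time t) a.
Hypothesis sT : le_time (Some s) T.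

Let aa : adm (cst_time t) a.
Proof. by apply: in_dual_adm ha => //; exact: stopping_cst. Qed.

Let B := [set w | theta w = Some s /\ 0 < mT a w].
Let c := mix s (future P F T theta a).

Lemma mix_future_eq u w :
  c u w = if (s <= u)%N then
             if (theta w == Some s) && (0 < mT a w)
             then (a u w - prev a s w) / mT a w else 1
          else 0.
Proof.
rewrite /c /mix /future /ind_from /prev_at /cst_time.
case: eqP => [->|_] /=; last by rewrite mul0r mul1r add0r; case: (s <= u)%N.
by rewrite mul0r mul1r addr0; case: (0 < mT a w) => //; case: (s <= u)%N; rewrite ?mulr1 ?mulr0.
Qed.

(** The event on which the future is normalized belongs to F_s. *)
Lemma future_event : F s B.
Proof.
apply/(@stopped_trace theta s); first by move=> w [].
apply: (subsigmaI sG); first exact: stopped_eq.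
apply: (measurable_wrt_ltr sG); first exact: measurable_cst.
exact: condexp_measurable_wrt sG.
Qed.

Let Bmem w : ((theta w == Some s) && (0 < mT a w)) = (w \in B).
Proof.
apply/andP/idP => [[/eqP h1 h2]|/set_mem [h1 h2]]; first by apply/mem_set; split.
by split => //; apply/eqP.
Qed.

Let Y w := \1_[set w | theta w = Some s] w * (\1_B w * (mT a w)^-1).

Let GB : Gt B.
Proof. by apply/(@stopped_trace theta s); [move=> w []|exact: future_event]. Qed.

Let mY0 : measurable_wrt Gt (fun w => \1_B w * (mT a w)^-1).
Proof.
apply: measurable_funM; first exact: (measurable_wrt_indic sG GB).
apply: (measurableT_comp (@measurable_invr R)).
exact: condexp_measurable_wrt sG.
Qed.

Let mY : measurable_wrt (F s) Y.
Proof. exact: measurable_wrt_at. Qed.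

Let YE w : Y w = \1_B w * (mT a w)^-1.
Proof.
rewrite /Y !indicE; have [Bw|Bw] := pselect (B w).
  by rewrite mem_set ?mul1r//; case: Bw.
by rewrite (memNset Bw) mul0r mulr0.
Qed.

Lemma mix_future_good : {ae P, forall w, good (cst_time s) c w}.
Proof.
have [Ra ga ia] := aa; apply: filterS ga => w [a1 a2 a3 a4].
split.
- have nd := nondecreasing_increment a1.
  move=> [|u]; rewrite /increment /= ?subr0 !mix_future_eq.
  + case: (leqP s 0) => // s0; case: ifPn => // /andP[_ m0].
    apply: divr_ge0; last exact: ltW.
    move: s0; rewrite leqn0 => /eqP -> /=; rewrite subr0.
    by have := a1 0%N; rewrite /increment /= subr0.
  + have [/andP[_ m0]|_] := boolP ((theta w == Some s) && (0 < mT a w)).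
    * case: (leqP s u) => su.
        by rewrite (leqW su) -mulrBl opprB addrA subrK divr_ge0 ?subr_ge0 ?nd//; exact: ltW.
      rewrite subr0; case: ifPn => // su'.
      have -> /= : s = u.+1 by apply/eqP; rewrite eqn_leq su su'.
      by apply: divr_ge0; [rewrite subr_ge0 nd|exact: ltW].
    * case: (leqP s u) => su; first by rewrite (leqW su) subrr.
      by rewrite subr0; case: ifP.
- by move=> u /= /negbTE h; rewrite mix_future_eq h.
- move=> u; rewrite !mix_future_eq.
  rewrite (leq_min_time u sT).
  by rewrite a3.
- apply/cvg_ex; case h : ((theta w == Some s) && (0 < mT a w)).
  + exists ((total a w - prev a s w) / mT a w).
    have : (fun n => (a n w - prev a s w) / mT a w) @ \oo --> (total a w - prev a s w) / mT a w.
      by apply: cvgM; [apply: cvgB; [exact: a4|exact: cvg_cst]|exact: cvg_cst].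
    apply: cvg_trans; apply: near_eq_cvg; exists s => // n /= sn.
    by rewrite mix_future_eq sn h.
  + exists 1; apply: cvg_near_cst; exists s => // n /= sn.
    by rewrite mix_future_eq sn h.
Qed.

Let total_mix w : good (cst_time t) a w ->
  total c w = Y w * tail a w + \1_(~` B) w.
Proof.
move=> [a1 a2 a3 a4]; rewrite YE !indicE in_setC.
apply/cvg_lim => //; case h : ((theta w == Some s) && (0 < mT a w)).
- rewrite -Bmem h /= mul1r addr0 /tail /prev_at.
  have /andP[/eqP -> m0] := h; rewrite mulrC.
  have : (fun n => (a n w - prev a s w) / mT a w) @ \oo --> (total a w - prev a s w) / mT a w.
    by apply: cvgM; [apply: cvgB; [exact: a4|exact: cvg_cst]|exact: cvg_cst].
  apply: cvg_trans; apply: near_eq_cvg; exists s => // n /= sn.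
  by rewrite mix_future_eq sn h.
- rewrite -Bmem h /= !mul0r add0r; apply: cvg_near_cst; exists s => // n /= sn.
  by rewrite mix_future_eq sn h.
Qed.

Lemma mix_future_R0 : R0 P F c.
Proof.
move=> u; have [Ra _ _] := aa.
rewrite (_ : c u = (fun w => if (s <= u)%N then
     (a u w - prev a s w) * Y w + \1_(~` B) w else 0)); last first.
  apply/funext => w; rewrite mix_future_eq; case: ifP => // _.
  rewrite YE !indicE in_setC Bmem; case: (w \in B) => /=.
    by rewrite mul1r addr0.
  by rewrite mul0r mulr0 add0r.
case: leqP => su; last exact: (L0_cst P (sF u)).
apply: L0_add.
- apply: L0_mul; first by apply: L0_sub; [exact: Ra|exact: (L0_prev Ra su)].
  by apply: L0_subsigma (sF s) (sF u) (filtration_le su) _; exact: (L0_wrt P (sF s) mY).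
- apply: (L0_indic P (sF u)).
  by apply: (subsigmaC (sF u)); apply: (filtration_le su); exact: future_event.
Qed.

(** On {theta = s} the normalized future of a belongs to D_(s,T). *)
Lemma mix_future_in_dual : in_dual (cst_time s) c.
Proof.
split; [exact: mix_future_R0|exact: mix_future_good|].
move=> A; rewrite stopped_cst => FA; have mA := subsigma_measurable (sF s) FA.
have [Ra ga ia] := aa; have mB := subsigma_measurable sG GB.
have [mmT imT ImT] := mass_T aa.
pose Z w := \1_A w * Y w.
have mZ : measurable_wrt Gt Z.
  have -> : Z = (fun w => \1_(A `&` [set w | theta w = Some s]) w * (\1_B w * (mT a w)^-1)).
    by apply/funext => w; rewrite /Z /Y indicI mulrA.
  apply: measurable_funM => //; apply: (measurable_wrt_indic sG).
  apply/(@stopped_trace theta s); first exact: subIsetr.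
  by apply: (subsigmaI (sF s)) => //; exact: stopping_eq.
have Z0 w : 0 <= Z w.
  rewrite /Z YE !indicE mulr_ge0//; have [[_ m0]|nB] := pselect (B w).
    by rewrite mulr_ge0// invr_ge0 ltW.
  by rewrite (memNset nB) mul0r.
have tail0 : {ae P, forall w, 0 <= tail a w}.
  by apply: filterS ga => w; exact: tail_ge0.
have mt := measurable_tail Ra.
have mnt : measurable_fun setT (fun w => `|tail a w|) by exact: measurableT_comp.
have mYf := measurable_wrt_fun (sF s) mY.
have m1B : measurable_fun setT (\1_(~` B) : Omega -> R).
  by apply: measurable_indic; exact: measurableC.
have mtc : measurable_fun setT (total c).
  by apply: measurable_total => u; exact: (R0_measurable _ mix_future_R0).
transitivity (\int[P]_(w in A) (Y w * `|tail a w| + \1_(~` B) w)%:E)%E.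
  apply: integral_aeq => //.
    by apply: measurable_funD => //; exact: measurable_funM.
  by apply: filterS ga => w gaw _; rewrite total_mix// ger0_norm ?(tail_ge0 gaw).
have Y0 w : 0 <= Y w.
  rewrite YE !indicE; have [[_ m0]|nB] := pselect (B w).
    by rewrite mulr_ge0// invr_ge0 ltW.
  by rewrite (memNset nB) mul0r.
have mYt : measurable_fun setT (fun w => Y w * `|tail a w|) by exact: measurable_funM.
under eq_integral do rewrite EFinD.
rewrite ge0_integralD//; last 3 first.
- by move=> w _; rewrite lee_fin mulr_ge0.
- by apply/measurable_EFinP; exact: measurable_funTS.
- by apply/measurable_EFinP; exact: measurable_funTS.
have -> : (\int[P]_(w in A) (Y w * `|tail a w|)%:E = P (A `&` B))%E.
  transitivity (\int[P]_w (Z w * `|tail a w|)%:E)%E.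
    rewrite integral_mkcond; apply: eq_integral => w _; rewrite /patch /Z indicE.
    by case: (w \in A); rewrite ?mul1r// !mul0r.
  transitivity (\int[P]_w (Z w * tail a w)%:E)%E.
    have mZf := measurable_wrt_fun sG mZ.
    apply: integral_aeq => //; [exact: measurable_funM..|].
    by apply: filterS tail0 => w h _; rewrite ger0_norm.
  transitivity (\int[P]_w (Z w * mT a w)%:E)%E.
    apply: (ae_ge0_integral_pull sG mZ Z0 mt tail0) => //.
    + exact: (measurable_wrt_fun sG mmT).
    + exact: (mass_ge0 aa).
    + by move=> C GC; rewrite ImT.
    + exact: subsigmaT sG.
  rewrite (eq_integral (fun w => (\1_(A `&` B) w : R)%:E)).
    by rewrite integral_indic ?setIT//; exact: measurableI.
  move=> w _; congr EFin; rewrite /Z YE indicI -mulrA; congr (_ * _).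
  rewrite indicE; have [Bw|nB] := pselect (B w).
    by rewrite mem_set// mul1r mulVf//; case: Bw => _ /lt0r_neq0.
  by rewrite memNset// !mul0r.
rewrite integral_indic//; last exact: measurableC.
by rewrite [~` B `&` A]setIC -setDE addeC -measureDI.
Qed.

End Future.

Section GlueDual.
Variables (b : nat -> nat -> process) (K : Omega -> nat).
Hypothesis Rb : forall s k, R0 P F (b s k).
Hypothesis Db : forall s k, le_time (Some s) T ->
  in_dual (cst_time s) (b s k).
Hypothesis hK : forall s k, F s ([set w | theta w = Some s] `&` [set w | K w = k]).

(** The process which is b s k on the event {theta = s, K = k}. *)
Definition glue : process :=
  fun u w => if occurred theta u w is Some s then b s (K w) u w else 0.

Lemma glueE w s u : theta w = Some s ->
  glue u w = if (s <= u)%N then b s (K w) u w else 0.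
Proof. by move=> E; rewrite /glue /occurred E /=; case: leqP. Qed.

Lemma glue_R0 : R0 P F glue.
Proof.
move=> u.
pose J w := if occurred theta u w is Some s then Some (s, K w) else None.
pose f (i : option (nat * nat)) : Omega -> R := if i is Some (s, k) then b s k u else cst 0.
have -> : glue u = (fun w => f (J w) w).
  by apply/funext => w; rewrite /glue /J; case: (occurred theta u w).
apply: (@L0_glue _ _ _ P _ (sF u) _ _ _ J f) => [[[s k]|]|[[s k]|]].
- have [su|us] := leqP s u.
  + have -> : J @^-1` [set Some (s, k)] = [set w | theta w = Some s] `&` [set w | K w = k].
      apply/seteqP; split => w /=; rewrite /J /occurred.
      * by case: ifP => // _; case E : (theta w) => [v|//] [-> ->].
      * by move=> [-> ->]; rewrite /= su.
    exact: (filtration_le su).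
  + have -> : J @^-1` [set Some (s, k)] = set0.
      apply/seteqP; split => w //=; rewrite /J /occurred.
      case: ifP => // + ; case E : (theta w) => [v|//] /= vu [vs _].
      by move: vu; rewrite vs leqNgt us.
    exact: (subsigma0 (sF u)).
- have -> : J @^-1` [set None] = occurred theta u @^-1` [set None].
    by apply/seteqP; split => w /=; rewrite /J; case: (occurred theta u w).
  exact: measurable_occurred.
- exact: Rb.
- exact: (L0_cst P (sF u)).
Qed.

Let glue_cvg w s : theta w = Some s -> good (cst_time s) (b s (K w)) w ->
  glue^~ w @ \oo --> total (b s (K w)) w.
Proof.
move=> E [_ _ _ c4]; apply: cvg_trans (c4); apply: near_eq_cvg.
by exists s => // n /= sn; rewrite (glueE _ E) sn.
Qed.

Let ae_good : {ae P, forall w, forall s k, le_time (Some s) T -> good (cst_time s) (b s k) w}.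
Proof.
suff : {ae P, forall w, forall s, le_time (Some s) T -> forall k, good (cst_time s) (b s k) w}.
  by apply: filterS => w h s k /h; exact.
by apply: ae_forall_time => s sT; apply: ae_foralln => k; have [] := Db k sT.
Qed.

(** Countably many elements of the sets D_(s,T) can be glued to one of
    D_(theta,T). *)
Lemma glue_in_dual : in_dual theta glue.
Proof.
split; first exact: glue_R0.
- apply: filterS3 ae_good fin_theta theta_T => w hg.
  case E : (theta w) => [s|//] _ sT.
  have gb := hg s (K w) sT; have [b1 b2 b3 b4] := gb.
  split.
  + move=> u; rewrite /increment; case: u => [|u] /=.
      rewrite subr0 (glueE _ E); case: ifP => // _.
      by have := b1 0%N; rewrite /increment /= subr0.
    rewrite !(glueE _ E); case: (leqP s u) => su.
      by rewrite (leqW su); exact: b1 u.+1.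
    rewrite subr0; case: leqP => // su1.
    have := b1 u.+1; rewrite /increment /= (b2 u) ?subr0//= -ltnNge.
    by [].
  + by move=> u; rewrite E /= (glueE _ E) => /negbTE ->.
  + move=> u; rewrite !(glueE _ E).
    rewrite (leq_min_time u sT).
    by rewrite -b3.
  + by apply/cvg_ex; eexists; exact: glue_cvg E gb.
- move=> A GA; have mA := subsigma_measurable sG GA.
  have mtg : measurable_fun setT (total glue).
    by apply: measurable_total => u; exact: (R0_measurable _ glue_R0).
  have mng : measurable_fun setT (fun w => `|total glue w|) by exact: measurableT_comp.
  pose E s k := A `&` ([set w | theta w = Some s] `&` [set w | K w = k]).
  pose D n := if @pickle_inv (nat * nat)%type n is Some (s, k) then E s k else set0.
  have FE s k : F s (E s k).
    rewrite /E setIA; have -> : A `&` [set w | theta w = Some s] `&` [set w | K w = k] =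
      (A `&` [set w | theta w = Some s]) `&` ([set w | theta w = Some s] `&` [set w | K w = k]).
      by rewrite setIA -(setIA A [set w | theta w = Some s] [set w | theta w = Some s]) setIid.
    apply: (subsigmaI (sF s)) => //; apply/(@stopped_trace theta s).
      exact: subIsetr.
    by apply: (subsigmaI sG) => //; exact: stopped_eq.
  have mE s k : measurable (E s k) by exact: (subsigma_measurable (sF s) (FE s k)).
  have mD n : measurable (D n) by rewrite /D; case: (pickle_inv n) => [[s k]|].
  have tD : trivIset setT D.
    apply/trivIsetP => i j _ _ ij; apply/seteqP; split => // w [].
    rewrite /D; case Ei : (pickle_inv i) => [[s k]|//].
    case Ej : (pickle_inv j) => [[s' k']|//] [_ [/= h1 h2]] [_ [/= h3 h4]].
    have := @pickle_invK (nat * nat)%type i; have := @pickle_invK (nat * nat)%type j; rewrite Ei Ej /= => Hj Hi.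
    have Es : s = s' by move: h1; rewrite h3 => -[].
    by move/eqP: ij; apply; rewrite -Hi -Hj Es -h2 -h4.
  have AD : {ae P, forall w, A w <-> (\bigcup_n D n) w}.
    apply: filterS fin_theta => w; case Ew : (theta w) => [s|//] _; split.
    - by move=> Aw; exists (pickle (s, K w)) => //; rewrite /D pickleK_inv; split.
    - by move=> [n _]; rewrite /D; case: (pickle_inv n) => [[s' k]|//] [].
  have mUD : measurable (\bigcup_n D n) by exact: bigcupT_measurable.
  have abs_total B : measurable B ->
      (\int[P]_(w in B) (total glue w)%:E = \int[P]_(w in B) (`|total glue w|)%:E)%E.
    move=> mB; apply: integral_aeq => //.
    apply: filterS3 ae_good fin_theta theta_T => w hg.
    case Ew : (theta w) => [s|//] _ sT _.
    have gb := hg s (K w) sT.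
    by rewrite /total (cvg_lim _ (glue_cvg Ew gb))// ger0_norm// (total_ge0 gb).
  rewrite abs_total// (integral_ae_set mA mUD mng AD) -integral_one//.
  rewrite (integral_ae_set mA mUD (measurable_cst _) AD) integral_one//.
  rewrite ge0_integral_bigcup//; last first.
    by apply/measurable_EFinP; exact: measurable_funTS.
  rewrite measure_bigcup//.
  rewrite (@eq_eseriesl _ (fun n => n \in [set: nat]) xpredT); last first.
    by move=> n; rewrite in_setT.
  apply: eq_eseriesr => n _.
  rewrite -abs_total// /D; case En : (pickle_inv n) => [[s k]|].
  - have [sT|sT] := boolP (le_time (Some s) T).
    + have [Rbs _ ib] := Db k sT.
      transitivity (\int[P]_(w in E s k) (total (b s k) w)%:E)%E; last first.
        by apply: ib; rewrite stopped_cst.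
      apply: integral_aeq => //.
        by apply: measurable_total => u; exact: (R0_measurable _ Rbs).
      apply: filterS ae_good => w hg [_ [/= Ew Kw]].
      by rewrite /total (cvg_lim _ (glue_cvg Ew (hg _ _ sT)))// Kw.
    + transitivity (\int[P]_(w in E s k) (1 : R)%:E)%E; last exact: integral_one.
      apply: integral_aeq => //.
      by apply: filterS theta_T => w + [_ [/= Ew _]]; rewrite Ew (negbTE sT).
  - by rewrite integral_set0 measure0.
Qed.

End GlueDual.

(** * Locality of the pairing and of the penalty functions *)

Lemma integrable_ser tau a (C : R) (y : process) : adm tau a ->
  (forall u, measurable_fun setT (y u)) ->
  {ae P, forall w, forall u, `|y u w| <= C} -> intg (ser y a).
Proof.
move=> [Ra ga ia] my yC; apply: integrable_dominated (integrable_scale C ia) _.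
  by apply: measurable_ser => // u; exact: (R0_measurable _ Ra).
by apply: filterS2 ga yC => w gw yw; exact: (ser_bound gw yw).
Qed.

(** On bounded processes the pairing is the conditional expectation of the
    pathwise integral. *)
Lemma pairing_condexp s a C X : adm (cst_time s) a ->
  bounded_on s C X ->
  is_condexp P (F s) (ser X a) (pairing P F (cst_time s) Tm X a).
Proof.
move=> aa [RX hX]; have [Ra ga ia] := aa.
have mX u : measurable_fun setT (X u) by exact: (R0_measurable _ RX).
have XC : {ae P, forall w, forall u, `|X u w| <= C}.
  by apply: filterS hX => w h u; have [] := h u.
have ms : measurable_fun setT (ser X a).
  by apply: measurable_ser => // u; exact: (R0_measurable _ Ra).
rewrite /pairing raw_pairingE stopped_cst.
have mr := measurable_pairing_raw (stopping_cst s) (stopping_cst_option T) mX Ra.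
have E : aeq P (ser (window (cst_time s) Tm X) a) (ser X a).
  by apply: filterS ga => w; exact: ser_window.
apply: (is_condexp_aeq (sF s) mr ms E); apply: condexpP; first exact: sF.
apply: integrable_aeq mr _ (integrable_ser aa mX XC).
by apply: filterS E => w ->.
Qed.

(** The pairing is local in the dual variable. *)
Lemma pairing_local s a b A C X : adm (cst_time s) a ->
  adm (cst_time s) b -> bounded_on s C X -> F s A ->
  {ae P, forall w, A w -> forall u, a u w = b u w} ->
  {ae P, forall w, A w -> pairing P F (cst_time s) Tm X a w =
                          pairing P F (cst_time s) Tm X b w}.
Proof.
move=> aa ab bX FA Eab; have [RX hX] := bX.
have mX u : measurable_fun setT (X u) by exact: (R0_measurable _ RX).
have XC : {ae P, forall w, forall u, `|X u w| <= C}.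
  by apply: filterS hX => w h u; have [] := h u.
have ia := integrable_ser aa mX XC; have ib := integrable_ser ab mX XC.
have h : {ae P, forall w, A w -> condexp P (F s) (ser X a) w = condexp P (F s) (ser X b) w}.
  apply: (condexp_aeq_local (sF s) (sF s) FA FA _ ia ib) => //.
  apply: filterS Eab => w h Aw; apply: eq_ser => u; congr (_ * _).
  by rewrite /increment /prev; case: u => [|u]; rewrite !h.
have ha := condexp_unique (sF s) ia (pairing_condexp aa bX).
have hb := condexp_unique (sF s) ib (pairing_condexp ab bX).
by apply: filterS3 h ha hb => w h1 <- <-.
Qed.

Lemma dual_cstP s a : le_time (Some s) T ->
  dual P F (cst_time s) Tm a <-> in_dual (cst_time s) a.
Proof. by move=> sT; apply: (dualP) => //; [exact: stopping_cst|exact: aeW]. Qed.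

Lemma in_dual_aeqp tau a b : (forall u, measurable_fun setT (a u)) -> aeqp P a b ->
  in_dual tau b -> in_dual tau a.
Proof.
move=> ma ab [Rb gb ib].
have Ra : R0 P F a.
  by move=> u; apply: (L0_aeq (ma u) _ (Rb u)); apply: filterS ab => w ->.
split => //; first exact: good_aeq gb ab.
move=> A GA; rewrite -ib//; have [mA _] := GA.
apply: integral_aeq => //.
- exact: measurable_total.
- by apply: measurable_total => u; exact: (R0_measurable _ Rb).
- by apply: filterS ab => w h _; rewrite /total (_ : a^~ w = b^~ w)//; exact/funext.
Qed.

Variable gamma : nat -> process -> Omega -> \bar R.
Local Notation ext a := (penalty_ext P F T gamma theta a).
Hypothesis hgamma : forall s : nat, le_time (Some s) T ->
  special_penalty P F (cst_time s) Tm (gamma s).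

Section OneTime.
Variable s : nat.
Hypothesis sT : le_time (Some s) T.

Lemma gamma_L0 a : in_dual (cst_time s) a -> L0 P (F s) (gamma s a).
Proof.
move=> /(dual_cstP _ sT) ha; have [[h _ _] _] := hgamma sT.
by have [] := h _ ha; rewrite stopped_cst.
Qed.

Lemma gamma_measurable a : in_dual (cst_time s) a -> measurable_fun setT (gamma s a).
Proof. by move=> /gamma_L0 []. Qed.

Lemma gamma_le0 a : in_dual (cst_time s) a -> {ae P, forall w, (gamma s a w <= 0)%E}.
Proof.
by move=> /(dual_cstP _ sT) ha; have [[h _ _] _] := hgamma sT; have [] := h _ ha.
Qed.

Lemma gamma_aeqp a b : in_dual (cst_time s) a -> in_dual (cst_time s) b ->
  aeqp P a b -> aeq P (gamma s a) (gamma s b).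
Proof.
move=> /(dual_cstP _ sT) ha /(dual_cstP _ sT) hb.
by have [[_ h _] _] := hgamma sT; exact: h.
Qed.

(** Special penalty functions are local. *)
Lemma gamma_local a b A : in_dual (cst_time s) a ->
  in_dual (cst_time s) b -> F s A ->
  {ae P, forall w, A w -> forall u, a u w = b u w} ->
  {ae P, forall w, A w -> gamma s a w = gamma s b w}.
Proof.
move=> ha hb FA ab; have [_ h] := hgamma sT.
pose c : process := fun t w => \1_A w * a t w + \1_(~` A) w * b t w.
have mA := subsigma_measurable (sF s) FA.
have [Ra _ _] := ha; have [Rb _ _] := hb.
have cb : aeqp P c b.
  apply: filterS ab => w h' u; rewrite /c !indicE in_setC.
  have [Aw|nA] := pselect (A w).
    by rewrite mem_set//= mul0r mul1r addr0 h'.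
  by rewrite memNset//= mul0r mul1r add0r.
have hc : in_dual (cst_time s) c.
  apply: in_dual_aeqp cb hb => u; apply: measurable_funD; apply: measurable_funM.
  - exact: measurable_indic.
  - exact: (R0_measurable _ Ra).
  - by apply: measurable_indic; exact: measurableC.
  - exact: (R0_measurable _ Rb).
have hsp := h a b A ((dual_cstP _ sT).2 ha) ((dual_cstP _ sT).2 hb).
rewrite stopped_cst in hsp.
apply: filterS2 (gamma_aeqp hc hb cb) (hsp FA) => w h1 h2 Aw.
have : gamma s c w = gamma s a w.
  by rewrite [LHS]h2 !indicE in_setC mem_set//= mul1e mul0e adde0.
by move=> <-.
Qed.

End OneTime.

Lemma penalty_atE a w : penalty_at T gamma theta a w =
  if theta w is Some s then
    if le_time (Some s) T then gamma s (mix s a) w else 0%E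
  else 0%E.
Proof.
rewrite /penalty_at.
case E : (theta w) => [s|]; last first.
  apply/cvg_lim => //; apply: cvg_near_cst; exists 0%N => // n _ /=.
  by rewrite big1// => i _; rewrite mul0e.
apply/cvg_lim => //; apply: cvg_near_cst; exists s.+1 => // n sn.
have {}sn : (s < n)%N := sn.
rewrite big_mkcond (bigD1_seq s) ?mem_index_iota ?iota_uniq// big1.
  rewrite eqxx mul1e; case: ifP => _; exact: adde0.
move=> i is_; case: ifP => // _.
have -> : (Some s == Some i) = false.
  by apply/eqP => -[si]; rewrite si eqxx in is_.
by rewrite mul0e.
Qed.

Section Ext.
Variables (t : nat) (a : process).
Hypothesis ha : in_dual (cst_time t) a.

Let fut s := mix s (future P F T theta a).

(** The extended penalty on {theta = s}, where a has remaining mass. *)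
Lemma penalty_extE w s : theta w = Some s -> le_time (Some s) T -> 0 < mT a w ->
  ext a w = ((mT a w)%:E * gamma s (fut s) w)%E.
Proof. by move=> E sT m0; rewrite /penalty_ext m0 penalty_atE E sT. Qed.

Lemma penalty_ext0 w : ~~ (0 < mT a w) -> ext a w = 0%E.
Proof. by rewrite /penalty_ext => /negbTE ->. Qed.

Lemma penalty_ext_measurable : measurable_fun setT (ext a).
Proof.
have mm : measurable_fun setT (mT a) by exact: (measurable_condexp _ _ sG).
pose g (i : option nat) : Omega -> \bar R := if i is Some s then
  if le_time (Some s) T then gamma s (fut s) else cst 0%E else cst 0%E.
have -> : ext a =
    (fun w => if 0 < mT a w then ((mT a w)%:E * g (theta w) w)%E else 0%E).
  apply/funext => w; rewrite /penalty_ext; case: ifP => // _.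
  by rewrite penalty_atE /g; case: (theta w) => // s; case: ifP.
apply: measurable_fun_ifT; [exact: measurable_fun_ltr| |exact: measurable_cst].
apply: emeasurable_funM; first exact/measurable_EFinP.
apply: (@measurable_glue _ _ _ _ _ theta g) => [i|[s|]].
- exact: measurable_theta_eq.
- rewrite /g; case: ifP => sT; last exact: measurable_cst.
  exact: (gamma_measurable sT (mix_future_in_dual ha sT)).
- exact: measurable_cst.
Qed.

Lemma penalty_ext_le0 : {ae P, forall w, (ext a w <= 0)%E}.
Proof.
have h : {ae P, forall w, forall s, le_time (Some s) T -> (gamma s (fut s) w <= 0)%E}.
  apply: ae_forall_time => s sT.
  exact: (gamma_le0 sT (mix_future_in_dual ha sT)).
apply: filterS h => w h.
have [m0|/penalty_ext0 ->//] := boolP (0 < mT a w).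
rewrite /penalty_ext m0 penalty_atE; case: (theta w) => [s|]; last by rewrite mule0.
case: ifP => sT; last by rewrite mule0.
by apply: mule_ge0_le0; [rewrite lee_fin ltW|exact: h].
Qed.

End Ext.

(** * The dual representation *)

Hypothesis hrep : forall t : nat, le_time (Some t) T ->
  forall X : process, Rinf_on P F (cst_time t) Tm X ->
  aeq P (fun w => (phi t X w)%:E)
    (essinf P [set (fun w => ((bra t X a w)%:E - gamma t a w)%E)
       | a in dual P F (cst_time t) Tm]).

Section Representation.
Variables (s : nat) (C : R) (X : process).
Hypothesis sT : le_time (Some s) T.
Hypothesis bX : bounded_on s C X.

Let S := [set (fun w => ((bra s X a w)%:E - gamma s a w)%E)
       | a in dual P F (cst_time s) Tm].

Let S0 : S !=set0.
Proof.
have hi := (dual_cstP (ind_from R (cst_time s)) sT).2 (ind_from_in_dual sT).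
by eexists; exists (ind_from R (cst_time s)); [exact: hi|reflexivity].
Qed.

Let measurable_term a : in_dual (cst_time s) a ->
  L0 P (F s) (fun w => ((bra s X a w)%:E - gamma s a w)%E).
Proof.
move=> ha; have [mg [g' mg' gg']] := gamma_L0 sT ha.
have mb : measurable_wrt (F s) (bra s X a).
  by have [] := pairing_condexp (in_dual_adm (stopping_cst s) ha) bX.
have mbf := measurable_wrt_fun (sF s) mb.
split.
  by apply: emeasurable_funB => //; exact/measurable_EFinP.
exists (fun w => ((bra s X a w)%:E - g' w)%E); last by apply: filterS gg' => w ->.
by apply: emeasurable_funB => //; exact/measurable_EFinP.
Qed.

Let mS f : S f -> measurable_fun setT f.
Proof. by move=> [a /(dual_cstP a sT) ha <-]; have [] := measurable_term ha. Qed.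

(** phi_s(X) is a lower bound of the penalized pairings, and the greatest one by
    the next lemma. *)
Lemma phi_lower a : in_dual (cst_time s) a ->
  {ae P, forall w, ((phi s X w)%:E <= (bra s X a w)%:E - gamma s a w)%E}.
Proof.
move=> ha; have [_ h _] := essinfP P S0 mS.
have ha' := (dual_cstP a sT).2 ha.
have h1 := h _ (ex_intro2 _ _ a ha' erefl).
have h2 := hrep sT ((Rinf_onP X sT).2 (ex_intro _ C bX)).
by apply: filterS2 h1 h2 => w + ->.
Qed.

Lemma phi_greatest (h : Omega -> R) : measurable_fun setT h ->
  (forall a, in_dual (cst_time s) a ->
    {ae P, forall w, ((h w)%:E <= (bra s X a w)%:E - gamma s a w)%E}) ->
  {ae P, forall w, h w <= phi s X w}.
Proof.
move=> mh hle; have [_ _ g] := essinfP P S0 mS.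
have : {ae P, forall w, ((h w)%:E <= essinf P S w)%E}.
  apply: g; first exact/measurable_EFinP.
  by move=> _ [a /(dual_cstP a sT) ha <-]; exact: hle.
have h2 := hrep sT ((Rinf_onP X sT).2 (ex_intro _ C bX)).
apply: filterS2 h2 => w E.
by rewrite -E lee_fin.
Qed.

(** A measurable selection, among countably many elements of the dual set, of
    one that is optimal up to e. *)
Lemma phi_almost_optimal (e : R) : 0 < e ->
  exists (b : nat -> process) (K : Omega -> nat),
  [/\ forall k, in_dual (cst_time s) (b k),
      forall k, F s [set w | K w = k] &
      {ae P, forall w, ((bra s X (b (K w)) w)%:E - gamma s (b (K w)) w
                          <= (phi s X w + e)%:E)%E}].
Proof.
move=> e0; have [f_ [Sf fE]] := essinf_sequence P S0 mS.
have /choice[b hb] : forall k, exists a, in_dual (cst_time s) a /\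
    (fun w => ((bra s X a w)%:E - gamma s a w)%E) = f_ k.
  by move=> k; have [a /(dual_cstP a sT) ha <-] := Sf k; exists a.
have /choice[g hg] : forall k, exists g : Omega -> \bar R, measurable_wrt (F s) g /\ aeq P (f_ k) g.
  by move=> k; have [ha <-] := hb k; have [_ [g mg h]] := measurable_term ha; exists g.
have [[_ [p mp hp]] _] := phi_Linf sT bX.
pose A k := [set w | (g k w <= (p w + e)%:E)%E].
have FA k : F s (A k).
  have mpe : measurable_wrt (F s) (fun w => (p w + e)%:E).
    by apply/measurable_EFinP; apply: measurable_funD => //; exact: measurable_cst.
  have : measurable ([set: g_sigma_algebraType (F s)] `&` A k).
    by apply: measurable_lee => //; exact: (hg k).1.
  by rewrite setTI /measurable /= (subsigma_generated (sF s)).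
have [J FJ AJ] := measurable_selection (sF s) FA.
exists b, J; split => //; first by move=> k; exact: (hb k).1.
have hfg : {ae P, forall w, forall k, f_ k w = g k w}.
  by apply: ae_foralln => k; exact: (hg k).2.
have hrepX := hrep sT ((Rinf_onP X sT).2 (ex_intro _ C bX)).
have hE : {ae P, forall w, (phi s X w)%:E = ereal_inf (range (f_^~ w))}.
  by apply: filterS2 hrepX fE => w -> ->.
apply: filterS3 hfg hE hp => w h1 h2 h3.
have lt : (ereal_inf (range (f_^~ w)) < (phi s X w + e)%:E)%E.
  by rewrite -h2 lte_fin ltrDl.
have [_ [k _ <-] hk] := ereal_inf_lt lt.
have /AJ : A k w by rewrite /A /= -h1 -h3 ltW.
by rewrite /A /= -h1 -(hb (J w)).2 -h3.
Qed.

End Representation.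

(** * Splitting the pairing at the stopping time *)

Variables (t : nat) (X : process) (C : R).
Hypothesis tT : le_time (Some t) T.
Hypothesis t_theta : ae_le_time P (cst_time t) theta.
Hypothesis bX : bounded_on t C X.

Let Phi := utility_at T phi theta (proj theta Tm X).
Let Z := stopped_utility t theta X.
(** An F_theta-measurable version of Phi, which itself is only almost surely
    equal to such a variable. *)
Variable Psi : Omega -> R.
Hypothesis mPsi : measurable_wrt Gt Psi.
Hypothesis PhiPsi : aeq P Phi Psi.

Let bZ : bounded_on t C Z.
Proof. exact: (stopped_utility_bounded htheta fin_theta t_theta theta_T bX). Qed.

Let PsiC : {ae P, forall w, `|Psi w| <= C}.
Proof.
have h := utility_at_bound htheta fin_theta theta_T bX.
by apply: filterS2 h PhiPsi => w + <-.
Qed.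

(** The integral of X against a over [theta, oo), and its expectation given
    F_theta. *)
Definition later a : Omega -> R := ser (after X) a.
Definition later_cond a : Omega -> R := condexp P Gt (later a).

Let paths : {ae P, forall w, exists2 s, theta w = Some s &
  [/\ (t <= s)%N, le_time (Some s) T, forall u, `|X u w| <= C, `|Phi w| <= C &
   forall u, Z u w = if (s <= u)%N then Phi w else X u w]}.
Proof.
have h1 := stopped_utilityE fin_theta t_theta theta_T bX.
have h2 := utility_at_bound htheta fin_theta theta_T bX.
apply: filterS3 h1 h2 bX.2 => w [s E [ts sT h]] PC hX.
by exists s => //; split => // u; have [] := hX u.
Qed.

Let measurable_after (y : process) u : (forall u, measurable_fun setT (y u)) ->
  measurable_fun setT (after y u).
Proof.
move=> my; apply: measurable_fun_ifT => //.
exact: measurable_le_time.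
Qed.

Let mX u : measurable_fun setT (X u).
Proof. by case: bX => RX _; exact: (R0_measurable _ RX). Qed.

Lemma integrable_later a : adm (cst_time t) a -> intg (later a).
Proof.
move=> aa; apply: (integrable_ser aa (C := C)).
  by move=> u; exact: measurable_after.
apply: filterS paths => w [s E [ts sT hX PC _]] u; rewrite /after.
by case: ifP => // _; rewrite normr0 (le_trans (normr_ge0 _) PC).
Qed.

Let integrable_Psi_mul f : intg f -> intg (fun w => Psi w * f w).
Proof.
move=> fi; apply: integrable_mul_bounded fi PsiC.
exact: (measurable_wrt_fun sG mPsi).
Qed.

(** Psi is F_theta-measurable and can be taken out. *)
Lemma Psi_tail_condexp a : adm (cst_time t) a ->
  is_condexp P Gt (fun w => Psi w * tail a w) (fun w => Psi w * mT a w).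
Proof.
move=> aa; have it := integrable_tail aa.
have cm := condexp_unique sG it (mass_T aa).
have mm : measurable_wrt Gt (mT a) by exact: (condexp_measurable_wrt _ _ sG).
apply: (is_condexp_version sG _ _ (condexp_pull sG mPsi it (integrable_Psi_mul it))).
- exact: measurable_funM.
- by apply: filterS cm => w ->.
Qed.

Let ser_split a w s : good (cst_time t) a w -> theta w = Some s ->
  (forall u, `|X u w| <= C) -> `|Phi w| <= C ->
  (forall u, Z u w = if (s <= u)%N then Phi w else X u w) ->
  ser X a w - ser Z a w = later a w - Phi w * tail a w.
Proof.
move=> ga E hX PC hZ.
have C0 : 0 <= C by exact: le_trans (normr_ge0 _) PC.
have hZC u : `|Z u w| <= C by rewrite hZ; case: ifP.
pose one : process := fun _ _ => 1.
have h1 u : `|after one u w| <= 1.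
  by rewrite /after; case: ifP => _; rewrite ?normr1 ?normr0.
have h1P u : `|(- Phi w) * after one u w| <= C.
  by rewrite normrM normrN -[leRHS]mulr1 ler_pM.
have hXa u : `|after X u w| <= C by rewrite /after; case: ifP; rewrite ?normr0.
have hs u : `|after X u w + - Phi w * after one u w| <= C + C.
  by apply: le_trans (ler_normD _ _) _; apply: lerD.
have -> : ser X a w = ser (fun u w' => Z u w' + (after X u w' + (- Phi w) * after one u w')) a w.
  apply: eq_ser => u; congr (_ * _); rewrite hZ /after /one E /=.
  by case: ifP => _; [rewrite mulr1 addrCA subrr addr0|rewrite mulr0 !addr0].
rewrite (ser_add ga hZC hs) addrAC subrr add0r (ser_add ga hXa h1P).
rewrite (ser_scale _ ga h1) mulNr; congr (_ - _ * _).
by apply: (ser_after1 _ E); case: ga.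
Qed.

Lemma ser_sub_stopped_utility a : adm (cst_time t) a ->
  aeq P (fun w => ser X a w - ser Z a w) (fun w => later a w - Psi w * tail a w).
Proof.
move=> [Ra ga _]; apply: filterS3 ga paths PhiPsi => w gw [s E [ts sT hX PC hZ]] <-.
exact: ser_split gw E hX PC hZ.
Qed.

Let integrable_ser_bounded a Y : adm (cst_time t) a ->
  bounded_on t C Y -> intg (ser Y a).
Proof.
move=> aa [RY hY]; apply: (integrable_ser aa (C := C)).
  by move=> u; exact: (R0_measurable _ RY).
by apply: filterS hY => w h u; have [] := h u.
Qed.

(** The difference of the pairings of X and of Z with a is determined by what
    happens from theta on. *)
Lemma pairing_sub_stopped_utility a : adm (cst_time t) a ->
  is_condexp P (F t) (fun w => later_cond a w - Psi w * mT a w)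
    (fun w => bra t X a w - bra t Z a w).
Proof.
move=> aa; have iX := integrable_ser_bounded aa bX; have iZ := integrable_ser_bounded aa bZ.
have [m1 i1 I1] := is_condexp_sub (sF t) iX iZ (pairing_condexp aa bX) (pairing_condexp aa bZ).
have il := integrable_later aa.
have iPt := integrable_Psi_mul (integrable_tail aa).
have [m2 i2 I2] := is_condexp_sub sG il iPt (condexpP sG il) (Psi_tail_condexp aa).
split; [exact: m1|exact: i1|move=> A FA].
have mA := subsigma_measurable (sF t) FA; rewrite (I1 _ FA).
rewrite (integral_tower t_theta i2 (integrable_sub il iPt) I2 FA).
apply: integral_aeq => //.
- exact: (integrable_measurable (integrable_sub iX iZ)).
- exact: (integrable_measurable (integrable_sub il iPt)).
- by apply: filterS (ser_sub_stopped_utility aa) => w.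
Qed.

Section Concatenation.
Variables (a b : process).
Hypothesis ha : in_dual (cst_time t) a.
Hypothesis hb : in_dual theta b.
Let c := concat P F theta setT a b.

Let hc : in_dual (cst_time t) c.
Proof. exact: (concat_in_dual ha hb t_theta). Qed.
Let aa : adm (cst_time t) a.
Proof. exact: (in_dual_adm (stopping_cst t) ha). Qed.
Let ac : adm (cst_time t) c.
Proof. exact: (in_dual_adm (stopping_cst t) hc). Qed.

(** Concatenating does not change the mass from theta on. *)
Lemma mass_concat : aeq P (mT c) (mT a).
Proof.
have E := tail_concat ha hb t_theta.
have mm : measurable_wrt Gt (mI a) by exact: (condexp_measurable_wrt _ _ sG).
have [_ im _] := mass_infty aa.
have m0 : {ae P, forall w, 0 <= mI a w}.
  by apply: filterS2 (mass_ge0 aa) (mass_aeq aa) => w + ->.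
have [imt cmt] := mul_total_condexp hb mm im m0.
have [Rc _ _] := ac.
have E' : aeq P (fun w => mI a w * total b w) (tail c) by apply: filterS E => w ->.
have h := is_condexp_aeq sG (integrable_measurable imt) (measurable_tail Rc) E' cmt.
have u := is_condexp_unique sG (mass_T ac) h.
by apply: filterS2 u (mass_aeq aa) => w -> ->.
Qed.

(** Z is constant after theta, so that only the mass of a after theta
    matters. *)
Lemma pairing_stopped_utility_concat : aeq P (bra t Z c) (bra t Z a).
Proof.
have iZa := integrable_ser_bounded aa bZ; have iZc := integrable_ser_bounded ac bZ.
have [m1 i1 I1] := pairing_condexp ac bZ.
apply: (is_condexp_unique (sF t) _ (pairing_condexp aa bZ)).
split; [exact: m1|exact: i1|move=> A FA].
have mA := subsigma_measurable (sF t) FA; rewrite (I1 _ FA).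
have ita := integrable_tail aa; have itc := integrable_tail ac.
have iPa := integrable_Psi_mul ita; have iPc := integrable_Psi_mul itc.
have [ma ima Ima] := Psi_tail_condexp aa; have [mc imc Imc] := Psi_tail_condexp ac.
have tw : (\int[P]_(w in A) (Psi w * tail c w)%:E = \int[P]_(w in A) (Psi w * tail a w)%:E)%E.
  apply: (integral_tower t_theta iPc iPa) FA => B GB.
  rewrite -(Imc B GB) -(Ima B GB); apply: integral_aeq.
  - exact: (subsigma_measurable sG GB).
  - exact: (measurable_wrt_fun sG mc).
  - exact: (measurable_wrt_fun sG ma).
  - by apply: filterS mass_concat => w ->.
have E : aeq P (fun w => ser Z c w - Psi w * tail c w) (fun w => ser Z a w - Psi w * tail a w).
  have [_ ga _] := aa; have [_ gc _] := ac.
  have cp := concat_path ha hb t_theta.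
  have g2 : {ae P, forall w, [/\ good (cst_time t) a w, good (cst_time t) c w & Phi w = Psi w]}.
    by apply: filterS3 ga gc PhiPsi.
  apply: filterS3 g2 paths cp => w [gaw gcw <-] [s Es [ts sT hX PC hZ]] [s' Es' [_ _ hc']].
  have {}Es' : s' = s by move: Es'; rewrite Es => -[].
  rewrite {s'}Es' -/c in hc'.
  have key y : good (cst_time t) y w -> ser Z y w - Phi w * tail y w =
      ser (fun u w' => Z u w' - after (fun _ => Phi) u w') y w.
    move=> gy; have hZC u : `|Z u w| <= C by rewrite hZ; case: ifP.
    have C0 : 0 <= C by exact: le_trans (normr_ge0 _) PC.
    pose one : process := fun _ _ => 1.
    have h1 u : `|after one u w| <= 1.
      by rewrite /after; case: ifP => _; rewrite ?normr1 ?normr0.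
    have h1P u : `|(- Phi w) * after one u w| <= C.
      by rewrite normrM normrN -[leRHS]mulr1 ler_pM.
    rewrite -(@ser_after1 y w s)//; last by case: gy.
    rewrite -mulNr -(ser_scale (- Phi w) gy h1) -(ser_add gy hZC h1P).
    apply: eq_ser => u; congr ((_ + _) * _); rewrite /after /one.
    by case: ifP => _; rewrite ?mulr1 ?mulr0 ?oppr0.
  rewrite !key//; apply: eq_ser => u; rewrite /after Es /=.
  rewrite hZ; case: leqP => su; first by rewrite subrr !mul0r.
  congr (_ * _); rewrite /increment hc' leqNgt su /=; congr (_ - _).
  case: u su => [|u] //= su.
  by rewrite hc' leqNgt (ltnW su).
have : (\int[P]_(w in A) (ser Z c w - Psi w * tail c w)%:E =
        \int[P]_(w in A) (ser Z a w - Psi w * tail a w)%:E)%E.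
  apply: integral_aeq; first exact: mA.
  - exact: (integrable_measurable (integrable_sub iZc iPc)).
  - exact: (integrable_measurable (integrable_sub iZa iPa)).
  - by apply: filterS E => w h _.
rewrite (integral_subE mA iZc iPc) (integral_subE mA iZa iPa) tw => /(congr1 (fun x => x + \int[P]_(w in A) (Psi w * tail a w)%:E)%E).
have fin := integral_fin mA iPa.
by rewrite !subeK.
Qed.

End Concatenation.

(** The part after theta is controlled by the remaining mass. *)
Lemma later_cond_bound a : adm (cst_time t) a ->
  {ae P, forall w, `|later_cond a w| <= C * mT a w}.
Proof.
move=> aa; have il := integrable_later aa; have it := integrable_tail aa.
have iC := integrable_scale C it.
have iN := integrable_scale (-1) il.
have cC := condexp_unique sG iC (is_condexp_scale C sG it (mass_T aa)).
have cN := condexp_unique sG iN (is_condexp_scale (-1) sG il (condexpP sG il)).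
have [_ ga _] := aa.
pose one : process := fun _ _ => 1.
have bd : {ae P, forall w, `|later a w| <= C * tail a w}.
  apply: filterS2 ga paths => w gw [s E [ts sT hX PC hZ]].
  have C0 : 0 <= C by exact: le_trans (normr_ge0 _) PC.
  have h1 u : `|after one u w| <= 1.
    by rewrite /after; case: ifP => _; rewrite ?normr1 ?normr0.
  have hC u : `|C * after one u w| <= C.
    by rewrite normrM ger0_norm// -[leRHS]mulr1 ler_pM.
  have hXa u : `|after X u w| <= C by rewrite /after; case: ifP; rewrite ?normr0.
  have hNa u : `|-1 * after X u w| <= C by rewrite mulN1r normrN.
  have cvg_a : cvgn (a^~ w) by case: gw.
  rewrite -(ser_after1 cvg_a E) -(ser_scale C gw h1) ler_norml lerNl; apply/andP; split.
  - rewrite -mulN1r -(ser_scale _ gw hXa); apply: (ser_le gw hNa hC) => u.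
    rewrite /after /one; case: ifP => _; last by rewrite !mulr0.
    by rewrite mulN1r mulr1 (le_trans (ler_norm _))// normrN.
  - apply: (ser_le gw hXa hC) => u.
    rewrite /after /one; case: ifP => _; last by rewrite mulr0.
    by rewrite mulr1 (le_trans (ler_norm _)).
have u1 : {ae P, forall w, later_cond a w <= C * mT a w}.
  have bd' : {ae P, forall w, later a w <= C * tail a w}.
    by apply: filterS bd => w h; apply: le_trans (ler_norm _) h.
  by apply: filterS2 (condexp_le sG il iC bd') cC => w + <-.
have u2 : {ae P, forall w, - later_cond a w <= C * mT a w}.
  have bd' : {ae P, forall w, -1 * later a w <= C * tail a w}.
    by apply: filterS bd => w; rewrite mulN1r ler_norml lerNl => /andP[].
  by apply: filterS3 (condexp_le sG iN iC bd') cC cN => w + h1 h2; rewrite h1 h2 mulN1r.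
by apply: filterS2 u1 u2 => w h1 h2; rewrite ler_norml lerNl h1 h2.
Qed.

(** On {theta = s}, the part after theta is the remaining mass times the
    pairing with the normalized future. *)
Lemma later_cond_future a s : in_dual (cst_time t) a -> le_time (Some s) T ->
  {ae P, forall w, theta w = Some s -> 0 < mT a w -> later_cond a w =
    mT a w * bra s (start s X) (mix s (future P F T theta a)) w}.
Proof.
move=> ha sT; have aa := in_dual_adm (stopping_cst t) ha.
set c := mix _ _.
have hc : in_dual (cst_time s) c by exact: (mix_future_in_dual ha sT).
have ac := in_dual_adm (stopping_cst s) hc.
have bS : bounded_on s C (start s X) by exact: (start_bounded sT bX).
have FB := future_event s a.
set B := [set w | _] in FB.
pose Y w := \1_B w * mT a w.
have mY : measurable_wrt (F s) Y.
  have mm : measurable_wrt Gt (mT a) by exact: (condexp_measurable_wrt _ _ sG).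
  have m0 : measurable_wrt (F s) (fun w => \1_[set w | theta w = Some s] w * mT a w).
    exact: (measurable_wrt_at mm).
  rewrite (_ : Y = (fun w => \1_B w * (\1_[set w | theta w = Some s] w * mT a w))).
    apply: measurable_funM; first exact: (measurable_wrt_indic (sF s) FB).
    exact: m0.
  apply/funext => w; rewrite /Y !indicE; have [Bw|nB] := pselect (B w).
    by rewrite [w \in [set _ | theta _ = _]]mem_set ?mul1r//; case: Bw.
  by rewrite (memNset nB) !mul0r.
have il := integrable_later aa.
have mS u : measurable_fun setT (start s X u) by case: bS => RS _; exact: (R0_measurable _ RS).
have SC : {ae P, forall w, forall u, `|start s X u w| <= C}.
  by apply: filterS bS.2 => w h u; have [] := h u.
have is_ := integrable_ser ac mS SC.
have EY : {ae P, forall w, Y w * ser (start s X) c w = \1_B w * later a w}.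
  have [_ ga _] := aa; have [_ gc _] := ac.
  have st := start_aeq s bX.
  have g2 : {ae P, forall w, [/\ good (cst_time t) a w, good (cst_time s) c w & forall u, `|start s X u w| <= C]}.
    by apply: filterS3 ga gc SC.
  apply: filterS3 g2 st paths => w [gaw gcw Sw] stw [s' Es' [ts sT' hX PC hZ]].
  rewrite /Y indicE; have [Bw|nB] := pselect (B w); last by rewrite (memNset nB) !mul0r.
  rewrite mem_set// !mul1r; have [E m0] := Bw.
  rewrite -(ser_scale _ gcw Sw); apply: eq_ser => u.
  rewrite /after E /= stw; case: leqP => su; last by rewrite mulr0 !mul0r.
  rewrite mulrAC mulrC; congr (_ * _).
  have mne : mT a w != 0 by rewrite gt_eqF.
  have ce v : c v w = if (s <= v)%N then (a v w - prev a s w) / mT a w else 0.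
    by rewrite /c mix_future_eq E eqxx m0.
  rewrite /increment ce su; case: u su => [|u] su /=.
    rewrite !subr0; move: su; rewrite leqn0 => /eqP ->; rewrite /= subr0.
    by rewrite mulrC divfK.
  rewrite ce; case: leqP => su'.
    by rewrite -mulrBl opprB addrA subrK mulrC divfK.
  have -> : s = u.+1 by apply/eqP; rewrite eqn_leq su su'.
  by rewrite /= subr0 mulrC divfK.
have iY : intg (fun w => Y w * ser (start s X) c w).
  apply: integrable_dominated (integrable_norm il) _.
    apply: measurable_funM; first exact: (measurable_wrt_fun (sF s) mY).
    exact: (integrable_measurable is_).
  apply: filterS EY => w ->; rewrite normrM indicE; case: (w \in B).
    by rewrite /= normr1 mul1r.
  by rewrite /= normr0 mul0r normr_ge0.
have cY := condexp_unique (sF s) iY (condexp_pull (sF s) mY is_ iY).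
have cS := condexp_unique (sF s) is_ (pairing_condexp ac bS).
have GB : Gt B by apply/(@stopped_trace theta s); [move=> w []|].
have loc : {ae P, forall w, B w -> later_cond a w = condexp P (F s) (fun w => Y w * ser (start s X) c w) w}.
  apply: (condexp_aeq_local sG (sF s) GB FB _ il iY).
    by move=> A AB; apply: stopped_trace => // w /AB [].
  by apply: filterS EY => w -> Bw; rewrite indicE mem_set// mul1r.
apply: filterS3 loc cY cS => w h1 h2 h3 E m0.
have Bw : B w by [].
by rewrite h1// h2 h3 /Y indicE mem_set// mul1r.
Qed.

(** * Time consistency at one stopping time *)

Local Notation join a b := (concat P F theta setT a b).
Local Notation sup_join a :=
  (esssup P [set gamma t (join a b) | b in dual P F theta Tm]).
Hypothesis hdec : penalty_decomposition P F T gamma t theta.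

Let mphi Y : bounded_on t C Y -> measurable_fun setT (phi t Y).
Proof. by move=> bY; have [[]] := phi_Linf tT bY. Qed.

Let admt a : in_dual (cst_time t) a -> adm (cst_time t) a.
Proof. exact: (in_dual_adm (stopping_cst t)). Qed.

Let bS s : le_time (Some s) T -> bounded_on s C (start s X).
Proof. by move=> sT; exact: (start_bounded sT bX). Qed.

Let Psi_at : {ae P, forall w, exists2 s, theta w = Some s &
  le_time (Some s) T /\ Psi w = phi s (start s X) w}.
Proof.
have h1 := utility_atE htheta theta_T bX.
have h2 : {ae P, forall w, theta w != None /\ le_time (theta w) T}.
  by apply: filterS2 fin_theta theta_T.
apply: filterS3 h1 h2 PhiPsi => w.
case: (theta w) => [s|] h [//] _ sT <-; exists s => //; split => //.
exact: h.
Qed.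

(** The normalized future of a on {theta = s}. *)
Let fut a s := mix s (future P F T theta a).

Let fut_in a s : in_dual (cst_time t) a -> le_time (Some s) T ->
  in_dual (cst_time s) (fut a s).
Proof. by move=> ha sT; exact: (mix_future_in_dual ha sT). Qed.

(** The conditional expectation, given F_theta, of the difference of the
    integrals of X and of Z against a. *)
Let cond a := fun w => later_cond a w - Psi w * mT a w.

Let cond_pairing a : in_dual (cst_time t) a ->
  is_condexp P (F t) (cond a) (fun w => bra t X a w - bra t Z a w).
Proof.
move=> ha; exact: (pairing_sub_stopped_utility (admt ha)).
Qed.

Let integrable_mass a : in_dual (cst_time t) a -> intg (mT a).
Proof. by move=> ha; have [] := mass_T (admt ha). Qed.

Let integrable_cond a : in_dual (cst_time t) a -> intg (cond a).
Proof.
move=> ha; apply: integrable_sub.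
  apply: integrable_condexp; first exact: sG.
  exact: (integrable_later (admt ha)).
apply: integrable_mul_bounded (integrable_mass ha) PsiC.
exact: (measurable_wrt_fun sG mPsi).
Qed.

(** What is known at almost every point about a, X and Psi. *)
Let regular a : in_dual (cst_time t) a ->
  {ae P, forall w, [/\ 0 <= mT a w, `|later_cond a w| <= C * mT a w &
    exists2 s, theta w = Some s & [/\ le_time (Some s) T,
      Psi w = phi s (start s X) w & 0 < mT a w ->
      later_cond a w = mT a w * bra s (start s X) (fut a s) w]]}.
Proof.
move=> ha.
have h1 := mass_ge0 (admt ha).
have h2 := later_cond_bound (admt ha).
have h12 : {ae P, forall w, 0 <= mT a w /\ `|later_cond a w| <= C * mT a w}.
  by apply: filterS2 h1 h2.
have h3 : {ae P, forall w, forall s, le_time (Some s) T -> theta w = Some s -> 0 < mT a w ->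
    later_cond a w = mT a w * bra s (start s X) (fut a s) w}.
  apply: ae_forall_time => s sT.
  exact: (later_cond_future ha sT).
apply: filterS3 h12 h3 Psi_at => w [m0 vC] hv [s E [sT Ps]].
by split => //; exists s => //; split => // m1; exact: hv.
Qed.

(** The representation of phi_s on each {theta = s}, applied to the normalized
    future of a and multiplied by the remaining mass. *)
Let ext_le a : in_dual (cst_time t) a ->
  {ae P, forall w, (ext a w <= (cond a w)%:E)%E}.
Proof.
move=> ha.
have hl : {ae P, forall w, forall s, le_time (Some s) T ->
    ((phi s (start s X) w)%:E <= (bra s (start s X) (fut a s) w)%:E - gamma s (fut a s) w)%E}.
  apply: ae_forall_time => s sT.
  exact: (phi_lower sT (bS sT) (fut_in ha sT)).
apply: filterS2 (regular ha) hl => w [m0 vC [s E [sT Ps hv]]] /(_ s sT) h1.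
rewrite /cond; have [m1|m1] := boolP (0 < mT a w); last first.
  rewrite penalty_ext0//; have mz : mT a w = 0 by apply/eqP; rewrite eq_le m0 leNgt m1.
  have : later_cond a w = 0.
    by apply/eqP; rewrite -normr_le0; move: vC; rewrite mz mulr0.
  by rewrite mz mulr0 => ->; rewrite subr0.
rewrite (penalty_extE E sT m1) hv// Ps mulrC -mulrBl.
by move: h1; rewrite lee_sub_swap mulrC EFinM lee_pmul2l// lte_fin.
Qed.

Let dec_at a : in_dual (cst_time t) a -> aeq P (gamma t a)
   (fun w => sup_join a w
     + condexp_npos P (F t) (ext a) w)%E.
Proof.
by move=> ha; have := hdec ((dual_cstP a tT).2 ha); rewrite stopped_cst.
Qed.

Let concat_in a b : in_dual (cst_time t) a -> in_dual theta b ->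
  in_dual (cst_time t) (join a b).
Proof. move=> ha hb; exact: (concat_in_dual ha hb t_theta). Qed.

Let dual_theta_ne : dual P F theta Tm !=set0.
Proof.
pose K (w : Omega) : nat := 0%N.
pose b (s k : nat) : process := ind_from R (cst_time s).
have h := @glue_in_dual b K.
exists (glue b K); apply/(dualP _ htheta theta_T); apply: h.
- by move=> s k; exact: ind_from_R0.
- by move=> s k sT; exact: ind_from_in_dual.
- move=> s k; apply: (subsigmaI (sF s)); first exact: stopping_eq.
  exact: (subsigma_cst (sF s) (0%N = k)).
Qed.

Let concat_measurable a b : in_dual (cst_time t) a -> dual P F theta Tm b ->
  measurable_fun setT (gamma t (join a b)).
Proof.
move=> ha /(dualP _ htheta theta_T) hb.
exact: (gamma_measurable tT (concat_in ha hb)).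
Qed.

Let esssup_concat a : in_dual (cst_time t) a ->
  is_esssup P [set gamma t (join a b) | b in dual P F theta Tm](sup_join a).
Proof.
move=> ha; apply: esssupP.
- by have [b hb] := dual_theta_ne; eexists; exists b; [exact: hb|reflexivity].
- by move=> _ [b hb <-]; exact: concat_measurable.
Qed.

(** Pairing Z with the concatenations of a bounds their penalties; what happens
    after theta is bounded by [ext_le]. *)
Lemma stopped_utility_le : {ae P, forall w, phi t Z w <= phi t X w}.
Proof.
apply: (phi_greatest tT bX (mphi bZ)) => a ha.
have cp := cond_pairing ha.
have e1 : {ae P, forall w, (condexp_npos P (F t) (ext a) w
     <= (bra t X a w - bra t Z a w)%:E)%E}.
  have h1 := condexp_npos_le (sF t) (penalty_ext_measurable ha)
     (penalty_ext_le0 ha) (integrable_cond ha) (ext_le ha).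
  by apply: filterS2 h1 (condexp_unique (sF t) (integrable_cond ha) cp) => w + <-.
have mbZ : measurable_fun setT (bra t Z a).
  have [m _ _] := pairing_condexp (admt ha) bZ.
  exact: (measurable_wrt_fun (sF t) m).
have e2 : {ae P, forall w,
    (sup_join a w
     <= (bra t Z a w - phi t Z w)%:E)%E}.
  have [_ _ lst] := esssup_concat ha; apply: lst.
    by apply/measurable_EFinP; apply: measurable_funB => //; exact: mphi.
  move=> _ [b /(dualP _ htheta theta_T) hb <-].
  have hc := concat_in ha hb.
  have h1 := phi_lower tT bZ hc.
  have h3 := pairing_stopped_utility_concat ha hb.
  by apply: filterS2 h1 h3 => w + <-; rewrite lee_sub_swap.
apply: filterS3 e1 e2 (dec_at ha) => w h1 h2 ->; rewrite lee_sub_swap.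
have -> : bra t X a w - phi t Z w = (bra t Z a w - phi t Z w) + (bra t X a w - bra t Z a w) by ring.
by rewrite EFinD; exact: leeD.
Qed.

Let mass_concat_infty a b : in_dual (cst_time t) a -> in_dual theta b ->
  aeq P (mT (join a b)) (mI a).
Proof.
move=> ha hb.
have h1 := mass_concat ha hb.
have h2 := mass_aeq (admt ha).
by apply: filterS2 h1 h2 => w -> ->.
Qed.

(** Concatenating twice at theta only keeps the last continuation. *)
Let concat_concat a b b' : in_dual (cst_time t) a -> in_dual theta b ->
  in_dual theta b' ->
  aeqp P (join (join a b) b')
         (join a b').
Proof.
move=> ha hb hb'; set c := join a b.
have hc : in_dual (cst_time t) c by exact: concat_in.
have p1 := concat_path ha hb t_theta.
have p2 := concat_path ha hb' t_theta.
have p3 := concat_path hc hb' t_theta.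
have m : aeq P (mI c) (mI a).
  apply: filterS2 (mass_concat_infty ha hb) (mass_aeq (admt hc)).
  by move=> w <- ->.
have p12 : {ae P, forall w, exists2 s, theta w = Some s &
   (forall u, c u w = if (s <= u)%N then prev a s w + mI a w * b u w else a u w) /\
   (forall u, join a b' u w = if (s <= u)%N then prev a s w + mI a w * b' u w else a u w)}.
  apply: filterS2 p1 p2 => w [s E [_ _ h]] [s' E' [_ _ h']]; exists s => //; split => //.
  by move: E'; rewrite E => -[->].
apply: filterS3 p12 p3 m => w [s E [h1 h2]] [s' E' [_ _ h3]] mE u.
have {E'}Es : s' = s by move: E'; rewrite E => -[].
rewrite {s'}Es in h3; rewrite h2 h3 mE; case: leqP => su; last by rewrite h1 leqNgt su.
by congr (_ + _); case: (s) h1 => [|v] //= ->; rewrite ltnn.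
Qed.

Section Optimal.
Variable e : R.
Hypothesis e0 : 0 < e.

(** An element of D_theta that is optimal up to e on each {theta = s}. *)
Let optimal : exists b, in_dual theta b /\
  forall a, in_dual (cst_time t) a ->
  let c := join a b in
  {ae P, forall w, 0 < mT c w -> exists2 s, theta w = Some s &
    ((bra s (start s X) (fut c s) w)%:E - gamma s (fut c s) w
       <= (phi s (start s X) w + e)%:E)%E}.
Proof.
have /choice[bK hbK] : forall s, exists bK : (nat -> process) * (Omega -> nat),
  [/\ forall k, R0 P F (bK.1 k),
      forall k, F s [set w | bK.2 w = k] &
      le_time (Some s) T -> (forall k, in_dual (cst_time s) (bK.1 k)) /\
      {ae P, forall w, ((bra s (start s X) (bK.1 (bK.2 w)) w)%:E - gamma s (bK.1 (bK.2 w)) w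
                          <= (phi s (start s X) w + e)%:E)%E}].
  move=> s; have [sT|sT] := boolP (le_time (Some s) T).
    have [b [K [h1 h2 h3]]] := phi_almost_optimal sT (bS sT) e0.
    by exists (b, K); split => // k; have [] := h1 k.
  (* The times s > T do not matter, and any process will do. *)
  exists (fun _ => ind_from R (cst_time s), fun _ => 0%N); split => //.
  - by move=> k; exact: ind_from_R0.
  - by move=> k; exact: (subsigma_cst (sF s) (0%N = k)).
pose b s k := (bK s).1 k.
pose K w := if theta w is Some s then (bK s).2 w else 0%N.
have Rb s k : R0 P F (b s k) by have [h _ _] := hbK s; exact: h.
have Db s k : le_time (Some s) T -> in_dual (cst_time s) (b s k).
  by move=> sT; have [_ _ /(_ sT) [h _]] := hbK s; exact: h.
have hK s k : F s ([set w | theta w = Some s] `&` [set w | K w = k]).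
  rewrite (_ : _ `&` _ = [set w | theta w = Some s] `&` [set w | (bK s).2 w = k]).
    apply: (subsigmaI (sF s)); first exact: stopping_eq.
    by have [_ h _] := hbK s; exact: h.
  by apply/seteqP; split => w /= [E]; rewrite /K E.
have hb : in_dual theta (glue b K).
  exact: (glue_in_dual Rb Db hK).
exists (glue b K); split => // a ha c.
have hc : in_dual (cst_time t) c by exact: concat_in.
have mmc : measurable_wrt Gt (mT c) by exact: (condexp_measurable_wrt _ _ sG).
(* On D s k the normalized future of c is b s k, so that locality applies. *)
pose D s k := [set w | theta w = Some s] `&` [set w | K w = k] `&` [set w | 0 < mT c w].
have FD s k : F s (D s k).
  have -> : D s k = ([set w | theta w = Some s] `&` [set w | K w = k]) `&`
      ([set w | theta w = Some s] `&` [set w | 0 < mT c w]).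
    by apply/seteqP; split => w /= [[h1 h2]]; [move=> h3|move=> [_ h3]].
  apply: (subsigmaI (sF s)) => //.
  apply/(@stopped_trace theta s); first by move=> w [].
  apply: (subsigmaI sG); first exact: stopped_eq.
  by apply: (measurable_wrt_ltr sG) => //; exact: measurable_cst.
have bgood : {ae P, forall w, forall s k, le_time (Some s) T -> good (cst_time s) (b s k) w}.
  suff : {ae P, forall w, forall s, le_time (Some s) T -> forall k, good (cst_time s) (b s k) w}.
    by apply: filterS => w h s k /h; exact.
  by apply: ae_forall_time => s sT; apply: ae_foralln => k; have [] := Db s k sT.
have fE : {ae P, forall w, forall s k, le_time (Some s) T -> D s k w -> forall u, fut c s u w = b s k u w}.
  have pth := concat_path ha hb t_theta.
  have mc := mass_concat_infty ha hb.
  apply: filterS3 bgood pth mc => w bg [s' E' [_ _ ce]] mcE s k sT [[/= E Kw] m0] u.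
  have {E'}Es : s' = s by move: E'; rewrite E => -[].
  rewrite {s'}Es -/c in ce.
  rewrite /fut mix_future_eq E eqxx m0 /=; case: leqP => su; last first.
    by have [_ + _ _] := bg s k sT; rewrite /= => -> //; rewrite -ltnNge.
  have -> : prev c s w = prev a s w.
    by case: (s) ce => [|v] //= ->; rewrite ltnn.
  rewrite ce su (glueE _ _ _ E) su Kw addrAC subrr add0r -mcE mulrC mulKf//.
  by rewrite gt_eqF.
have loc : {ae P, forall w, forall s k, le_time (Some s) T -> D s k w ->
    bra s (start s X) (fut c s) w = bra s (start s X) (b s k) w /\
    gamma s (fut c s) w = gamma s (b s k) w}.
  apply: ae_foralln => s; apply: ae_foralln => k.
  case sT : (le_time (Some s) T); last exact: aeW.
  have hE : {ae P, forall w, D s k w -> forall u, fut c s u w = b s k u w}.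
    by apply: filterS fE => w h Dw; exact: h.
  have hf := fut_in hc sT.
  have h1 := pairing_local (in_dual_adm (stopping_cst s) hf)
     (in_dual_adm (stopping_cst s) (Db s k sT)) (bS sT) (FD s k) hE.
  have h2 := gamma_local sT hf (Db s k sT) (FD s k) hE.
  by apply: filterS2 h1 h2 => w g1 g2 _ Dw; split; [exact: g1|exact: g2].
have opt : {ae P, forall w, forall s, le_time (Some s) T ->
   ((bra s (start s X) (b s ((bK s).2 w)) w)%:E - gamma s (b s ((bK s).2 w)) w
                          <= (phi s (start s X) w + e)%:E)%E}.
  by apply: ae_forall_time => s sT; have [_ _ /(_ sT) []] := hbK s.
apply: filterS3 loc opt Psi_at => w h1 h2 [s E [sT _]] m0.
exists s => //; have Kw : K w = (bK s).2 w by rewrite /K E.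
have Dw : D s (K w) w by [].
by have [-> ->] := h1 s (K w) sT Dw; rewrite Kw; exact: h2.
Qed.

(** The converse inequality, tested on the concatenation of a with an element
    that is almost optimal after theta. *)
Lemma le_stopped_utility_add : {ae P, forall w, phi t X w - e <= phi t Z w}.
Proof.
have [b [hb opt]] := optimal.
apply: (phi_greatest tT bZ).
  by apply: measurable_funB; [exact: mphi|exact: measurable_cst].
move=> a ha; pose c := join a b.
have hc : in_dual (cst_time t) c by exact: concat_in.
have icc := integrable_cond hc; have imc := integrable_mass hc.
have iem := integrable_scale e imc.
pose low w := cond c w - e * mT c w.
have ilow : intg low by exact: integrable_sub icc iem.
have ext_ge : {ae P, forall w, ((low w)%:E <= ext c w)%E}.
  apply: filterS2 (regular hc) (opt a ha) => w [m0 vC [s E [sT Ps hv]]] ho.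
  rewrite /low /cond; have [m1|m1] := boolP (0 < mT c w); last first.
    rewrite penalty_ext0//; have mz : mT c w = 0 by apply/eqP; rewrite eq_le m0 leNgt m1.
    have : later_cond c w = 0.
      by apply/eqP; rewrite -normr_le0; move: vC; rewrite mz mulr0.
    by rewrite mz !mulr0 => ->; rewrite !subr0.
  rewrite (penalty_extE E sT m1) hv// Ps.
  have [s' E' +] := ho m1; have {E'}-> : s' = s by move: E'; rewrite E => -[].
  rewrite -/(fut c s) -/c; case: (gamma s (fut c s) w) => [g||] //=.
  - rewrite -EFinB !lee_fin => h.
    have -> : mT c w * bra s (start s X) (fut c s) w - phi s (start s X) w * mT c w - e * mT c w =
      mT c w * (bra s (start s X) (fut c s) w - (phi s (start s X) w + e)) by ring.
    by rewrite ler_pM2l// lerBlDr addrC -lerBlDr.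
  - by move=> _; rewrite gt0_muley ?leey// lte_fin.
have npos_ge : {ae P, forall w, ((bra t X c w - bra t Z c w - e)%:E <=
     condexp_npos P (F t) (ext c) w)%E}.
  have h1 := condexp_npos_ge (sF t) (penalty_ext_measurable hc)
     (penalty_ext_le0 hc) ilow ext_ge.
  have h2 := condexp_unique (sF t) ilow (is_condexp_sub (sF t) icc iem (cond_pairing hc)
     (is_condexp_scale e (sF t) imc (condexpP (sF t) imc))).
  (* The total mass of c has conditional expectation 1. *)
  have h3 : {ae P, forall w, condexp P (F t) (mT c) w <= 1}.
    have ac := admt hc; have [Rc gc itot] := ac.
    have itl := integrable_tail ac.
    have cm : is_condexp P (F t) (mT c) (condexp P (F t) (tail c)).
      have [k1 k2 k3] := condexpP (sF t) itl.
      split; [exact: k1|exact: k2|move=> A FA]; rewrite (k3 A FA).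
      apply: (integral_tower t_theta itl imc) FA => B GB.
      by have [_ _ k4] := mass_T ac; rewrite (k4 B GB).
    have c1 : is_condexp P (F t) (total c) (cst 1).
      split; [exact: measurable_cst|exact: integrable_const|move=> A FA].
      have [_ _ k4] := hc; rewrite k4; last by rewrite stopped_cst.
      by apply: integral_one; exact: (subsigma_measurable (sF t) FA).
    have le1 : {ae P, forall w, tail c w <= total c w}.
      apply: filterS gc => w gw; have /andP[k1 _] := prev_at_bounds gw.
      by rewrite /tail lerBlDr lerDl.
    have k1 := condexp_le (sF t) itl itot le1.
    have k2 := condexp_unique (sF t) itot c1.
    have k3 := condexp_unique (sF t) imc cm.
    by apply: filterS3 k1 k2 k3 => w l1 l2 l3; rewrite l3 -[leRHS]l2.
  apply: filterS3 h1 h2 h3 => w + h h'; rewrite h; apply: le_trans.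
  by rewrite lee_fin lerB// ler_piMr// ltW.
have npos_le0 : {ae P, forall w, (condexp_npos P (F t) (ext a) w <= 0)%E}.
  have h1 := condexp_npos_le (sF t) (penalty_ext_measurable ha)
     (penalty_ext_le0 ha) (integrable_const P 0)
     (penalty_ext_le0 ha).
  apply: filterS2 h1 (condexp_cst P 0 (sF t)) => w k1 k2; apply: (le_trans k1).
  by rewrite lee_fin; exact: (eq_ind_r (fun x => x <= 0) (lexx 0) k2).
(* By [concat_concat] c and a have the same concatenations. *)
have sup_eq : aeq P (sup_join c) (sup_join a).
  apply: esssup_aeq => //.
  - by move=> b' hb'; exact: concat_measurable.
  - by move=> b' hb'; exact: concat_measurable.
  move=> b' /(dualP _ htheta theta_T) hb'.
  exact: (gamma_aeqp tT (concat_in hc hb') (concat_in ha hb') (concat_concat ha hb hb')).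
have lowc := phi_lower tT bX hc.
have pZ := pairing_stopped_utility_concat ha hb.
have step1 : {ae P, forall w,
    (sup_join a w
     <= (bra t Z c w + e - phi t X w)%:E)%E}.
  have dc : {ae P, forall w, gamma t c w =
     (sup_join a w
     + condexp_npos P (F t) (ext c) w)%E}.
    by apply: filterS2 (dec_at hc) sup_eq => w -> ->.
  apply: filterS3 lowc dc npos_ge => w h1 h h2.
  move: h1; rewrite lee_sub_swap h => h1.
  have := le_trans (leeD2l _ h2) h1; rewrite -leeBrDr// -EFinB.
  move=> /le_trans; apply; rewrite lee_fin.
  by rewrite le_eqVlt; apply/orP; left; apply/eqP; ring.
have step2 := dec_at ha.
have step3 : {ae P, forall w, (gamma t a w <= (bra t Z c w + e - phi t X w)%:E)%E}.
  apply: filterS3 step1 step2 npos_le0 => w h1 -> h2.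
  by rewrite -[leRHS]adde0; exact: leeD.
apply: filterS2 step3 pZ => w h1 h2; rewrite lee_sub_swap.
apply: (le_trans h1); rewrite lee_fin -h2.
by rewrite le_eqVlt; apply/orP; left; apply/eqP; rewrite -/c; ring.
Qed.

End Optimal.

(** The decomposition of the penalty functions at theta entails time
    consistency at theta. *)
Lemma stopped_utility_aeq : aeq P (phi t X) (phi t Z).
Proof.
have h : {ae P, forall w, forall k : nat, phi t X w - k.+1%:R^-1 <= phi t Z w}.
  by apply: ae_foralln => k; apply: le_stopped_utility_add; rewrite invr_gt0.
apply: filterS2 h stopped_utility_le => w h1 h2.
apply/eqP; rewrite eq_le h2 andbT; apply/ler_addgt0Pr => e e0.
have [k ke] := invrS_lt e0.
by rewrite -lerBlDr (le_trans _ (h1 k))// lerD2l lerN2 ltW.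
Qed.

End AtTheta.

(** * From one-step time consistency to all stopping times *)

Section OneTime.
Variables (t : nat) (theta : Omega -> option nat) (X : process) (C : R).
Hypothesis tT : le_time (Some t) T.
Hypothesis htheta : stopping_time F theta.
Hypothesis fin_theta : ae_finite P theta.
Hypothesis t_theta : ae_le_time P (cst_time t) theta.
Hypothesis theta_T : ae_le_time P theta Tm.
Hypothesis bX : bounded_on t C X.

Lemma start_self : aeq P (phi t (start t X)) (phi t X).
Proof.
apply: (phi_aeqp tT (start_bounded tT bX) bX).
apply: filterS2 (start_aeq t bX) bX.2 => w h hX u; rewrite h.
by case: leqP => // ut; have [_ ->] := hX u.
Qed.

(** Nothing changes on {theta = t}, by normalization. *)
Lemma stopped_utility_now : {ae P, forall w, theta w = Some t ->
  phi t X w = phi t (stopped_utility t theta X) w}.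
Proof.
have L := phi_Linf tT bX; have [L0phi _] := L.
have bY := payment_bounded tT L0phi (phi_bound tT bX) (bounded_on_ge0 bX).
have bZ := stopped_utility_bounded htheta fin_theta t_theta theta_T bX.
have E : {ae P, forall w, theta w = Some t -> forall u,
    stopped_utility t theta X u w = phi t X w * ind_from R (cst_time t) u w}.
  have h1 := stopped_utilityE fin_theta t_theta theta_T bX.
  have h2 := utility_atE htheta theta_T bX.
  have h3 : {ae P, forall w, phi t (start t X) w = phi t X w /\ forall u, (u < t)%N -> X u w = 0}.
    by apply: filterS2 start_self bX.2 => w e hX; split => // u ut; have [_ ->] := hX u.
  apply: filterS3 h1 h2 h3 => w [s Es [_ _ h]] hP [e hX] Et u.
  rewrite (h u); have -> : s = t by move: Et; rewrite Es => -[].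
  rewrite (hP t Et) e /ind_from /=; case: leqP => ut; first by rewrite mulr1.
  by rewrite hX// mulr0.
have loc := phi_local tT bZ bY (stopping_eq htheta t) E.
by apply: filterS2 loc (phi_payment tT L) => w h1 h2 Et; rewrite h1// h2.
Qed.

End OneTime.

(** Restricting to [t, oo) first does not matter when t <= s. *)
Lemma start_start s t (X : process) : (t <= s)%N -> le_time (Some s) T ->
  start s (start t X) = start s X.
Proof.
move=> ts sT; apply/funext => u; apply/funext => w; rewrite !startE.
case: leqP => // su; rewrite (min_timeK).
have -> // : (t <= min_time u T)%N.
apply: (leq_trans ts); move: sT su; case: T => //= N sN su.
by rewrite /min_time leq_min su sN.
Qed.

(** Time consistency between t and t+1 for all t < N entails time consistency
    with respect to all stopping times. *)
Lemma time_consistent_recursion N : T = Some N ->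
  (forall t C (X : process), (t < N)%N -> bounded_on t C X ->
    aeq P (phi t X) (phi t (stopped_utility t (cst_time t.+1) X))) ->
  forall k t (theta : Omega -> option nat) C (X : process), (t + k = N)%N -> stopping_time F theta ->
    ae_finite P theta -> ae_le_time P (cst_time t) theta ->
    ae_le_time P theta Tm -> bounded_on t C X ->
    aeq P (phi t X) (phi t (stopped_utility t theta X)).
Proof.
move=> TN one; elim=> [|k IH] t theta C X tk htheta fin_theta t_theta theta_T bX.
  rewrite addn0 in tk; have tT : le_time (Some t) T by rewrite TN tk /=.
  have now := stopped_utility_now tT htheta fin_theta t_theta theta_T bX.
  have h : {ae P, forall w, theta w = Some t}.
    apply: filterS3 fin_theta t_theta theta_T => w.
    case: (theta w) => //= s _ ts; rewrite TN /= -tk => st.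
    by congr Some; apply/eqP; rewrite eqn_leq st ts.
  by apply: filterS2 now h => w; apply.
have tN : (t < N)%N by rewrite -tk addnS ltnS leq_addr.
have tT : le_time (Some t) T by rewrite TN /= ltnW.
have t1T : le_time (Some t.+1) T by rewrite TN.
have now := stopped_utility_now tT htheta fin_theta t_theta theta_T bX.
set Z := stopped_utility t theta X in now *.
have bZ : bounded_on t C Z.
  exact: (stopped_utility_bounded htheta fin_theta t_theta theta_T bX).
(* theta' is max(theta, t+1), which agrees with theta on A below. *)
pose theta' w : option nat := if theta w is Some s then Some (maxn s t.+1) else None.
have htheta' : stopping_time F theta'.
  move=> u; have [tu|ut] := leqP t.+1 u.
    rewrite (_ : [set w | _] = [set w | le_time (theta w) (Some u)]); first exact: htheta.
    by apply/seteqP; split => w /=; rewrite /theta'; case: (theta w) => //= s; rewrite geq_max tu andbT.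
  rewrite (_ : [set w | _] = set0); first exact: (subsigma0 (sF u)).
  apply/seteqP; split => w //=; rewrite /theta'; case: (theta w) => //= s.
  by rewrite geq_max (leqNgt t.+1) ut andbF.
have fin_theta' : ae_finite P theta'.
  by apply: filterS fin_theta => w; rewrite /theta'; case: (theta w).
have t_theta' : ae_le_time P (cst_time t.+1) theta'.
  by apply: aeW => w; rewrite /theta'; case: (theta w) => //= s; exact: leq_maxr.
have theta_T' : ae_le_time P theta' Tm.
  apply: filterS2 fin_theta theta_T => w; rewrite /theta'; case: (theta w) => //= s _.
  by rewrite TN /= geq_max => ->.
pose X1 := start t.+1 X; pose Z1 := start t.+1 Z.
have bX1 : bounded_on t.+1 C X1 by exact: (start_bounded t1T bX).
have bZ1 : bounded_on t.+1 C Z1 by exact: (start_bounded t1T bZ).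
have ih := IH t.+1 theta' C X1 (etrans (addSnnS t k) tk) htheta' fin_theta' t_theta' theta_T' bX1.
set W := stopped_utility t.+1 theta' X1 in ih.
have bW : bounded_on t.+1 C W.
  exact: (stopped_utility_bounded htheta' fin_theta' t_theta' theta_T' bX1).
pose A := ~` [set w | theta w = Some t].
have FA : F t A by apply: (subsigmaC (sF t)); exact: stopping_eq.
have FA1 : F t.+1 A by exact: (filtration_le (leqnSn t)).
have later : {ae P, forall w, A w -> exists2 s, theta w = Some s & [/\ (t < s)%N, le_time (Some s) T & theta' w = Some s]}.
  apply: filterS3 fin_theta t_theta theta_T => w; rewrite /A /theta' /=.
  case: (theta w) => // s _ /= ts sT nt; exists s => //.
  have st : (t < s)%N by rewrite ltn_neqAle ts andbT; apply/eqP => E; apply: nt; rewrite E.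
  by split => //; congr Some; exact/maxn_idPl.
have Zpath := stopped_utilityE fin_theta t_theta theta_T bX.
have WZ : {ae P, forall w, A w -> forall u, W u w = Z1 u w}.
  have h1 := stopped_utilityE fin_theta' t_theta' theta_T' bX1.
  have h2 := utility_atE htheta theta_T bX.
  have h3 := utility_atE htheta' theta_T' bX1.
  have h23 : {ae P, forall w,
     (forall s, theta w = Some s -> utility_at T phi theta (proj theta Tm X) w = phi s (start s X) w) /\
     (forall s, theta' w = Some s -> utility_at T phi theta' (proj theta' Tm X1) w = phi s (start s X1) w)}.
    by apply: filterS2 h2 h3.
  have h4 : {ae P, forall w, (forall u, Z1 u w = if (t.+1 <= u)%N then Z u w else 0) /\
     (forall u, X1 u w = if (t.+1 <= u)%N then X u w else 0)}.
    by apply: filterS2 (start_aeq t.+1 bZ) (start_aeq t.+1 bX).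
  have h5 : {ae P, forall w, A w -> exists2 s, theta w = Some s &
     [/\ (t < s)%N, le_time (Some s) T, theta' w = Some s,
       forall u, Z u w = if (s <= u)%N then utility_at T phi theta (proj theta Tm X) w else X u w &
       forall u, W u w = if (s <= u)%N then utility_at T phi theta' (proj theta' Tm X1) w else X1 u w]}.
    apply: filterS3 later Zpath h1 => w lt [s2 E2 [_ _ hZ]] [s1 E1 [_ _ hW]] Aw.
    have [s E [ts sT E']] := lt Aw; exists s => //; split => //.
    - by have <- : s2 = s by move: E2; rewrite E => -[].
    - by have <- : s1 = s by move: E1; rewrite E' => -[].
  apply: filterS3 h5 h23 h4 => w h [e1 e2] [e3 e4] Aw u.
  have [s E [ts sT E' hZ hW]] := h Aw.
  rewrite hW e3 hZ e4 (e1 _ E) (e2 _ E') (start_start X ts sT).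
  by case: (leqP s u) => // su; rewrite (leq_trans ts su).
have X1Z1 : {ae P, forall w, A w -> phi t.+1 X1 w = phi t.+1 Z1 w}.
  have h := phi_local t1T bW bZ1 FA1 WZ.
  by apply: filterS2 ih h => w -> .
pose next := cst_time t.+1 : Omega -> option nat.
have hnext : stopping_time F next by exact: stopping_cst.
have fnext : ae_finite P next by exact: aeW.
have tnext : ae_le_time P (cst_time t) next by apply: aeW => w /=.
have nextT : ae_le_time P next Tm by exact: aeW.
have b2 Y : bounded_on t C Y -> bounded_on t C (stopped_utility t next Y).
  by move=> bY; exact: (stopped_utility_bounded hnext fnext tnext nextT bY).
have path2 Y : bounded_on t C Y -> {ae P, forall w, forall u,
    stopped_utility t next Y u w = if (t < u)%N then phi t.+1 (start t.+1 Y) w else Y u w}.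
  move=> bY; have h1 := stopped_utilityE fnext tnext nextT bY.
  apply: filterS2 h1 (utility_atE hnext nextT bY) => w [s [<-] [_ _ h]] e u.
  by rewrite h (e t.+1 erefl).
have XZ2 : {ae P, forall w, A w -> forall u,
    stopped_utility t next X u w = stopped_utility t next Z u w}.
  have p12 : {ae P, forall w,
     (forall u, stopped_utility t next X u w = if (t < u)%N then phi t.+1 X1 w else X u w) /\
     (forall u, stopped_utility t next Z u w = if (t < u)%N then phi t.+1 Z1 w else Z u w)}.
    by apply: filterS2 (path2 X bX) (path2 Z bZ).
  have q : {ae P, forall w, A w -> phi t.+1 X1 w = phi t.+1 Z1 w /\
     forall u, (u <= t)%N -> Z u w = X u w}.
    apply: filterS3 X1Z1 later Zpath => w h1 lt [s2 E2 [_ _ hZ]] Aw; split; first exact: h1.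
    have [s E [ts _ _]] := lt Aw; have Es : s2 = s by move: E2; rewrite E => -[].
    by move=> u ut; rewrite /Z hZ Es leqNgt (leq_ltn_trans ut ts).
  apply: filterS2 p12 q => w [e1 e2] h Aw u; have [h1 h2] := h Aw.
  by rewrite e1 e2 h1; case: leqP => // ut; rewrite h2.
have loc := phi_local tT (b2 X bX) (b2 Z bZ) FA XZ2.
have onA : {ae P, forall w, A w -> phi t X w = phi t Z w}.
  by apply: filterS3 loc (one t C X tN bX) (one t C Z tN bZ) => w h -> -> /h.
apply: filterS2 now onA => w h1 h2.
by have [Aw|nA] := pselect (A w); [exact: h2|apply: h1; apply: contrapT].
Qed.

End Filtered.

Theorem theorem4p22 (d : measure_display) (Omega : measurableType d)
    (R : realType) (P : probability Omega R)
    (F : nat -> set (set Omega))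
    (hF : filtration F) (hF0 : F 0%N = [set set0; setT])
    (T : option nat)
    (phi : nat -> (nat -> Omega -> R) -> Omega -> R)
    (hphi : utility_process P F T phi)
    (gamma : nat -> (nat -> Omega -> R) -> Omega -> \bar R)
    (hgamma : forall t : nat, le_time (Some t) T ->
       special_penalty P F (cst_time t) (cst T) (gamma t))
    (hrep : forall t : nat, le_time (Some t) T ->
       forall X : nat -> Omega -> R, Rinf_on P F (cst_time t) (cst T) X ->
       aeq P (fun w => (phi t X w)%:E)
         (essinf P
            [set (fun w =>
                    ((pairing P F (cst_time t) (cst T) X a w)%:E
                     - gamma t a w)%E)
             | a in dual P F (cst_time t) (cst T)]))
    (hcond :
       (forall t : nat, le_time (Some t) T ->
        forall theta : Omega -> option nat,
          stopping_time F theta -> ae_finite P theta ->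
          ae_le_time P (cst_time t) theta -> ae_le_time P theta (cst T) ->
          penalty_decomposition P F T gamma t theta)
       \/
       (exists2 N : nat, T = Some N &
        forall t : nat, (t < N)%N ->
          penalty_decomposition P F T gamma t (cst_time t.+1))) :
  time_consistent P F T phi.
Proof.
have step t theta C X : le_time (Some t) T -> stopping_time F theta ->
    ae_finite P theta -> ae_le_time P (cst_time t) theta ->
    ae_le_time P theta (cst T) -> penalty_decomposition P F T gamma t theta ->
    bounded_on P F T t C X ->
    aeq P (phi t X) (phi t (stopped_utility T phi t theta X)).
  move=> tT htheta fin_theta t_theta theta_T hdec bX.
  have [Psi mPsi PhiPsi] := utility_at_version hF hphi htheta fin_theta theta_T bX.
  exact: (stopped_utility_aeq hF hphi htheta fin_theta theta_T hgamma hrep tT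
    t_theta bX mPsi PhiPsi hdec).
move=> t tT theta htheta fin_theta t_theta theta_T X /(Rinf_onP P F X tT)[C bX].
case: hcond => [h|[N TN h]].
  by apply: step bX => //; exact: h.
have tN : (t <= N)%N by move: tT; rewrite TN.
apply: (time_consistent_recursion hF hphi TN _ (subnKC tN) htheta fin_theta
  t_theta theta_T bX) => s C' Y sN bY.
apply: step bY.
- by rewrite TN /= ltnW.
- exact: stopping_cst.
- exact: aeW.
- by apply: aeW => w /=.
- by apply: aeW => w; rewrite TN.
- exact: h.
Qed.
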